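(* For $i=1,2$, let $M_i$ be a compact, oriented $n$-dimensional manifold equipped with a smooth family of Riemannian metrics $g_i(t)$ satisfying the Ricci flow equation $\frac{\partial g_i(t)}{\partial t} = -2\operatorname{Ric}(g_i(t))$ for $t\in[0,T_i)$, and let $T=\min(T_1,T_2)$. Consider a one-parameter family of distance functions $D^t$, $t\in[0,T)$, on the disjoint union $M_1\sqcup M_2$ such that, for every $t\in[0,T)$, $(M_1\sqcup M_2,D^t)$ is a complete, compact metric space with $D^t|_{M_i}=d_{g_i(t)}$ for $i=1,2$. Suppose that for $t\in(0,T)$, $$\frac{\partial}{\partial t}D^t(x,y)\ \geq\ \Delta_{M_1^t\times M_2^t}D^t(x,y)\qquad\text{for } x\in M_1,\ y\in M_2.$$ Then the family of metrics $D^t$ is a super Ricci flow of the disjoint union $M_1\sqcup M_2$.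
   Context: Here $d_g$ denotes the distance function induced by a Riemannian metric $g$, and $\Delta_{M_1^t\times M_2^t}$ denotes the Laplacian on the Riemannian product $(M_1,g_1(t))\times(M_2,g_2(t))$. Definition (super Ricci flow of a disjoint union). The family $D^t$ on $M_1\sqcup M_2$, $t\in[0,T)$, is called a super Ricci flow of the disjoint union $M_1\sqcup M_2$ if, whenever $0<a<b<T$ and $u:(M_1\sqcup M_2)\times(a,b)\to\mathbb{R}$ is a solution to the heat equation on $M_1\sqcup M_2$, the quantity $$\operatorname{Lip}(u,t):=\sup_{x\neq y,\ x,y\in M_1\sqcup M_2}\frac{|u(x,t)-u(y,t)|}{D^t(x,y)}$$ is non-increasing in $t$. Heat equation on the disjoint union: $u:(M_1\sqcup M_2)\times(a,b)\to\mathbb{R}$ is a solution to the heat equation on $M_1\sqcup M_2$ when, for each $i=1,2$, the restriction $u_i=u|_{M_i\times(a,b)}$ is a smooth solution of $\frac{\partial u_i}{\partial t}=\Delta_{g_i(t)}u_i$ on $M_i$. *)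

(* Defs.v *)
From HB Require Import structures.
From mathcomp Require Import all_boot all_order all_algebra.
From mathcomp Require Import all_classical all_reals all_analysis.
Import Order.TTheory GRing.Theory Num.Theory.
Import numFieldNormedType.Exports.

Set Implicit Arguments.
Unset Strict Implicit.
Unset Printing Implicit Defensive.

Local Open Scope classical_set_scope.
Local Open Scope ring_scope.

Section smoothness.
Context {R : realType} {V W : normedModType R}.
Implicit Types (A U : set V) (f h : V -> W).

Definition iter_derive (vs : seq V) f : V -> W :=
  foldr (fun v h x => 'D_v h x) f vs.

(* The next two notions are meant for open sets [U]: [f] is [k] times
   differentiable on [U] when its iterated directional derivatives of order
   less than [k] are all (Frechet) differentiable at every point of [U]. *)
Definition differentiable_upto (k : nat) U f :=
  forall vs : seq V, (size vs < k)%N ->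
  forall x, U x -> differentiable (iter_derive vs f) x.

Definition smooth_on U f := forall k, differentiable_upto k U f.

(* Smoothness on an arbitrary set [A]: existence of local smooth extensions.
   This is used for half-open time intervals [0, T[. *)
Definition smooth_in A f := forall x, A x ->
  exists2 U, open_nbhs x U &
  exists2 h, smooth_on U h & forall y, A y -> U y -> h y = f y.

End smoothness.

(* [cinv] is only meaningful on the image of the chart domain. *)
Record chart (R : realType) (n : nat) (M : topologicalType) := Chart {
  cdom : set M ;
  cmap :> M -> 'rV[R]_n ;
  cinv : 'rV[R]_n -> M ;
  open_cdom : open cdom ;
  open_cimg : open (cmap @` cdom) ;
  cmap_continuous : forall p, cdom p -> {for p, continuous cmap} ;
  cinv_continuous :
    forall x, (cmap @` cdom) x -> {for x, continuous cinv} ;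
  cmapK : forall p, cdom p -> cinv (cmap p) = p
}.

Definition cimg R n M (c : @chart R n M) : set 'rV[R]_n := c @` cdom c.

Definition transition R n M (c c' : @chart R n M) : 'rV[R]_n -> 'rV[R]_n :=
  c' \o cinv c.

(* An oriented smooth n-manifold is given by an atlas all of whose transition
   maps are smooth with positive Jacobian determinant.  The atlas need not be
   maximal; [chart_at] selects a chart around each point, and is only used to
   evaluate chart-independent expressions. *)
Record orientedManifold (R : realType) (n : nat) (M : topologicalType) :=
  OrientedManifold {
  atlas : set (chart R n M) ;
  chart_at : M -> chart R n M ;
  manifold_hausdorff : hausdorff_space M ;
  manifold_second_countable : @second_countable M ;
  atlas_chart_at : forall p, atlas (chart_at p) ;
  cdom_chart_at : forall p, cdom (chart_at p) p ;
  atlas_smooth : forall c c', atlas c -> atlas c' ->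
    smooth_on (c @` (cdom c `&` cdom c')) (transition c c') ;
  atlas_oriented : forall c c' p, atlas c -> atlas c' ->
    cdom c p -> cdom c' p -> 0 < \det ('J (transition c c') (c p))
}.

Section coordinates.
Context {R : realType} {n : nat}.
Implicit Types (G : 'rV[R]_n -> 'M[R]_n) (x : 'rV[R]_n) (i j k l m : 'I_n).

Definition partial i (f : 'rV[R]_n -> R) x : R := 'D_(delta_mx 0 i) f x.

(* Christoffel symbols of the second kind, upper index first. *)
Definition christoffel G k i j x : R :=
  2^-1 * \sum_l invmx (G x) k l *
    (partial i (fun y => G y j l) x + partial j (fun y => G y i l) x
     - partial l (fun y => G y i j) x).

(* [riemann G l k i j] is the d_l-component of R(d_i, d_j) d_k, where
   R(X, Y) Z = nabla_X nabla_Y Z - nabla_Y nabla_X Z - nabla_[X, Y] Z. *)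
Definition riemann G l k i j x : R :=
  partial i (christoffel G l j k) x - partial j (christoffel G l i k) x
  + \sum_m (christoffel G l i m x * christoffel G m j k x
            - christoffel G l j m x * christoffel G m i k x).

(* Ric(Y, Z) is the trace of X |-> R(X, Y) Z. *)
Definition ricci G x : 'M[R]_n := \matrix_(j, k) \sum_i riemann G i k i j x.

(* The trace of the covariant Hessian. *)
Definition coord_laplacian G (f : 'rV[R]_n -> R) x : R :=
  \sum_i \sum_j invmx (G x) i j *
    (partial i (partial j f) x - \sum_k christoffel G k i j x * partial k f x).

End coordinates.

(* A field of symmetric 2-tensors, given by its matrix in each chart as a
   function of the coordinates. *)
Definition tensor (R : realType) (n : nat) (M : topologicalType) :=
  chart R n M -> 'rV[R]_n -> 'M[R]_n.

Section riemannian_manifold.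
Context {R : realType} {n : nat} {M : topologicalType}.
Variable A : orientedManifold R n M.
Implicit Types (g : tensor R n M) (f : M -> R) (gamma : R^o -> M).

(* The transformation law uses that ['J] acts on row vectors from the right. *)
Definition is_riemannian g :=
  [/\ forall c i j, atlas A c -> smooth_on (cimg c) (fun x => g c x i j),
      forall c x, atlas A c -> cimg c x -> (g c x)^T = g c x,
      forall c x (v : 'rV[R]_n), atlas A c -> cimg c x -> v != 0 ->
        0 < (v *m g c x *m v^T) 0 0 &
      forall c c' p, atlas A c -> atlas A c' -> cdom c p -> cdom c' p ->
        let J := 'J (transition c c') (c p) in
        g c (c p) = J *m g c' (c' p) *m J^T].

(* A smooth curve on [0, 1] is the restriction of one that is smooth on an
   open neighbourhood of [0, 1]. *)
Definition smooth_curve gamma := forall t, 0 <= t <= 1 ->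
  let c := chart_at A (gamma t) in
  exists2 U : set R^o, open_nbhs (t : R^o) U &
    (forall s, U s -> cdom c (gamma s)) /\ smooth_on U (c \o gamma).

Definition speed g gamma (t : R) : R :=
  let c := chart_at A (gamma t) in
  let v := 'D_1 (c \o gamma) (t : R^o) in
  Num.sqrt ((v *m g c (c (gamma t)) *m v^T) 0 0).

Definition curve_length g gamma : \bar R :=
  (\int[@lebesgue_measure R]_(t in `[0%R, 1%R]) (speed g gamma t)%:E)%E.

(* [path_length g x y l]: some concatenation of finitely many smooth curves
   leads from [x] to [y] and has length [l]. *)
Inductive path_length g : M -> M -> \bar R -> Prop :=
| path_length_nil x : path_length g x x 0%E
| path_length_cons gamma y l : smooth_curve gamma ->
    path_length g (gamma 1) y l ->
    path_length g (gamma 0) y (curve_length g gamma + l)%E.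

Definition riemannian_dist g (x y : M) : \bar R :=
  ereal_inf [set l | path_length g x y l].

Definition laplacian g f (p : M) : R :=
  let c := chart_at A p in coord_laplacian (g c) (f \o cinv c) (c p).

(* At t = 0 the time derivative is one-sided. *)
Definition is_ricci_flow (T : \bar R) (g : R -> tensor R n M) :=
  [/\ forall t : R, 0 <= t -> (t%:E < T)%E -> is_riemannian (g t),
      forall c i j, atlas A c ->
        smooth_in [set z : R^o * 'rV[R]_n |
                    [/\ 0 <= z.1, (z.1%:E < T)%E & cimg c z.2]]
          (fun z => g z.1 c z.2 i j : R) &
      forall (t : R) c x, 0 <= t -> (t%:E < T)%E -> atlas A c -> cimg c x ->
        (fun s : R => (s - t)^-1 *: (g s c x - g t c x))
          @ within [set s : R | 0 <= s /\ (s%:E < T)%E] t^'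
          --> (- 2) *: ricci (g t c) x].

Definition is_heat_solution (a b : R) (g : R -> tensor R n M)
    (u : M -> R -> R) :=
  (forall c, atlas A c ->
     smooth_on [set z : R^o * 'rV[R]_n | a < z.1 < b /\ cimg c z.2]
       (fun z => u (cinv c z.2) z.1 : R)) /\
  (forall t p, a < t < b -> derive1 (u p) t = laplacian (g t) (u^~ t) p).

End riemannian_manifold.

Section product_manifold.
Context {R : realType} {n1 n2 : nat} {M1 M2 : topologicalType}.
Implicit Types (f : M1 -> M2 -> R).

(* Product charts take values in 'rV_(n1 + n2), the two blocks being the
   coordinates on [M1] and [M2]. *)
Definition prod_cimg (c1 : chart R n1 M1) (c2 : chart R n2 M2)
    : set 'rV[R]_(n1 + n2) :=
  [set z | cimg c1 (lsubmx z) /\ cimg c2 (rsubmx z)].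

Definition prod_coord (c1 : chart R n1 M1) (c2 : chart R n2 M2) f
    (z : 'rV[R]_(n1 + n2)) : R :=
  f (cinv c1 (lsubmx z)) (cinv c2 (rsubmx z)).

Definition prod_metric (g1 : tensor R n1 M1) (g2 : tensor R n2 M2)
    (c1 : chart R n1 M1) (c2 : chart R n2 M2) (z : 'rV[R]_(n1 + n2)) : 'M[R]_(n1 + n2) :=
  block_mx (g1 c1 (lsubmx z)) 0 0 (g2 c2 (rsubmx z)).

Variables (A1 : orientedManifold R n1 M1) (A2 : orientedManifold R n2 M2).

Definition prod_laplacian (g1 : tensor R n1 M1) (g2 : tensor R n2 M2) f
    (p : M1) (q : M2) : R :=
  let c1 := chart_at A1 p in let c2 := chart_at A2 q in
  coord_laplacian (prod_metric g1 g2 c1 c2) (prod_coord c1 c2 f)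
    (row_mx (c1 p) (c2 q)).

Definition twice_differentiable_prod f :=
  forall c1 c2, atlas A1 c1 -> atlas A2 c2 ->
  differentiable_upto 2 (prod_cimg c1 c2) (prod_coord c1 c2 f).

End product_manifold.

Record distance (R : realType) (X : choiceType) := Distance {
  dist_fun :> X -> X -> R ;
  dist_xx : forall x, dist_fun x x = 0 ;
  dist_eq0 : forall x y, dist_fun x y = 0 -> x = y ;
  dist_sym : forall x y, dist_fun x y = dist_fun y x ;
  dist_triangle :
    forall y x z, dist_fun x z <= dist_fun x y + dist_fun y z
}.

(* [X] with the topology and uniformity of [d], and not any it already has. *)
Definition metric_space (R : realType) (X : choiceType) (d : distance R X)
  : Type := X.

HB.instance Definition _ (R : realType) (X : choiceType) (d : distance R X) :=
  Choice.copy (metric_space d) X.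
HB.instance Definition _ (R : realType) (X : choiceType) (d : distance R X) :=
  isMetric.Build R (metric_space d)
    (dist_xx d) (@dist_eq0 _ _ d) (dist_sym d) (dist_triangle d).

Definition complete_space (T : uniformType) :=
  forall F : set_system T, ProperFilter F -> cauchy F -> exists x : T, F --> x.

Definition is_complete_compact_metric (R : realType) (X : choiceType)
    (d : X -> X -> R) :=
  exists m : distance R X,
    [/\ d = m, complete_space (metric_space m)
      & compact [set: metric_space m]].

(* The supremum is taken in the extended reals. *)
Definition Lip (R : realType) (X : Type) (d : X -> X -> R) (u : X -> R)
  : \bar R :=
  ereal_sup [set r | exists x y, x <> y /\ r = (`|u x - u y| / d x y)%:E].

Section super_ricci_flow.
Context {R : realType} {n : nat} {M1 M2 : topologicalType}.
Variables (A1 : orientedManifold R n M1) (A2 : orientedManifold R n M2).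
Variables (g1 : R -> tensor R n M1) (g2 : R -> tensor R n M2).

Definition is_heat_solution_sum (a b : R) (u : M1 + M2 -> R -> R) :=
  is_heat_solution A1 a b g1 (fun p => u (inl p)) /\
  is_heat_solution A2 a b g2 (fun p => u (inr p)).

Definition is_super_ricci_flow (T : \bar R)
    (D : R -> M1 + M2 -> M1 + M2 -> R) :=
  forall (a b : R) (u : M1 + M2 -> R -> R),
    0 < a -> a < b -> (b%:E < T)%E -> is_heat_solution_sum a b u ->
  forall s t, a < s -> s <= t -> t < b ->
    (Lip (D t) (u^~ t) <= Lip (D s) (u^~ s))%E.

End super_ricci_flow.

(* Main.v *)
(* A Lipschitz bound for u at time s is propagated to later times separately
   for pairs of points in the same M_i and for pairs (x, y) in M_1 x M_2.

   For pairs in the same M_i: the Lipschitz constant with respect to d_g(t) is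
   the supremum of |grad u|.  Under the Ricci flow the Bochner formula reads
   (d/dt - Laplacian) |grad u|^2 = - 2 |Hess u|^2, the term produced by dg/dt
   cancelling the Ricci curvature term, so this supremum does not increase by
   the maximum principle.

   For x in M_1 and y in M_2: by hypothesis the functions
   +-(u(x,t) - u(y,t)) - L D^t(x,y) are subsolutions of the heat equation on the
   product, so the maximum principle on the compact M_1 x M_2 keeps them
   nonpositive.  They are jointly continuous in (x,y,t) because, by the triangle
   inequality, D^t is controlled by the distances d_g_i(t). *)

Require Import Defs.
From mathcomp Require Import all_boot all_order all_algebra.
From mathcomp Require Import all_classical all_reals all_analysis.
From mathcomp Require Import measurable_realfun.
From mathcomp Require Import ring lra.
Import Order.TTheory GRing.Theory Num.Theory.
Import numFieldNormedType.Exports.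

Set Implicit Arguments.
Unset Strict Implicit.
Unset Printing Implicit Defensive.

Local Open Scope classical_set_scope.
Local Open Scope ring_scope.

(** * Iterated directional derivatives *)

(** The operators in the statement are coordinate formulas read in a selected chart, so tensor
    calculus is done with matrix-valued functions: for a fixed direction the Christoffel symbols
    form a matrix, covariant derivatives become matrix products, and the curvature is a commutator.
    The chart selected at a point may jump as the point varies, whereas derivatives and maxima
    involve neighbouring points; hence the proof that the squared gradient and the Laplacian agree
    in all charts of the atlas.

    Lipschitz constants and gradients are compared without geodesics: a Lipschitz bound is tested on
    short chart segments in the gradient direction, and a gradient bound is integrated along
    arbitrary piecewise smooth curves. Integration divides by the constant, so [L] is first replaced
    by [L + e].

    In both uses of the maximum principle the sign of the time derivative is known only at spatial
    maxima, and only weakly; a penalty linear in time makes it strict. At such a maximum first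
    derivatives vanish, so the Bochner formula is needed only at critical points of the squared
    gradient, where the Christoffel terms of its Laplacian drop out. *)

Section upto.
Context {R : realType} {V W : normedModType R}.
Implicit Types (U : set V) (f h : V -> W).

Lemma near_eq_differentiable f h x :
  (\forall y \near x, f y = h y) -> differentiable f x -> differentiable h x.
Proof.
move=> fh /diff_locallyP[dfc dfE].
have fhx := nbhs_singleton fh.
have E : h \o shift x = cst (h x) + 'd f x +o_ 0 id.
  apply/eqaddoP => e e0.
  move/eqaddoP: dfE => /(_ e e0) H.
  near=> y.
  have hf : f (y + x) = h (y + x).
    near: y.
    by move: fh; rewrite (near_shift 0) subr0.
  suff : `|(f \o shift x - (cst (f x) + 'd f x)) y| <= e * `|id y|.
    by rewrite !fctE /= hf fhx.
  by near: y.
have dE := diff_unique dfc E.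
by apply/diff_locallyP; rewrite dE.
Unshelve. all: by end_near. Qed.

Lemma open_eq_near U f h x : open U -> (forall y, U y -> f y = h y) -> U x ->
  \forall y \near x, f y = h y.
Proof.
by move=> oU fh Ux; apply: filterS (open_nbhs_nbhs (conj oU Ux)).
Qed.

(** In [iter_derive] the last direction of the list is applied to [f] first, hence the [rcons]
    decomposition. This recursive form drives the inductions on [k] below. *)
Lemma differentiable_uptoS k U f : differentiable_upto k.+1 U f <->
  (forall x, U x -> differentiable f x) /\
  (forall v, differentiable_upto k U ('D_v f)).
Proof.
split=> [H|[H0 H1] vs].
  split=> [x Ux|v vs vsk x Ux]; first exact: (H [::]).
  by have := H (rcons vs v); rewrite size_rcons /iter_derive foldr_rcons; apply.
elim/last_ind: vs => [|vs v _] vsk x Ux; first exact: H0.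
rewrite /iter_derive foldr_rcons; apply: (H1 v) => //.
by rewrite size_rcons in vsk.
Qed.

Lemma differentiable_upto_congr k U f h : open U ->
  (forall y, U y -> f y = h y) ->
  differentiable_upto k U f -> differentiable_upto k U h.
Proof.
move=> oU; elim: k f h => [|k IH] f h fh; first by move=> _ vs.
move=> /differentiable_uptoS[H0 H1]; apply/differentiable_uptoS; split.
  move=> x Ux; apply: near_eq_differentiable (H0 x Ux).
  exact: open_eq_near oU fh Ux.
move=> v; apply: IH (H1 v) => y Uy.
by apply: near_eq_derive; apply: open_eq_near oU fh Uy.
Qed.

Lemma differentiable_uptoW k U f :
  differentiable_upto k.+1 U f -> differentiable_upto k U f.
Proof. by move=> H vs vsk; apply: H; apply: ltnW. Qed.

Lemma differentiable_upto_sub k U U' f : U' `<=` U ->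
  differentiable_upto k U f -> differentiable_upto k U' f.
Proof. by move=> UU H vs vsk x /UU; apply: H. Qed.

Lemma smooth_on_derive U f v : smooth_on U f -> smooth_on U ('D_v f).
Proof. by move=> H k; case/differentiable_uptoS: (H k.+1). Qed.

Lemma differentiable_upto_cst k U (w : W) : differentiable_upto k U (cst w).
Proof.
elim: k w => [|k IH] w; first by move=> vs.
apply/differentiable_uptoS; split=> [x _|v]; first exact: differentiable_cst.
have -> : 'D_v (cst w) = cst 0 :> (V -> W).
  by apply/funext => x; rewrite derive_cst.
exact: IH.
Qed.

Lemma differentiable_uptoD k U f h : open U ->
  differentiable_upto k U f -> differentiable_upto k U h ->
  differentiable_upto k U (f + h).
Proof.
move=> oU; elim: k f h => [|k IH] f h; first by move=> _ _ vs.
move=> /differentiable_uptoS[f0 f1] /differentiable_uptoS[h0 h1].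
apply/differentiable_uptoS; split=> [x Ux|v].
  by apply: differentiableD; [apply: f0|apply: h0].
apply: differentiable_upto_congr (IH _ _ (f1 v) (h1 v)) => // y Uy.
by rewrite deriveD//; apply: diff_derivable; [apply: f0|apply: h0].
Qed.

Lemma smooth_on_differentiable U f x : smooth_on U f -> U x -> differentiable f x.
Proof. by move=> fs; apply: (fs 1%N [::]). Qed.

Lemma smooth_on_congr U f h : open U -> (forall x, U x -> f x = h x) ->
  smooth_on U f -> smooth_on U h.
Proof. by move=> oU fh fs k; apply: differentiable_upto_congr fh (fs k). Qed.

End upto.

Section upto_real.
Context {R : realType} {V : normedModType R}.
Implicit Types (U : set V) (f h : V -> R).

Lemma differentiable_uptoM k U f h : open U ->
  differentiable_upto k U f -> differentiable_upto k U h ->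
  differentiable_upto k U (f * h).
Proof.
move=> oU; elim: k f h => [|k IH] f h; first by move=> _ _ vs.
move=> fk hk.
have fk' := differentiable_uptoW fk.
have hk' := differentiable_uptoW hk.
move: fk hk => /differentiable_uptoS[f0 f1] /differentiable_uptoS[h0 h1].
apply/differentiable_uptoS; split=> [x Ux|v].
  by apply: differentiableM; [apply: f0|apply: h0].
have := differentiable_uptoD oU (IH _ _ fk' (h1 v)) (IH _ _ hk' (f1 v)).
apply: differentiable_upto_congr => // y Uy.
by rewrite deriveM//; apply: diff_derivable; [apply: f0|apply: h0].
Qed.

(** The derivative of the inverse is a product of the derivative of [f] with two copies of the
    inverse itself, which by induction has one order less. *)
Lemma differentiable_uptoV k U f : open U -> (forall x, U x -> f x != 0) ->
  differentiable_upto k U f -> differentiable_upto k U (fun x => (f x)^-1).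
Proof.
move=> oU f_neq0; elim: k => [|k IH]; first by move=> _ vs.
move=> fk; have fk' := differentiable_uptoW fk.
move: fk => /differentiable_uptoS[f0 f1].
apply/differentiable_uptoS; split=> [x Ux|v].
  by apply: differentiableV; [apply: f0|apply: f_neq0].
have := differentiable_uptoM oU (differentiable_upto_cst (U := U) (-1 : R))
  (differentiable_uptoM oU (f1 v) (differentiable_uptoM oU (IH fk') (IH fk'))).
apply: differentiable_upto_congr => // y Uy.
rewrite deriveV ?f_neq0//; last exact/diff_derivable/f0.
by rewrite /GRing.mul/= mulN1r -exprVn expr2 scaleNr mulrC /GRing.scale/= mulrC.
Qed.

End upto_real.

(** * Precomposition with affine maps *)

Section affine.
Context {R : realType} {V' V W : normedModType R}.
Variables (aff l : V' -> V).
Hypothesis affE : forall h v x, aff (h *: v + x) = h *: l v + aff x.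
Implicit Types (f : V -> W).

(** The two difference quotients are the same function of [h], so directional derivatives and
    derivability transport exactly, for arbitrary [f]. The affine maps in question are straight
    lines, the time and space slices of space-time, and the two projections of a product chart. *)
Lemma growth_rate_affine f x v :
  (fun h : R => h^-1 *: (((f \o aff) \o shift x) (h *: v) - (f \o aff) x)) =
  (fun h => h^-1 *: ((f \o shift (aff x)) (h *: l v) - f (aff x))).
Proof. by apply/funext => h /=; rewrite affE. Qed.

Lemma derive_affine f x v : 'D_v (f \o aff) x = 'D_(l v) f (aff x).
Proof. by rewrite /derive growth_rate_affine. Qed.

Lemma derivable_affine f x v :
  derivable (f \o aff) x v = derivable f (aff x) (l v).
Proof. by rewrite /derivable growth_rate_affine. Qed.

Lemma iter_derive_affine vs f :
  iter_derive vs (f \o aff) = iter_derive (map l vs) f \o aff.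
Proof.
elim: vs => //= v vs IH; rewrite [iter_derive _ _]/= -/(iter_derive vs _) IH.
by apply/funext => x; rewrite derive_affine.
Qed.

Lemma differentiable_upto_affine k (U : set V) (U' : set V') f :
  (forall x, differentiable aff x) -> (forall x, U' x -> U (aff x)) ->
  differentiable_upto k U f -> differentiable_upto k U' (f \o aff).
Proof.
move=> daff UU fk vs vsk x Ux; rewrite iter_derive_affine.
by apply: differentiable_comp => //; apply: fk; [rewrite size_map|apply: UU].
Qed.

End affine.

Section line.
Context {R : realType} {V : normedModType R}.
Implicit Types (x v : V).

Lemma line_affine v x h (s r : R^o) :
  x + (h *: s + r) *: v = h *: (s *: v) + (x + r *: v).
Proof. by rewrite scalerDl scalerA addrCA. Qed.

Lemma differentiable_line v x (s : R^o) :
  differentiable (fun r : R^o => x + r *: v) s.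
Proof.
apply: differentiableD; first exact: differentiable_cst.
exact: differentiableZl.
Qed.

Lemma is_derive_line (W : normedModType R) (f : V -> W) v x (s : R) :
  derivable f (x + s *: v) v ->
  is_derive (s : R) 1 (fun r : R => f (x + r *: v)) ('D_v f (x + s *: v)).
Proof.
move=> fd.
have H := line_affine v x.
split.
  by rewrite (derivable_affine H f s (1 : R^o)) scale1r.
by rewrite (derive_affine H f s (1 : R^o)) scale1r.
Qed.

End line.

(** * Symmetry of second derivatives and the second-derivative test *)

Section schwarz.
Context {R : realType} {V : normedModType R}.
Implicit Types (f : V -> R) (U : set V).

Lemma differentiable_ball f x (e : R) : differentiable f x -> 0 < e ->
  exists2 d : R, 0 < d & forall y, `|y| < d ->
    `|f (x + y) - f x - 'd f x y| <= e * `|y|.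
Proof.
move=> /diff_locally/eqaddoP H e0.
have [d /= d0 dH] := (nbhs_ballP _ _).1 (H e e0).
exists d => // y yd.
have : ball 0 d y by rewrite -ball_normE /= sub0r normrN.
by move/dH; rewrite !fctE /= [y + x]addrC opprD addrA.
Qed.

(* The mean value theorem in the direction [v] followed by the differentiability
   of ['D_v f] at [x]; the left-hand side is symmetric in [v] and [w]. *)
Lemma second_difference f U x v w (e : R) : open U -> U x -> 0 < e ->
  differentiable_upto 2 U f ->
  \forall h \near 0^'+, `|f (x + h *: v + h *: w) - f (x + h *: v)
     - f (x + h *: w) + f x - h * h * 'D_w ('D_v f) x| <= e * (h * h).
Proof.
move=> oU Ux e0 /differentiable_uptoS[f0 /(_ v)/differentiable_uptoS[f1 _]].
(* [h * K] bounds every [a *: v + b *: w] with [a] and [b] between 0 and [h], so a small [h] keeps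
   the whole parallelogram in any given ball. *)
pose K := 1 + `|v| + `|w|.
have K0 : 0 < K by rewrite /K; have := normr_ge0 v; have := normr_ge0 w; lra.
(* With precision [e / (2 * K)] each of the two first-order expansions below has error at most
   [e * h / 2]; the mean value theorem contributes the other factor [h]. *)
have [d d0 dH] := differentiable_ball (f1 x Ux) (divr_gt0 e0 (mulr_gt0 (ltr0n _ 2) K0)).
have [d' /= d'0 d'H] := (nbhs_ballP _ _).1 (open_nbhs_nbhs (conj oU Ux)).
near=> h.
have h0 : 0 < h by near: h; exact: nbhs_right_gt.
have hd : h < d / K by near: h; apply: nbhs_right_lt; rewrite divr_gt0.
have hd' : h < d' / K by near: h; apply: nbhs_right_lt; rewrite divr_gt0.
have hn0 : h != 0 by rewrite gt_eqF.
have Kn0 : K != 0 by rewrite gt_eqF.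
rewrite ltr_pdivlMr// in hd; rewrite ltr_pdivlMr// in hd'.
have nle a b : 0 <= a -> a <= h -> 0 <= b -> b <= h -> `|a *: v + b *: w| <= h * K.
  move=> a0 ah b0 bh; apply: le_trans (ler_normD _ _) _.
  rewrite !normrZ !ger0_norm// /K.
  have := ler_wpM2r (normr_ge0 v) ah; have := ler_wpM2r (normr_ge0 w) bh.
  lra.
have inU a b : 0 <= a -> a <= h -> 0 <= b -> b <= h -> U (x + (a *: v + b *: w)).
  move=> a0 ah b0 bh; apply: d'H; rewrite -ball_normE /= opprD addNKr normrN.
  by apply: le_lt_trans (nle _ _ a0 ah b0 bh) _.
(* The second difference is [phi h - phi 0], that is, [h] times a difference of two values of
   ['D_v f], each then expanded at [x]. *)
pose phi s : R := f (x + h *: w + s *: v) - f (x + s *: v).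
have dphi s : 0 <= s <= h -> is_derive (s : R) 1 phi
    ('D_v f (x + h *: w + s *: v) - 'D_v f (x + s *: v)).
  move=> /andP[s0 sh]; apply: is_deriveB; apply: is_derive_line;
    apply: diff_derivable; apply: f0.
    by rewrite -addrA [h *: w + _]addrC; apply: inU => //; apply: ltW.
  rewrite -[s *: v]addr0 -(scale0r w); apply: inU => //; exact: ltW.
have dphi' s : s \in `]0, h[ -> is_derive (s : R) 1 phi
    ('D_v f (x + h *: w + s *: v) - 'D_v f (x + s *: v)).
  by rewrite in_itv /= => /andP[s0 sh]; apply: dphi; rewrite !ltW.
have [|c cI] := MVT h0 dphi'.
  apply: continuous_in_subspaceT => s; rewrite inE /= in_itv /= => sI.
  apply: differentiable_continuous; apply/derivable1_diffP.
  by have [] := dphi s sI.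
rewrite /phi scale0r !addr0 subr0 => E.
have [c0 ch] : 0 <= c /\ c <= h by move: cI; rewrite in_itv /= => /andP[/ltW-> /ltW->].
have -> : f (x + h *: v + h *: w) - f (x + h *: v) - f (x + h *: w) + f x =
  (f (x + h *: w + h *: v) - f (x + h *: v)) - (f (x + h *: w) - f x).
  by rewrite [x + h *: w + h *: v]addrAC; ring.
rewrite E (deriveE _ (f1 _ Ux)).
set A := 'D_v f (x + h *: w + c *: v); set B := 'D_v f (x + c *: v).
have hA : `|A - 'D_v f x - 'd ('D_v f) x (c *: v + h *: w)| <= e / (2 * K) * (h * K).
  have n := nle c h c0 ch (ltW h0) (lexx h).
  apply: le_trans (ler_wpM2l _ n); last first.
    by rewrite divr_ge0 ?(ltW e0)// mulr_ge0 ?ltW.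
  rewrite /A -[x + _ + _]addrA [h *: w + _]addrC; apply: dH.
  exact: le_lt_trans n hd.
have hB : `|B - 'D_v f x - 'd ('D_v f) x (c *: v)| <= e / (2 * K) * (h * K).
  have n := nle c 0 c0 ch (lexx 0) (ltW h0).
  rewrite scale0r addr0 in n.
  apply: le_trans (ler_wpM2l _ n); last first.
    by rewrite divr_ge0 ?(ltW e0)// mulr_ge0 ?ltW.
  apply: dH; exact: le_lt_trans n hd.
have Ke : e / (2 * K) * (h * K) = e * h / 2.
  by field; rewrite ?hn0 ?Kn0.
rewrite Ke in hA hB.
have -> : 'd ('D_v f) x w = h^-1 * ('d ('D_v f) x (c *: v + h *: w) -
   'd ('D_v f) x (c *: v)).
  rewrite linearD addrC addKr linearZ /= /GRing.scale /= mulKf //.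
set P := 'd _ _ _ in hA *; set Q := 'd _ _ _ in hB *.
have -> : (A - B) * h - h * h * (h^-1 * (P - Q)) = h * ((A - B) - (P - Q)).
  by field; rewrite ?hn0 ?Kn0.
rewrite normrM gtr0_norm// mulrCA ler_pM2l//.
have -> : A - B - (P - Q) = (A - 'D_v f x - P) - (B - 'D_v f x - Q) by ring.
apply: le_trans (ler_normB _ _) _; lra.
Unshelve. all: by end_near. Qed.

Let difference_quotient_le (a b c d h A B e : R) : 0 < h ->
  `|a - b - c + d - h * h * B| <= e / 2 * (h * h) ->
  `|a - c - b + d - h * h * A| <= e / 2 * (h * h) -> `|A - B| <= e.
Proof.
move=> h0 HB HA; rewrite -(ler_pM2l (mulr_gt0 h0 h0)).
have -> : h * h * `|A - B| = `|h * h * A - h * h * B|.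
  by rewrite -mulrBr normrM (gtr0_norm (mulr_gt0 h0 h0)).
have -> : h * h * A - h * h * B =
  (a - b - c + d - h * h * B) - (a - c - b + d - h * h * A) by ring.
apply: le_trans (ler_normB _ _) _; lra.
Qed.

(** One and the same second difference, divided by [h * h], approximates both mixed derivatives
    within [e / 2]. *)
Lemma derive_comm f U x v w : open U -> U x -> differentiable_upto 2 U f ->
  'D_v ('D_w f) x = 'D_w ('D_v f) x.
Proof.
move=> oU Ux f2; apply/eqP; rewrite -subr_eq0 -normr_le0.
apply/ler_addgt0Pr => e e0.
have e20 : 0 < e / 2 by lra.
have S1 := second_difference v w oU Ux e20 f2.
have S2 := second_difference w v oU Ux e20 f2.
have [h [h0 [Hv Hw]]] := filter_ex (filterI (nbhs_right_gt 0) (filterI S1 S2)).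
rewrite /= in h0.
rewrite [x + h *: w + _]addrAC in Hw.
by rewrite add0r; exact: difference_quotient_le h0 Hv Hw.
Qed.

(** Differentiability of ['D_v f] at [x] suffices for the second part: a positive second derivative
    would make ['D_v f] positive just after [x] on the line, and the mean value theorem would
    produce a larger value of [f]. *)
Lemma derive_at_max f U x v : open U -> U x -> differentiable_upto 2 U f ->
  (forall y, U y -> f y <= f x) ->
  'D_v f x = 0 /\ 'D_v ('D_v f) x <= 0.
Proof.
move=> oU Ux /differentiable_uptoS[f0 /(_ v)/differentiable_uptoS[f1 _]] fmax.
have [d' /= d'0 d'H] := (nbhs_ballP _ _).1 (open_nbhs_nbhs (conj oU Ux)).
pose d := d' / (1 + `|v|).
have v10 : 0 < 1 + `|v| by have := normr_ge0 v; lra.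
have d0 : 0 < d by rewrite divr_gt0.
have inU s : `|s| < d -> U (x + s *: v).
  rewrite ltr_pdivlMr// => sd; apply: d'H; rewrite -ball_normE /= opprD addNKr normrN.
  rewrite normrZ; apply: le_lt_trans sd.
  by apply: ler_wpM2l => //; lra.
pose phi (s : R) := f (x + s *: v).
have dphi (s : R) : `|s| < d -> is_derive (s : R) 1 phi ('D_v f (x + s *: v)).
  by move=> sd; apply: is_derive_line; apply: diff_derivable; apply/f0/inU.
have D0 : 'D_v f x = 0.
  have dI (t : R) : t \in `](- d), d[ -> `|t| < d by rewrite in_itv /= ltr_norml.
  have I0 : (0 : R) \in `](- d), d[ by rewrite in_itv /=; lra.
  have H1 : - d <= d by lra.
  case: (@derive1_at_max _ phi (- d) d 0 H1 _ I0).
  - by move=> t /dI td; have [] := dphi _ td.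
  - move=> t /dI td; rewrite /phi scale0r addr0; apply: fmax; exact: inU.
  move=> _ <-; have /dphi[_ ->] : `|0 : R| < d by rewrite normr0.
  by rewrite scale0r addr0.
split=> //; rewrite leNgt; apply/negP => A0.
(* Since ['D_v f x = 0], the difference quotient of ['D_v f] at [x] is its value divided by [s]; its
   limit is positive. *)
have [_ /posnumP[d2] d2H] : exists2 d2 : R, 0 < d2 &
    forall s, 0 < s -> s < d2 -> 0 < 'D_v f (x + s *: v).
  have dv := @diff_derivable _ _ _ _ _ v (f1 _ Ux).
  have /cvgrPdist_lt/(_ _ A0) : (fun h => h^-1 *: (('D_v f \o shift x) (h *: v) - 'D_v f x)) @ 0^'
     --> 'D_v ('D_v f) x by [].
  move=> /nbhs_ballP[d2 /= d20 d2H]; exists d2 => // s s0 sd2.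
  have := d2H s; rewrite -ball_normE /= sub0r normrN (gtr0_norm s0) => /(_ sd2).
  rewrite gt_eqF// => /(_ isT); rewrite D0 subr0 ltr_norml => /andP[_].
  rewrite ltrBlDr ltrDl => H'.
  by move: H'; rewrite /GRing.scale /= pmulr_rgt0 ?invr_gt0// addrC.
pose s := Num.min (d / 2) (d2%:num / 2).
have s0 : 0 < s by rewrite lt_min; apply/andP; split; [lra|exact: divr_gt0].
have sd : s < d by rewrite gt_min; apply/orP; left; lra.
have sd2 : s < d2%:num by rewrite gt_min; apply/orP; right; have : 0 < d2%:num by []; lra.
have dI (t : R) : 0 <= t -> t <= s -> `|t| < d.
  by move=> t0 ts; rewrite ger0_norm//; apply: le_lt_trans sd.
have [||c] := @MVT R phi (fun t => 'D_v f (x + t *: v)) 0 s s0.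
- by move=> t; rewrite in_itv /= => /andP[t0 ts]; apply/dphi/dI; exact: ltW.
- apply: continuous_in_subspaceT => t; rewrite inE /= in_itv /= => /andP[t0 ts].
  apply: differentiable_continuous; apply/derivable1_diffP.
  by have [] := dphi t (dI _ t0 ts).
rewrite in_itv /= => /andP[c0 cs] E.
have : 0 < phi s - phi 0.
  rewrite E mulr_gt0//; last by rewrite subr0.
  by apply: d2H => //; apply: lt_trans sd2.
rewrite subr_gt0 /phi scale0r addr0 ltNge fmax//; apply/inU/dI => //.
exact: ltW.
Qed.

End schwarz.

(** * Positive definite matrices *)

Section posdef.
Context {R : realType}.

Definition posdef n (A : 'M[R]_n) :=
  A^T = A /\ forall v : 'rV[R]_n, v != 0 -> 0 < (v *m A *m v^T) 0 0.

Lemma posdef_ge0 n (A : 'M[R]_n) (v : 'rV[R]_n) : posdef A -> 0 <= (v *m A *m v^T) 0 0.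
Proof.
move=> [_ Apos]; have [->|/Apos/ltW//] := eqVneq v 0.
by rewrite !mul0mx mxE.
Qed.

Lemma posdef_unitmx n (A : 'M[R]_n) : posdef A -> A \in unitmx.
Proof.
move=> [_ Apos]; rewrite -row_free_unit -kermx_eq0; apply/rowV0P.
move=> v /sub_kermxP vA0; apply/eqP; apply: contraT => /Apos.
by rewrite vA0 mul0mx mxE ltxx.
Qed.

Lemma posdef_invmx n (A : 'M[R]_n) : posdef A -> posdef (invmx A).
Proof.
move=> Apd; have uA := posdef_unitmx Apd; have [AT Apos] := Apd.
have iT : (invmx A)^T = invmx A by rewrite trmx_inv AT.
split=> // v v0.
have -> : v *m invmx A *m v^T = (v *m invmx A) *m A *m (v *m invmx A)^T.
  by rewrite mulmxKV// trmx_mul iT mulmxA.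
apply: Apos; apply: contra v0 => /eqP vA0.
by rewrite -[v](mulmxKV uA) vA0 mul0mx.
Qed.

(** Cholesky factorisation by induction on the size: the Schur complement [S] of the upper left
    entry is again positive definite. *)
Lemma posdef_gram n (A : 'M[R]_n) : posdef A -> exists W : 'M[R]_n, A = W^T *m W.
Proof.
elim: n A => [|n IH] A; first by exists 0; apply/matrixP; case.
move: A; rewrite -[n.+1]/(1 + n)%N => A.
rewrite -[A](@submxK _ 1 n 1 n).
set a := ulsubmx _; set b := ursubmx _; set b' := dlsubmx _; set C := drsubmx _.
move=> [AT Apos].
move: (AT); rewrite tr_block_mx => /eq_block_mx[_ bT _ CT].
have b'E : b' = b^T by rewrite -bT trmxK.
have a0 : 0 < a 0 0.
  have := Apos (row_mx 1%:M 0); rewrite mul_row_block !mul0mx !addr0 !mul1mx.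
  rewrite tr_row_mx mul_row_col trmx0 mulmx0 addr0 trmx1 mulmx1; apply.
  apply/negP => /eqP/matrixP/(_ 0 (lshift n 0)).
  by rewrite row_mxEl !mxE eqxx => /eqP; rewrite oner_eq0.
pose S := C - (a 0 0)^-1 *: (b^T *m b).
have [|W' SE] := IH S.
  split; first by rewrite linearB /= CT linearZ /= trmx_mul trmxK.
  move=> w w0.
  (* This first coordinate minimises the quadratic form of [A] once the others are fixed to [w]; the
     minimum is the form of [S] at [w]. *)
  pose y := - (a 0 0)^-1 *: (b *m w^T).
  have yT : y^T = - (a 0 0)^-1 *: (w *m b^T) by rewrite linearZ /= trmx_mul trmxK.
  have := Apos (row_mx y^T w).
  rewrite mul_row_block tr_row_mx mul_row_col trmxK b'E.
  have -> : y^T *m a + w *m b^T = 0.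
    have aE : w *m b^T *m a = a 0 0 *: (w *m b^T).
      by rewrite {1}(mx11_scalar a) mul_mx_scalar.
    rewrite yT -scalemxAl aE scalerA mulNr mulVf ?gt_eqF//.
    by rewrite scaleN1r addNr.
  rewrite mul0mx add0r yT -scalemxAl.
  have -> : (- (a 0 0)^-1 *: (w *m b^T *m b) + w *m C) *m w^T = w *m S *m w^T.
    congr (_ *m _); rewrite mulmxBr -scalemxAr mulmxA scaleNr.
    by rewrite addrC.
  apply; apply: contra w0 => /eqP/(congr1 (@rsubmx _ 1 1 n)).
  by rewrite row_mxKr linear0 => ->.
pose s := Num.sqrt (a 0 0).
have s0 : s != 0 by rewrite gt_eqF// sqrtr_gt0.
have ss : s * s = a 0 0 by rewrite -expr2 sqr_sqrtr// ltW.
exists (block_mx s%:M (s^-1 *: b) 0 W').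
rewrite tr_block_mx mulmx_block trmx0 !mul0mx !mulmx0 !addr0 linearZ /=.
rewrite tr_scalar_mx mul_scalar_mx scale_scalar_mx ss -mx11_scalar.
rewrite mul_scalar_mx scalerA mulVf// scale1r -SE mul_mx_scalar linearZ /=.
rewrite scalerA mulfV// scale1r -scalemxAl -scalemxAr scalerA.
by rewrite -invfM ss /S addrC subrK b'E.
Qed.

(** Writing [A = W^T *m W] and cycling the trace, each diagonal entry becomes the form of [B] at a
    row of [W]. This gives both the sign of the Laplacian at a maximum and the sign of the squared
    norm of the Hessian. *)
Lemma tr_posdef_mul_ge0 n (A B : 'M[R]_n) : posdef A ->
  (forall v : 'rV[R]_n, 0 <= (v *m B *m v^T) 0 0) -> 0 <= \tr (A *m B).
Proof.
move=> /posdef_gram[W ->] B0.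
rewrite -mulmxA mxtrace_mulC; apply: sumr_ge0 => i _.
have := B0 (row i W); rewrite -mulmxA.
suff -> : W *m B *m W^T = W *m (B *m W^T).
  have -> : (W *m (B *m W^T)) i i = (row i W *m (B *m (row i W)^T)) 0 0.
    rewrite !mxE; apply: eq_bigr => j _; rewrite !mxE; congr (_ * _).
    by apply: eq_bigr => k _; rewrite !mxE.
  by [].
by rewrite mulmxA.
Qed.

(* Dual form: [v *m d] is the pairing of a vector with a covector. *)
Lemma cauchy_schwarz_posdef n (A : 'M[R]_n) (v : 'rV[R]_n) (d : 'cV[R]_n) :
  posdef A ->
  ((v *m d) 0 0) ^+ 2 <=
    (d^T *m invmx A *m d) 0 0 * (v *m A *m v^T) 0 0.
Proof.
move=> Apd; have uA := posdef_unitmx Apd; have iApd := posdef_invmx Apd.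
set F := (d^T *m invmx A *m d) 0 0; set p := (v *m d) 0 0.
set q := (v *m A *m v^T) 0 0.
have [d0|d0] := eqVneq d 0.
  by rewrite /F /p d0 !mulmx0 !mxE expr0n mul0r.
have F0 : 0 < F.
  have := iApd.2 d^T; rewrite trmxK; apply; apply: contra d0 => /eqP/(congr1 trmx).
  by rewrite trmxK trmx0 => ->.
(* Up to the factor [F], this is the component of [v] that is [A]-orthogonal to the vector dual to
   [d]; scaling by [F] avoids a division. *)
have := posdef_ge0 (F *: v - p *: (d^T *m invmx A)) Apd.
have -> : ((F *: v - p *: (d^T *m invmx A)) *m A *m
    (F *: v - p *: (d^T *m invmx A))^T) 0 0 = F * (F * q - p ^+ 2).
  have dv : (d^T *m v^T) 0 0 = p by rewrite -trmx_mul mxE.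
  have vd : (v *m A *m (d^T *m invmx A)^T) 0 0 = p.
    rewrite trmx_mul trmxK trmx_inv Apd.1 -mulmxA [A *m _]mulmxA mulmxV// mul1mx //.
  have dd : (d^T *m (d^T *m invmx A)^T) 0 0 = F.
    by rewrite trmx_mul trmxK trmx_inv Apd.1 mulmxA.
  have T : (F *: v - p *: (d^T *m invmx A))^T = F *: v^T - p *: (d^T *m invmx A)^T.
    by rewrite linearB /= !linearZ.
  rewrite T !mulmxBl -!scalemxAl mulmxKV//.
  rewrite !mulmxBr -!scalemxAr.
  have sE (x y : 'M[R]_1) : (x - y) 0 0 = x 0 0 - y 0 0 by rewrite !mxE.
  have zE (c : R) (x : 'M[R]_1) : (c *: x) 0 0 = c * x 0 0 by rewrite mxE.
  by rewrite !(sE, zE) dv vd dd -/q; ring.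
by rewrite pmulr_rge0// subr_ge0.
Qed.

End posdef.

(** * Calculus of matrix-valued functions *)

Section smooth_closure.
Context {R : realType} {V : normedModType R}.
Implicit Types (U : set V) (f h : V -> R).

Lemma smooth_on_cst U (c : R) : smooth_on U (fun _ => c).
Proof. by move=> k; apply: differentiable_upto_cst. Qed.

Lemma smooth_onD U f h : open U -> smooth_on U f -> smooth_on U h ->
  smooth_on U (fun x => f x + h x).
Proof. by move=> oU fs hs k; apply: differentiable_uptoD. Qed.

Lemma smooth_onM U f h : open U -> smooth_on U f -> smooth_on U h ->
  smooth_on U (fun x => f x * h x).
Proof. by move=> oU fs hs k; apply: differentiable_uptoM. Qed.

Lemma smooth_onN U f : open U -> smooth_on U f -> smooth_on U (fun x => - f x).
Proof.
move=> oU fs; have := smooth_onM oU (smooth_on_cst (U := U) (-1)) fs.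
by under eq_fun do rewrite mulN1r.
Qed.

Lemma smooth_onB U f h : open U -> smooth_on U f -> smooth_on U h ->
  smooth_on U (fun x => f x - h x).
Proof. by move=> oU fs hs; apply: smooth_onD => //; apply: smooth_onN. Qed.

Lemma smooth_onV U f : open U -> (forall x, U x -> f x != 0) ->
  smooth_on U f -> smooth_on U (fun x => (f x)^-1).
Proof. by move=> oU f0 fs k; apply: differentiable_uptoV. Qed.

Lemma smooth_on_sum U (I : Type) (r : seq I) (P : pred I) (F : I -> V -> R) :
  open U -> (forall i, smooth_on U (F i)) ->
  smooth_on U (fun x => \sum_(i <- r | P i) F i x).
Proof.
move=> oU Fs; elim: r => [|i r IH].
  by under eq_fun do rewrite big_nil; apply: smooth_on_cst.
under eq_fun do rewrite big_cons.
by case: (P i) => //; apply: smooth_onD.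
Qed.

Lemma smooth_on_prod U (I : Type) (r : seq I) (P : pred I) (F : I -> V -> R) :
  open U -> (forall i, smooth_on U (F i)) ->
  smooth_on U (fun x => \prod_(i <- r | P i) F i x).
Proof.
move=> oU Fs; elim: r => [|i r IH].
  by under eq_fun do rewrite big_nil; apply: smooth_on_cst.
under eq_fun do rewrite big_cons.
by case: (P i) => //; apply: smooth_onM.
Qed.

Lemma smooth_on_derivable U f x v : smooth_on U f -> U x -> derivable f x v.
Proof. by move=> fs Ux; apply/diff_derivable/(smooth_on_differentiable fs). Qed.

Lemma derive_mul f h x v : derivable f x v -> derivable h x v ->
  'D_v (fun y => f y * h y) x = 'D_v f x * h x + f x * 'D_v h x.
Proof.
move=> fd hd; have -> : (fun y => f y * h y) = f * h by [].
by rewrite deriveM// addrC /GRing.scale /= [in X in X + _]mulrC.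
Qed.

Lemma derive_sum_seq (I : Type) (r : seq I) (P : pred I) (F : I -> V -> R) x v :
  (forall i, derivable (F i) x v) ->
  'D_v (fun y => \sum_(i <- r | P i) F i y) x = \sum_(i <- r | P i) 'D_v (F i) x.
Proof.
move=> Fd.
suff: is_derive x v (fun y => \sum_(i <- r | P i) F i y)
   (\sum_(i <- r | P i) 'D_v (F i) x) by case.
elim: r => [|i r IH].
  by under eq_fun do rewrite big_nil; rewrite big_nil; exact: is_derive_cst.
under eq_fun do rewrite big_cons; rewrite big_cons.
by case: (P i) => //; apply: is_deriveD IH; exact: derivableP.
Qed.

End smooth_closure.

Section mx_calculus.
Context {R : realType} {V : normedModType R}.
Implicit Types (U : set V) (x v w : V).

Definition mx_derive v p q (M : V -> 'M[R]_(p, q)) x : 'M[R]_(p, q) :=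
  \matrix_(i, j) 'D_v (fun y => M y i j) x.

Definition mx_smooth U p q (M : V -> 'M[R]_(p, q)) :=
  forall i j, smooth_on U (fun y => M y i j).

Lemma mx_derive_near v p q (M N : V -> 'M[R]_(p, q)) U x : open U -> U x ->
  (forall y, U y -> M y = N y) -> mx_derive v M x = mx_derive v N x.
Proof.
move=> oU Ux MN; apply/matrixP => i j; rewrite !mxE.
apply: near_eq_derive; apply: open_eq_near oU _ Ux => y Uy.
by rewrite MN.
Qed.

Lemma mx_smooth_congr p q (M N : V -> 'M[R]_(p, q)) U : open U ->
  (forall y, U y -> M y = N y) -> mx_smooth U M -> mx_smooth U N.
Proof.
by move=> oU MN Ms i j; apply: smooth_on_congr (Ms i j) => // y Uy; rewrite MN.
Qed.

Lemma mx_smooth_cst U p q (N : 'M[R]_(p, q)) : mx_smooth U (fun=> N).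
Proof. by move=> i j; exact: smooth_on_cst. Qed.

Lemma mx_smoothD U p q (M N : V -> 'M[R]_(p, q)) : open U ->
  mx_smooth U M -> mx_smooth U N -> mx_smooth U (fun y => M y + N y).
Proof.
move=> oU Ms Ns i j; under eq_fun do rewrite mxE.
exact: smooth_onD.
Qed.

Lemma mx_smoothM U p q r (M : V -> 'M[R]_(p, q)) (N : V -> 'M[R]_(q, r)) :
  open U ->
  mx_smooth U M -> mx_smooth U N -> mx_smooth U (fun y => M y *m N y).
Proof.
move=> oU Ms Ns i j; under eq_fun do rewrite mxE.
by apply: smooth_on_sum => // k; apply: smooth_onM.
Qed.

Lemma mx_smooth_tr U p q (M : V -> 'M[R]_(p, q)) :
  mx_smooth U M -> mx_smooth U (fun y => (M y)^T).
Proof. by move=> Ms i j; under eq_fun do rewrite mxE; exact: Ms. Qed.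

Lemma mx_smooth_derive U p q (M : V -> 'M[R]_(p, q)) v :
  mx_smooth U M -> mx_smooth U (mx_derive v M).
Proof.
move=> Ms i j; under eq_fun do rewrite mxE.
exact: smooth_on_derive (Ms i j).
Qed.

Lemma smooth_on_det U n (M : V -> 'M[R]_n) : open U ->
  mx_smooth U M -> smooth_on U (fun y => \det (M y)).
Proof.
move=> oU Ms; rewrite /determinant.
apply: smooth_on_sum => // s; apply: smooth_onM => //; first exact: smooth_on_cst.
exact: smooth_on_prod.
Qed.

(** By Cramer's rule the entries are polynomials in those of [M] divided by a determinant that does
    not vanish on [U]. *)
Lemma mx_smooth_inv U n (M : V -> 'M[R]_n) : open U ->
  (forall y, U y -> M y \in unitmx) -> mx_smooth U M ->
  mx_smooth U (fun y => invmx (M y)).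
Proof.
move=> oU uM Ms.
apply: (@mx_smooth_congr _ _ (fun y => (\det (M y))^-1 *: \adj (M y))) => //.
  by move=> y /uM uMy; rewrite /invmx uMy.
move=> i j; under eq_fun do rewrite mxE.
apply: smooth_onM => //.
  apply: smooth_onV => //; last exact: smooth_on_det.
  by move=> y /uM; rewrite unitmxE unitfE.
under eq_fun do rewrite mxE.
rewrite /cofactor; apply: smooth_onM => //; first exact: smooth_on_cst.
apply: smooth_on_det => // a b; under eq_fun do rewrite !mxE.
exact: Ms.
Qed.

Lemma mx_deriveD U v p q (M N : V -> 'M[R]_(p, q)) x : U x ->
  mx_smooth U M -> mx_smooth U N ->
  mx_derive v (fun y => M y + N y) x = mx_derive v M x + mx_derive v N x.
Proof.
move=> Ux Ms Ns; apply/matrixP => i j; rewrite !mxE.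
under eq_fun do rewrite mxE.
by rewrite deriveD//; apply: (@smooth_on_derivable _ _ U).
Qed.

Lemma mx_deriveN U v p q (M : V -> 'M[R]_(p, q)) x : U x ->
  mx_smooth U M ->
  mx_derive v (fun y => - M y) x = - mx_derive v M x.
Proof.
move=> Ux Ms; apply/matrixP => i j; rewrite !mxE.
under eq_fun do rewrite mxE.
by rewrite deriveN//; apply: (@smooth_on_derivable _ _ U).
Qed.

Lemma mx_deriveB U v p q (M N : V -> 'M[R]_(p, q)) x : U x ->
  mx_smooth U M -> mx_smooth U N ->
  mx_derive v (fun y => M y - N y) x = mx_derive v M x - mx_derive v N x.
Proof.
move=> Ux Ms Ns; apply/matrixP => i j; rewrite !mxE.
under eq_fun do rewrite !mxE.
by rewrite deriveB//; apply: (@smooth_on_derivable _ _ U).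
Qed.

Lemma mx_deriveM U v p q r (M : V -> 'M[R]_(p, q)) (N : V -> 'M[R]_(q, r)) x :
  U x -> mx_smooth U M -> mx_smooth U N ->
  mx_derive v (fun y => M y *m N y) x =
  mx_derive v M x *m N x + M x *m mx_derive v N x.
Proof.
move=> Ux Ms Ns; apply/matrixP => i j; rewrite !mxE.
have Md a b : derivable (fun y => M y a b) x v by apply: (@smooth_on_derivable _ _ U).
have Nd a b : derivable (fun y => N y a b) x v by apply: (@smooth_on_derivable _ _ U).
under eq_fun do rewrite mxE.
rewrite derive_sum_seq; last first.
  by move=> k; exact: derivableM (Md i k) (Nd k j).
by rewrite -big_split; apply: eq_bigr => k _; rewrite derive_mul// !mxE.
Qed.

Lemma mx_derive_tr v p q (M : V -> 'M[R]_(p, q)) x :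
  mx_derive v (fun y => (M y)^T) x = (mx_derive v M x)^T.
Proof. by apply/matrixP => i j; rewrite !mxE; under eq_fun do rewrite mxE. Qed.

Lemma mx_derive_col v p q (j : 'I_q) (M : V -> 'M[R]_(p, q)) x :
  mx_derive v (fun y => col j (M y)) x = col j (mx_derive v M x).
Proof. by apply/matrixP => a b; rewrite !mxE; under eq_fun do rewrite mxE. Qed.

Lemma derive_mxtrace U v n (M : V -> 'M[R]_n) x : U x -> mx_smooth U M ->
  'D_v (fun y => \tr (M y)) x = \tr (mx_derive v M x).
Proof.
move=> Ux Ms; rewrite /mxtrace derive_sum_seq; last first.
  by move=> i; apply: (@smooth_on_derivable _ _ U).
by apply: eq_bigr => i _; rewrite mxE.
Qed.

Lemma mx_derive_cst v p q (M : 'M[R]_(p, q)) x : mx_derive v (fun=> M) x = 0.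
Proof. by apply/matrixP => i j; rewrite !mxE derive_cst. Qed.

(** Obtained by differentiating the identity of [M y *m invmx (M y)] with [1%:M], valid on all of
    [U]. *)
Lemma mx_derive_inv U v n (M : V -> 'M[R]_n) x : open U -> U x ->
  (forall y, U y -> M y \in unitmx) -> mx_smooth U M ->
  mx_derive v (fun y => invmx (M y)) x =
  - (invmx (M x) *m mx_derive v M x *m invmx (M x)).
Proof.
move=> oU Ux uM Ms; have iMs := mx_smooth_inv oU uM Ms.
have := mx_deriveM v Ux Ms iMs.
rewrite (mx_derive_near (N := fun=> 1%:M) v oU Ux); last first.
  by move=> y Uy; rewrite mulmxV ?uM.
rewrite mx_derive_cst => /esym/eqP; rewrite addrC addr_eq0 => /eqP.
move=> /(congr1 (mulmx (invmx (M x)))).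
by rewrite mulKmx ?uM// mulmxN mulmxA.
Qed.

Lemma mx_derive_comm U v w p q (M : V -> 'M[R]_(p, q)) x : open U -> U x ->
  mx_smooth U M ->
  mx_derive v (mx_derive w M) x = mx_derive w (mx_derive v M) x.
Proof.
move=> oU Ux Ms; apply/matrixP => i j; rewrite !mxE.
under eq_fun do rewrite mxE.
under [in RHS]eq_fun do rewrite mxE.
exact: derive_comm oU Ux (Ms i j 2).
Qed.

End mx_calculus.

(** * The Bochner formula in coordinates *)

Section tensor_calculus.
Context {R : realType} {n : nat}.
Implicit Types (U : set 'rV[R]_n) (G : 'rV[R]_n -> 'M[R]_n).
Implicit Types (x y : 'rV[R]_n) (f : 'rV[R]_n -> R).

Notation e_ k := (delta_mx 0 k : 'rV[R]_n).

(** The connection matrix in direction [k]: on columns, the covariant derivative in this direction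
    is the partial derivative plus this matrix for vectors, minus its transpose for covectors. *)
Definition christoffel_mx G k y : 'M[R]_n := \matrix_(a, b) christoffel G a k b y.

(** The endomorphism R(d_k, d_j), acting on column vectors. *)
Definition riemann_mx G k j y : 'M[R]_n := \matrix_(m, l) riemann G m l k j y.

(** This is the differential, a covector; the metric gradient is its product with [invmx (G y)]. *)
Definition gradient f y : 'cV[R]_n := \col_i partial i f y.

Definition hessian G f y : 'M[R]_n := \matrix_(i, j)
  (partial i (partial j f) y - \sum_k christoffel G k i j y * partial k f y).

Definition grad_sq G f y : R := ((gradient f y)^T *m invmx (G y) *m gradient f y) 0 0.

Lemma addmx_entry p q (A B : 'M[R]_(p, q)) i j : (A + B) i j = A i j + B i j.
Proof. by rewrite mxE. Qed.

Lemma oppmx_entry p q (A : 'M[R]_(p, q)) i j : (- A) i j = - A i j.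
Proof. by rewrite mxE. Qed.

Lemma trmxD p q (A B : 'M[R]_(p, q)) : (A + B)^T = A^T + B^T.
Proof. by apply/matrixP => i j; rewrite !mxE. Qed.

Lemma trmxB p q (A B : 'M[R]_(p, q)) : (A - B)^T = A^T - B^T.
Proof. by apply/matrixP => i j; rewrite !mxE. Qed.

(** Here [S] is the inverse metric, [C] and [E] are the connection matrices in two directions, [A]
    and [B] their derivatives in the opposite directions. The premise equates the two mixed second
    derivatives of [S]. *)
Let antisym_algebra (A B C E S : 'M[R]_n) :
  A *m S - E *m (C *m S + S *m C^T) - (C *m S + S *m C^T) *m E^T + S *m A^T =
  B *m S - C *m (E *m S + S *m E^T) - (E *m S + S *m E^T) *m C^T + S *m B^T ->
  (A - B + (C *m E - E *m C)) *m S = - (S *m (A - B + (C *m E - E *m C))^T).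
Proof.
rewrite trmxD !trmxB !trmx_mul.
rewrite !(mulmxDl, mulmxDr, mulmxBl, mulmxBr, mulNmx, mulmxN) !mulmxA.
move=> /matrixP E0; apply/matrixP => a b; have := E0 a b.
rewrite !(addmx_entry, oppmx_entry); lra.
Qed.

Lemma col_mulmx p q r (A : 'M[R]_(p, q)) (B : 'M[R]_(q, r)) j :
  col j (A *m B) = A *m col j B.
Proof.
by apply/colP => i; rewrite !mxE; apply: eq_bigr => k _; rewrite mxE.
Qed.

Lemma colB p q (A B : 'M[R]_(p, q)) j : col j (A - B) = col j A - col j B.
Proof. by apply/colP => i; rewrite !mxE. Qed.

Let comm_algebra (A B C E : 'M[R]_n) (X g u v Y : 'cV[R]_n) :
  X - A^T *m g - E^T *m C^T *m g - u - v - Y =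
  X - B^T *m g - C^T *m E^T *m g - v - u - Y
    - (A - B + (C *m E - E *m C))^T *m g.
Proof.
rewrite trmxD !trmxB !trmx_mul !(mulmxDl, mulmxBl) ?mulNmx.
by apply/matrixP => s t; rewrite !(addmx_entry, oppmx_entry); ring.
Qed.

Let trace_algebra (K S L E : 'M[R]_n) :
  \tr (- (K *m S + S *m K^T) *m L + S *m E) =
  \tr (S *m (E - L *m K - K^T *m L)).
Proof.
have trB (A B : 'M[R]_n) : \tr (A - B) = \tr A - \tr B by rewrite linearB.
have trN (A : 'M[R]_n) : \tr (- A) = - \tr A by rewrite linearN.
rewrite !mulmxBr mulNmx mulmxDl mxtraceD !trB trN mxtraceD !mulmxA.
rewrite -[K *m S *m L]mulmxA.
rewrite [\tr (K *m _)]mxtrace_mulC; ring.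
Qed.

Let trace_swap (S : 'M[R]_n) (N : 'I_n -> 'M[R]_n) (W : 'cV[R]_n) :
  \sum_k \sum_l S k l * (N k *m W) l 0 =
  \sum_j W j 0 * \sum_k (S *m col j (N k)) k 0.
Proof.
under eq_bigr => k _ do under eq_bigr => l _ do rewrite mxE mulr_sumr.
under eq_bigr => k _ do rewrite exchange_big /=.
rewrite exchange_big /=; apply: eq_bigr => j _.
rewrite mulr_sumr; apply: eq_bigr => k _.
rewrite mxE mulr_sumr; apply: eq_bigr => l _; rewrite mxE; ring.
Qed.

(** The left side is a plain partial derivative of [L *m S *m g], the right side a covariant one;
    they differ by [K^T *m L *m S *m g], which the premise kills. *)
Let derive_product_algebra (L E K S : 'M[R]_n) (g c : 'cV[R]_n) :
  L *m S *m g = 0 ->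
  (E *m S + L *m - (K *m S + S *m K^T)) *m g + L *m S *m (c + K^T *m g) =
  (E - L *m K - K^T *m L) *m (S *m g) + L *m S *m c.
Proof.
move=> E0; have {}E0 : K^T *m L *m S *m g = 0 by rewrite -!mulmxA [L *m _]mulmxA E0 mulmx0.
rewrite !(mulmxDr, mulmxDl, mulmxN, mulNmx) !mulmxA E0 oppr0 addr0.
by apply/matrixP => s t; rewrite !(addmx_entry, oppmx_entry); ring.
Qed.

Let scalar_algebra (A B C : 'M[R]_1) :
  (A + B - (B + C) + (A^T + C)) 0 0 = 2 * A 0 0.
Proof. by rewrite !mxE; ring. Qed.

Lemma coord_laplacian_hessian G f y :
  coord_laplacian G f y = \tr (invmx (G y) *m (hessian G f y)^T).
Proof.
rewrite /coord_laplacian /mxtrace; apply: eq_bigr => i _.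
by rewrite mxE; apply: eq_bigr => j _; rewrite !mxE.
Qed.

Lemma coord_laplacian_critical G f x : (forall k, partial k f x = 0) ->
  coord_laplacian G f x =
  \sum_i \sum_j invmx (G x) i j * partial i (partial j f) x.
Proof.
move=> f0; rewrite /coord_laplacian; apply: eq_bigr => i _; apply: eq_bigr => j _.
by rewrite big1 ?subr0// => k _; rewrite f0 mulr0.
Qed.

(** * Parallelism of the metric, curvature, and the Bochner formula *)

Section metric.
Variables (U : set 'rV[R]_n) (G : 'rV[R]_n -> 'M[R]_n).
Hypotheses (oU : open U) (Gs : mx_smooth U G)
  (Gpd : forall y, U y -> posdef (G y)).

Let Gi y := invmx (G y).
Let Gam := christoffel_mx G.

Lemma metric_unitmx y : U y -> G y \in unitmx.
Proof. by move=> /Gpd/posdef_unitmx. Qed.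

Lemma invmx_metric_smooth : mx_smooth U Gi.
Proof. exact: mx_smooth_inv oU metric_unitmx Gs. Qed.

Lemma invmx_metric_tr y : U y -> (Gi y)^T = Gi y.
Proof. by move=> /Gpd/posdef_invmx[]. Qed.

Lemma metric_sym y i j : U y -> G y i j = G y j i.
Proof. by move=> /Gpd[GT _]; rewrite -[in LHS]GT mxE. Qed.

Lemma partial_metric_sym y k i j : U y ->
  partial k (fun z => G z i j) y = partial k (fun z => G z j i) y.
Proof.
move=> Uy; apply: near_eq_derive; apply: open_eq_near oU _ Uy => z Uz.
exact: metric_sym.
Qed.

Lemma christoffel_sym y a i j : U y -> christoffel G a i j y = christoffel G a j i y.
Proof.
move=> Uy; rewrite /christoffel; congr (_ * _); apply: eq_bigr => l _.
by rewrite (partial_metric_sym l i j)// (addrC (partial i _ y)).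
Qed.

Lemma christoffel_mx_col y k j : U y -> col j (Gam k y) = col k (Gam j y).
Proof. by move=> Uy; apply/colP => a; rewrite !mxE christoffel_sym. Qed.

(** Twice the Christoffel symbols of the first kind, with the lowered index as row. *)
Let koszul k y : 'M[R]_n := \matrix_(l, b)
  (partial k (fun z => G z b l) y + partial b (fun z => G z k l) y
    - partial l (fun z => G z k b) y).

Lemma christoffel_mx_koszul k y : Gam k y = 2^-1 *: (Gi y *m koszul k y).
Proof.
apply/matrixP => a b; rewrite !mxE; congr (_ * _); apply: eq_bigr => l _.
by rewrite !mxE.
Qed.

Lemma christoffel_smooth a i j : smooth_on U (christoffel G a i j).
Proof.
rewrite /christoffel; apply: smooth_onM => //; first exact: smooth_on_cst.
apply: smooth_on_sum => // l; apply: smooth_onM => //; first exact: invmx_metric_smooth.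
have ps (k b c : 'I_n) : smooth_on U (partial k (fun z => G z b c)).
  exact: smooth_on_derive (Gs b c).
by apply: smooth_onB => //; apply: smooth_onD.
Qed.

Lemma christoffel_mx_smooth k : mx_smooth U (Gam k).
Proof.
by move=> a b; under eq_fun do rewrite mxE; apply: christoffel_smooth.
Qed.

(** [G y *m Gam k y] is half the Koszul matrix; adding the transpose cancels its two terms that are
    not derivatives in direction [k]. *)
Lemma metric_compat k y : U y ->
  mx_derive (e_ k) G y = G y *m Gam k y + (G y *m Gam k y)^T.
Proof.
move=> Uy; have -> : G y *m Gam k y = 2^-1 *: koszul k y.
  by rewrite christoffel_mx_koszul -scalemxAr mulKVmx// metric_unitmx.
apply/matrixP => i j; rewrite !mxE -/(partial k (fun z => G z i j) y).
rewrite (partial_metric_sym k j i)// (partial_metric_sym j k i)//.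
rewrite (partial_metric_sym i k j)//; lra.
Qed.

Lemma inverse_metric_compat k y : U y ->
  mx_derive (e_ k) Gi y = - (Gam k y *m Gi y + Gi y *m (Gam k y)^T).
Proof.
move=> Uy; have uG := metric_unitmx Uy.
rewrite (mx_derive_inv _ oU Uy metric_unitmx Gs) metric_compat//.
rewrite mulmxDr mulmxDl mulKmx// trmx_mul (Gpd Uy).1 -/(Gi y).
by rewrite mulmxA mulmxK.
Qed.

Lemma riemann_mxE k j y : U y -> riemann_mx G k j y =
  mx_derive (e_ k) (Gam j) y - mx_derive (e_ j) (Gam k) y
  + (Gam k y *m Gam j y - Gam j y *m Gam k y).
Proof.
move=> Uy; apply/matrixP => m l; rewrite !mxE /riemann.
congr (_ - _ + _).
- by under [in RHS]eq_fun do rewrite mxE.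
- by under [in RHS]eq_fun do rewrite mxE.
- by rewrite big_split sumrN /=; congr (_ - _); apply: eq_bigr => a _; rewrite !mxE.
Qed.

(* Antisymmetry of the curvature in its first two indices, obtained from the
   symmetry of the second derivatives of the inverse metric. *)
Lemma riemann_mx_antisym k j y : U y ->
  riemann_mx G k j y *m Gi y = - (Gi y *m (riemann_mx G k j y)^T).
Proof.
move=> Uy; have Gis := invmx_metric_smooth.
have dd a b : mx_derive (e_ a) (mx_derive (e_ b) Gi) y =
  - (mx_derive (e_ a) (Gam b) y *m Gi y
     - Gam b y *m (Gam a y *m Gi y + Gi y *m (Gam a y)^T)
     - (Gam a y *m Gi y + Gi y *m (Gam a y)^T) *m (Gam b y)^T
     + Gi y *m (mx_derive (e_ a) (Gam b) y)^T).
  have Gb := christoffel_mx_smooth b; have GbT := mx_smooth_tr Gb.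
  rewrite (mx_derive_near (N := fun y => - (Gam b y *m Gi y + Gi y *m (Gam b y)^T)) _ oU Uy).
    rewrite (mx_deriveN _ Uy); last by apply: mx_smoothD => //; apply: mx_smoothM.
    rewrite (mx_deriveD _ Uy); [|exact: mx_smoothM|exact: mx_smoothM].
    rewrite !(mx_deriveM _ Uy)// mx_derive_tr inverse_metric_compat//.
    by rewrite mulmxN mulNmx addrA.
  by move=> z Uz; apply: inverse_metric_compat.
have := etrans (esym (dd k j)) (etrans (mx_derive_comm (e_ k) (e_ j) oU Uy Gis) (dd j k)).
move=> /oppr_inj; rewrite (riemann_mxE k j Uy).
exact: antisym_algebra.
Qed.

Section function.
Variable f : 'rV[R]_n -> R.
Hypothesis fs : smooth_on U f.

Let gr := gradient f.
Let H := hessian G f.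

Lemma gradient_smooth : mx_smooth U gr.
Proof.
by move=> i j; under eq_fun do rewrite mxE; exact: smooth_on_derive.
Qed.

Lemma hessian_smooth : mx_smooth U H.
Proof.
move=> i j; under eq_fun do rewrite mxE.
apply: smooth_onB => //; first by do 2 apply: smooth_on_derive.
apply: smooth_on_sum => // k; apply: smooth_onM => //; first exact: christoffel_smooth.
exact: smooth_on_derive.
Qed.

Lemma partial_comm i j y : U y -> partial i (partial j f) y = partial j (partial i f) y.
Proof. by move=> Uy; exact: (@derive_comm _ _ f U y _ _ oU Uy (@fs 2%N)). Qed.

Lemma hessian_tr y : U y -> (H y)^T = H y.
Proof.
move=> Uy; apply/matrixP => i j; rewrite !mxE partial_comm//; congr (_ - _).
by apply: eq_bigr => k _; rewrite christoffel_sym.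
Qed.

Lemma derive_gradient k y : U y ->
  mx_derive (e_ k) gr y = col k (H y) + (Gam k y)^T *m gr y.
Proof.
move=> Uy; rewrite -(hessian_tr Uy); apply/colP => i; rewrite !mxE.
under eq_fun do rewrite mxE.
rewrite -[in RHS]/(partial k (partial i f) y).
have -> : \sum_j ((Gam k y)^T) i j * gr y j 0 =
   \sum_m christoffel G m k i y * partial m f y.
  by apply: eq_bigr => m _; rewrite !mxE.
by rewrite subrK.
Qed.

Let P y := H y *m Gi y *m gr y.

(** The connection terms produced by the two gradients cancel those produced by the inverse metric;
    the two Hessian terms left over are transposes of each other, whence the factor 2. *)
Lemma partial_grad_sq k y : U y -> partial k (grad_sq G f) y = 2 * P y k 0.
Proof.
move=> Uy; have grs := gradient_smooth; have Gis := invmx_metric_smooth.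
have grTs := mx_smooth_tr grs.
have -> : partial k (grad_sq G f) y =
   (mx_derive (e_ k) (fun z => (gr z)^T *m Gi z *m gr z) y) 0 0.
  by rewrite mxE.
rewrite (mx_deriveM _ Uy)//; last exact: mx_smoothM.
rewrite (mx_deriveM _ Uy)// mx_derive_tr derive_gradient// inverse_metric_compat//.
have -> : mulmx ((gr y)^T *m Gi y) (col k (H y) + (Gam k y)^T *m gr y) =
   ((col k (H y))^T *m Gi y *m gr y)^T + (gr y)^T *m Gi y *m (Gam k y)^T *m gr y.
  by rewrite !trmx_mul trmxK invmx_metric_tr// mulmxDr !mulmxA.
rewrite linearD /= trmx_mul trmxK !(mulmxDl, mulmxN, mulNmx, mulmxDr) !mulmxA.
have -> : P y k 0 = ((col k (H y))^T *m Gi y *m gr y) 0 0.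
  by rewrite tr_col hessian_tr// -!row_mul [RHS]mxE.
exact: scalar_algebra.
Qed.

Let N k y := mx_derive (e_ k) H y - H y *m Gam k y - (Gam k y)^T *m H y.

(* The Ricci identity; [N k] is the covariant derivative of the hessian. *)
Lemma derive_hessian_comm k j y : U y ->
  col j (N k y) = col k (N j y) - (riemann_mx G k j y)^T *m gr y.
Proof.
move=> Uy; have grs := gradient_smooth.
(* Once expanded, everything except the derivative of the connection and the product of two
   connection matrices is symmetric in [a] and [b]; these two make up the curvature. *)
have E a b : col b (N a y) = mx_derive (e_ a) (mx_derive (e_ b) gr) y
   - (mx_derive (e_ a) (Gam b) y)^T *m gr y - (Gam b y)^T *m (Gam a y)^T *m gr y
   - (Gam b y)^T *m col a (H y) - (Gam a y)^T *m col b (H y)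
   - H y *m col b (Gam a y).
  have Gs' := mx_smooth_tr (christoffel_mx_smooth b).
  have Gsgr : mx_smooth U (fun z => (Gam b z)^T *m gr z) by apply: mx_smoothM.
  rewrite /N !colB !col_mulmx -mx_derive_col.
  rewrite (mx_derive_near
     (N := fun z => mx_derive (e_ b) gr z - (Gam b z)^T *m gr z) _ oU Uy); last first.
    by move=> z Uz; rewrite derive_gradient// addrK.
  rewrite (mx_deriveB _ Uy)//; last exact: mx_smooth_derive.
  rewrite (mx_deriveM _ Uy)// mx_derive_tr derive_gradient// mulmxDr !mulmxA.
  apply/matrixP => s t; rewrite !(addmx_entry, oppmx_entry); ring.
rewrite (E k j) (E j k) (riemann_mxE k j Uy).
rewrite (mx_derive_comm (e_ k) (e_ j) oU Uy grs) (christoffel_mx_col k j Uy).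
exact: comm_algebra.
Qed.

Lemma hessian_coord_laplacian y : U y -> coord_laplacian G f y = \tr (Gi y *m H y).
Proof. by move=> Uy; rewrite coord_laplacian_hessian hessian_tr. Qed.

(** The inverse metric is parallel, so its derivative supplies exactly the connection terms that
    turn the derivative of the Hessian into [N j y]. *)
Lemma partial_coord_laplacian j y : U y ->
  partial j (coord_laplacian G f) y = \tr (Gi y *m N j y).
Proof.
move=> Uy; have Gis := invmx_metric_smooth; have Hs := hessian_smooth.
have -> : partial j (coord_laplacian G f) y =
    'D_(e_ j) (fun z => \tr (Gi z *m H z)) y.
  apply: near_eq_derive; apply: open_eq_near oU _ Uy => z Uz.
  exact: hessian_coord_laplacian.
rewrite (derive_mxtrace _ Uy); last exact: mx_smoothM.
rewrite (mx_deriveM _ Uy)// (inverse_metric_compat j Uy).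
exact: trace_algebra.
Qed.

Let W y := Gi y *m gr y.

(** The Ricci identity contracted with the inverse metric: exchanging the derivatives yields the
    differential of the Laplacian, and the trace of the curvature term is the Ricci tensor. *)
Lemma trace_derive_hessian y : U y ->
  \sum_k \sum_l Gi y k l * (N k y *m W y) l 0 =
  ((W y)^T *m gradient (coord_laplacian G f) y + (W y)^T *m ricci G y *m W y) 0 0.
Proof.
move=> Uy.
transitivity (\sum_j W y j 0 * \sum_k (Gi y *m col j (N k y)) k 0).
  exact: trace_swap.
have Ej j : \sum_k (Gi y *m col j (N k y)) k 0 =
    partial j (coord_laplacian G f) y + (ricci G y *m W y) j 0.
  rewrite partial_coord_laplacian// /mxtrace mxE.
  under [X in _ + X]eq_bigr do rewrite mxE mulr_suml.
  rewrite exchange_big /= -big_split; apply: eq_bigr => k _ /=.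
  (* The Ricci identity leaves the transposed curvature acting on the differential; antisymmetry
     carries the inverse metric across it, so that the curvature acts on the vector [W y]. *)
  have -> : Gi y *m col j (N k y) = col k (Gi y *m N j y) + riemann_mx G k j y *m W y.
    rewrite derive_hessian_comm// mulmxBr -col_mulmx; congr (_ + _).
    by rewrite mulmxA -mulNmx -riemann_mx_antisym// -mulmxA.
  rewrite addmx_entry; congr (_ + _); first by rewrite [LHS]mxE.
  by rewrite mxE; apply: eq_bigr => m _; congr (_ * _); rewrite !mxE.
rewrite addmx_entry -mulmxA !mxE -big_split; apply: eq_bigr => j _ /=.
by rewrite Ej !mxE; ring.
Qed.

(* At a critical point of [grad_sq G f] its Laplacian involves no Christoffel
   symbol, which is all that the maximum principle needs. *)
Lemma bochner_critical x : U x -> (forall k, partial k (grad_sq G f) x = 0) ->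
  coord_laplacian G (grad_sq G f) x =
  2 * (((W x)^T *m gradient (coord_laplacian G f) x
        + (W x)^T *m ricci G x *m W x) 0 0 + \tr (Gi x *m (H x *m Gi x *m H x))).
Proof.
move=> Ux F0; rewrite coord_laplacian_critical//.
have Hs := hessian_smooth; have Gis := invmx_metric_smooth.
have grs := gradient_smooth.
(* [P] is half the differential of the squared gradient. Its vanishing makes the partial derivatives
   of [P] at [x] equal to covariant ones, so [N] appears below. *)
have P0 : P x = 0.
  apply/colP => k; rewrite [RHS]mxE.
  have := F0 k; rewrite partial_grad_sq// => /eqP; rewrite mulf_eq0 pnatr_eq0 /=.
  by move/eqP.
have PE k l : partial k (partial l (grad_sq G f)) x =
    2 * (N k x *m W x + H x *m Gi x *m col k (H x)) l 0.
  have -> : partial k (partial l (grad_sq G f)) x =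
      'D_(e_ k) (fun y => 2 * P y l 0) x.
    apply: near_eq_derive; apply: open_eq_near oU _ Ux => z Uz.
    exact: partial_grad_sq.
  rewrite derive_mul ?derive_cst ?mul0r ?add0r//; last first.
    apply: (@smooth_on_derivable _ _ U) => //.
    by apply: mx_smoothM => //; apply: mx_smoothM.
  have -> : 'D_(e_ k) (fun y => P y l 0) x = (mx_derive (e_ k) P x) l 0.
    by rewrite mxE.
  have -> // : mx_derive (e_ k) P x = N k x *m W x + H x *m Gi x *m col k (H x).
  rewrite (mx_deriveM _ Ux)//; last exact: mx_smoothM.
  rewrite (mx_deriveM _ Ux)// derive_gradient// inverse_metric_compat//.
  exact: derive_product_algebra.
under eq_bigr => k _ do under eq_bigr => l _ do rewrite PE addmx_entry.
rewrite -trace_derive_hessian// mulrDr -[2 * \tr _]/(2 * _) /mxtrace.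
rewrite !mulr_sumr -big_split; apply: eq_bigr => k _ /=.
rewrite mxE !mulr_sumr -big_split; apply: eq_bigr => l _ /=.
rewrite -col_mulmx [in X in _ + X](_ : (col k _) l 0 = (H x *m Gi x *m H x) l k); last by rewrite mxE.
ring.
Qed.

End function.
End metric.
End tensor_calculus.

(** * Changes of coordinates *)

Section chain_rule.
Context {R : realType} {V : normedModType R}.

Lemma derive_row n (f : 'rV[R]_n -> R) x (w : 'rV[R]_n) : differentiable f x ->
  'D_w f x = (w *m gradient f x) 0 0.
Proof.
move=> fd; rewrite deriveE// {1}(row_sum_delta w) linear_sum mxE.
by apply: eq_bigr => i _; rewrite linearZ /= mxE /partial deriveE.
Qed.

Lemma differentiable_entry p q (f : V -> 'M[R]_(p, q)) i j x :
  differentiable f x -> differentiable (fun y => f y i j) x.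
Proof.
move=> fd; apply: (@differentiable_comp _ _ _ _ f (fun M : 'M[R]_(p, q) => M i j)) => //.
exact: differentiable_coord.
Qed.

Lemma derive_entry p q (f : V -> 'M[R]_(p, q)) i j x v :
  differentiable f x -> 'D_v (fun y => f y i j) x = ('D_v f x) i j.
Proof. by move=> fd; rewrite derive_mx ?mxE//; apply: diff_derivable. Qed.

Lemma smooth_on_entry p q (f : V -> 'M[R]_(p, q)) U i j : open U ->
  smooth_on U f -> smooth_on U (fun y => f y i j).
Proof.
move=> oU fs k; move: (fs k) => {fs}; elim: k f => [|k IH] f; first by move=> _ vs.
move=> /differentiable_uptoS[f0 f1]; apply/differentiable_uptoS; split.
  by move=> x /f0; apply: differentiable_entry.
move=> v; apply: differentiable_upto_congr (IH _ (f1 v)) => // y /f0 fy.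
by rewrite derive_entry.
Qed.

Lemma derive_comp_row n (phi : V -> 'rV[R]_n) (f : 'rV[R]_n -> R) x v :
  differentiable phi x -> differentiable f (phi x) ->
  'D_v (f \o phi) x = ('D_v phi x *m gradient f (phi x)) 0 0.
Proof.
move=> phid fd; rewrite deriveE; last exact: differentiable_comp.
by rewrite diff_comp//= -!deriveE//; exact: derive_row.
Qed.

(** The chain rule writes a derivative of the composite as a sum of products of a derivative of
    [phi] with some [partial a f \o phi], to which the induction on [k], taken for all [f],
    applies. *)
Lemma smooth_on_comp n U (U' : set 'rV[R]_n) (phi : V -> 'rV[R]_n) f :
  open U -> (forall x, U x -> U' (phi x)) ->
  smooth_on U phi -> smooth_on U' (f : _ -> R) -> smooth_on U (f \o phi).
Proof.
move=> oU UU' phis fs k; elim: k f fs => [|k IH] f fs; first by move=> vs.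
apply/differentiable_uptoS; split=> [x Ux|v].
  apply: differentiable_comp; first exact: smooth_on_differentiable phis Ux.
  exact: smooth_on_differentiable fs (UU' _ Ux).
apply: (@differentiable_upto_congr _ _ _ _ _
    (fun x => \sum_a 'D_v (fun y => phi y 0 a) x * (partial a f \o phi) x)) => //.
  move=> y Uy; rewrite derive_comp_row; last 2 first.
    exact: smooth_on_differentiable phis Uy.
    exact: smooth_on_differentiable fs (UU' _ Uy).
  rewrite mxE; apply: eq_bigr => a _; rewrite mxE derive_entry//.
  exact: smooth_on_differentiable phis Uy.
have H a : differentiable_upto k U
    (fun x => 'D_v (fun y => phi y 0 a) x * (partial a f \o phi) x).
  apply: differentiable_uptoM => //.
    exact: (smooth_on_derive v (smooth_on_entry 0 a oU phis)).
  exact/IH/smooth_on_derive.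
elim: (index_enum _) => [|a r IHr].
  by under eq_fun do rewrite big_nil; apply: differentiable_upto_cst.
under eq_fun do rewrite big_cons.
exact: differentiable_uptoD.
Qed.

End chain_rule.

Section koszul_change.
Context {R : realType} {n : nat}.

Lemma eq_row_mulmx p (A A' B : 'M[R]_n) (C : 'M[R]_(n, p)) i j l :
  (forall a, A j a = A' i a) -> (A *m B *m C) j l = (A' *m B *m C) i l.
Proof.
by move=> AA'; rewrite -!mulmxA !mxE; apply: eq_bigr => a _; rewrite AA'.
Qed.

Lemma conj_mulmx_entry (A B : 'M[R]_n) i j :
  (A *m B *m A^T) i j = \sum_c \sum_a A i c * A j a * B c a.
Proof.
rewrite mxE; under eq_bigr => a _ do rewrite !mxE mulr_suml.
rewrite exchange_big; apply: eq_bigr => c _; apply: eq_bigr => a _ /=; ring.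
Qed.

Variables (J : 'M[R]_n) (W : 'cV[R]_n) (X D : 'I_n -> 'M[R]_n).
Hypothesis X_sym : forall i j l, X i j l = X j i l.

(** In the application [J] is the Jacobian, [D c] a derivative of the target metric, and [X i] the
    term in which the left Jacobian factor is differentiated; [T i] is the term in which the metric
    is. The vector [W] is pushed forward to [W']. *)
Let T i := J *m (\sum_c J i c *: D c) *m J^T.

Let W' : 'cV[R]_n := J^T *m W.

Let T_entry i j l : T i j l =
  \sum_c \sum_a \sum_b J i c * J j a * D c a b * J l b.
Proof.
rewrite mxE; under eq_bigr => b _.
  rewrite !mxE; under eq_bigr => a _.
    rewrite summxE; under eq_bigr => c _ do rewrite mxE.
    over.
  rewrite mulr_suml; under eq_bigr => a _ do rewrite mulr_sumr mulr_suml.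
  over.
rewrite exchange_big /= [RHS]exchange_big; apply: eq_bigr => a _ /=.
rewrite exchange_big; apply: eq_bigr => c _ /=.
apply: eq_bigr => b _; ring.
Qed.

Let W'_entry b : W' b 0 = \sum_l J l b * W l 0.
Proof. by rewrite mxE; apply: eq_bigr => l _; rewrite mxE. Qed.

Let T_contract i j : \sum_l T i j l * W l 0 =
  \sum_c \sum_a J i c * J j a * \sum_b D c a b * W' b 0.
Proof.
under eq_bigr => l _ do rewrite T_entry mulr_suml.
rewrite exchange_big; apply: eq_bigr => c _ /=.
under eq_bigr => l _ do rewrite mulr_suml.
rewrite exchange_big; apply: eq_bigr => a _ /=.
under eq_bigr => l _ do rewrite mulr_suml.
rewrite exchange_big mulr_sumr; apply: eq_bigr => b _ /=.
rewrite W'_entry !mulr_sumr; apply: eq_bigr => l _; ring.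
Qed.

Let T_contract' i j : \sum_l T l i j * W l 0 =
  \sum_c \sum_a J i c * J j a * \sum_b D b c a * W' b 0.
Proof.
under eq_bigr => l _ do rewrite T_entry mulr_suml.
rewrite exchange_big /=.
under eq_bigr => b _ do under eq_bigr => l _ do rewrite mulr_suml.
under eq_bigr => b _ do rewrite exchange_big /=.
rewrite exchange_big; apply: eq_bigr => c _ /=.
under eq_bigr => b _ do under eq_bigr => l _ do rewrite mulr_suml.
under eq_bigr => b _ do rewrite exchange_big /=.
rewrite exchange_big; apply: eq_bigr => a _ /=.
rewrite mulr_sumr; apply: eq_bigr => b _.
rewrite W'_entry !mulr_sumr; apply: eq_bigr => l _; ring.
Qed.

(* The terms of [X] differentiate the Jacobian; by symmetry of the second
   derivatives all of them but one cancel in the Koszul combination. *)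
Lemma koszul_change (dG : 'I_n -> 'M[R]_n) i j :
  (forall k, dG k = X k + (X k)^T + T k) ->
  \sum_l (dG i j l + dG j i l - dG l i j) * W l 0 =
  2 * (X i *m W) j 0 + \sum_c \sum_a J i c * J j a *
    \sum_b (D c a b + D a c b - D b c a) * W' b 0.
Proof.
move=> dGE.
have E k p q : dG k p q = X k p q + X k q p + T k p q.
  by rewrite dGE !addmx_entry [(X k)^T p q]mxE.
transitivity (\sum_l (2 * (X i j l * W l 0) + (T i j l * W l 0 + T j i l * W l 0
   - T l i j * W l 0))).
  apply: eq_bigr => l _; rewrite !E (X_sym j i l) (X_sym i l j) (X_sym j l i); ring.
rewrite big_split -mulr_sumr /= [(X i *m W) j 0]mxE; congr (_ + _).
rewrite !big_split sumrN /= !T_contract T_contract'.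
rewrite [X in _ + X - _]exchange_big /= -big_split -sumrB; apply: eq_bigr => c _ /=.
rewrite -big_split -sumrB; apply: eq_bigr => a _ /=.
rewrite [J j a * J i c]mulrC -mulrDr -mulrBr -big_split -sumrB /=; congr (_ * _).
by apply: eq_bigr => b _; ring.
Qed.

End koszul_change.

(** * Invariance of the squared gradient, the Hessian and the Laplacian *)

Section change_of_coordinates.
Context {R : realType} {n : nat}.
Notation e_ k := (delta_mx 0 k : 'rV[R]_n).
Variables (U U' : set 'rV[R]_n) (phi : 'rV[R]_n -> 'rV[R]_n).
Variables (G G' : 'rV[R]_n -> 'M[R]_n).
Hypotheses (oU : open U) (UU' : forall y, U y -> U' (phi y)).
Hypothesis phis : smooth_on U phi.
Hypotheses (Gpd : forall y, U y -> posdef (G y)).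
Hypotheses (Gs' : mx_smooth U' G') (Gpd' : forall y, U' y -> posdef (G' y)).
Hypothesis GG' : forall y, U y -> G y = 'J phi y *m G' (phi y) *m ('J phi y)^T.

Let J y : 'M[R]_n := \matrix_(i, a) partial i (fun z => phi z 0 a) y.

Let phid y : U y -> differentiable phi y.
Proof. exact: smooth_on_differentiable phis. Qed.

Lemma jacobian_partial y : U y -> 'J phi y = J y.
Proof.
move=> Uy; apply/matrixP => i a; rewrite !mxE.
by rewrite /partial derive_entry ?deriveE//; exact: phid.
Qed.

Let metric_change y : U y -> G y = J y *m G' (phi y) *m (J y)^T.
Proof. by move=> Uy; rewrite GG'// jacobian_partial. Qed.

Lemma jacobian_smooth : mx_smooth U J.
Proof.
move=> i a; under eq_fun do rewrite mxE.
exact/smooth_on_derive/smooth_on_entry.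
Qed.

Lemma jacobian_unitmx y : U y -> J y \in unitmx.
Proof.
move=> Uy; have := posdef_unitmx (Gpd Uy); rewrite metric_change//.
by rewrite !unitmx_mul => /andP[/andP[]].
Qed.

Lemma inverse_metric_change y : U y ->
  (J y)^T *m invmx (G y) *m J y = invmx (G' (phi y)).
Proof.
move=> Uy; have uJ := jacobian_unitmx Uy.
have uS := posdef_unitmx (Gpd' (UU' Uy)); have uG := posdef_unitmx (Gpd Uy).
apply: (can_inj (mulKmx uS)); rewrite mulmxV//.
apply: (can_inj (mulKmx uJ)); rewrite !mulmxA mulmx1 -metric_change//.
by rewrite mulmxV// mul1mx.
Qed.

Let K i y := mx_derive (e_ i) J y.

Lemma jacobian_derive_sym i j a y : U y -> K i y j a = K j y i a.
Proof.
move=> Uy; have E b c : K b y c a = 'D_(e_ b) ('D_(e_ c) (fun z => phi z 0 a)) y.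
  rewrite mxE; suff -> : (fun z => J z c a) = 'D_(e_ c) (fun z => phi z 0 a) by [].
  by apply/funext => z; rewrite mxE.
have S := smooth_on_entry 0 a oU phis.
have C := @derive_comm _ _ _ U y (e_ i) (e_ j) oU Uy (S 2%N).
exact: etrans (E i j) (etrans C (esym (E j i))).
Qed.

Section function.
Variables f f' : 'rV[R]_n -> R.
Hypothesis fs' : smooth_on U' f'.
Hypothesis ff' : forall y, U y -> f y = f' (phi y).

Lemma gradient_change y : U y -> gradient f y = J y *m gradient f' (phi y).
Proof.
move=> Uy; apply/colP => i; rewrite [LHS]mxE.
have -> : partial i f y = 'D_(e_ i) (f' \o phi) y.
  by apply: near_eq_derive; apply: open_eq_near oU _ Uy => z; apply: ff'.
rewrite derive_comp_row; last 2 first.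
- exact: phid.
- exact: smooth_on_differentiable fs' (UU' Uy).
rewrite !mxE; apply: eq_bigr => a _; congr (_ * _).
by rewrite mxE /partial derive_entry//; exact: phid.
Qed.

Lemma grad_sq_change y : U y -> grad_sq G f y = grad_sq G' f' (phi y).
Proof.
move=> Uy; rewrite /grad_sq gradient_change// -inverse_metric_change//.
by rewrite trmx_mul !mulmxA.
Qed.

Let ddf i j y : U y -> partial i (partial j f) y =
  (K i y *m gradient f' (phi y)) j 0 +
  \sum_c \sum_a J y i c * J y j a * partial c (partial a f') (phi y).
Proof.
move=> Uy.
have -> : partial i (partial j f) y =
    'D_(e_ i) (fun z => \sum_a J z j a * (partial a f' \o phi) z) y.
  apply: near_eq_derive; apply: open_eq_near oU _ Uy => z Uz.
  have /colP/(_ j) := gradient_change Uz; rewrite [LHS]mxE [RHS]mxE => ->.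
  by apply: eq_bigr => a _; congr (_ * _); rewrite mxE.
have Jd a : derivable (fun z => J z j a) y (e_ i).
  exact: smooth_on_derivable (jacobian_smooth j a) Uy.
have fd a : smooth_on U (partial a f' \o phi).
  by apply: smooth_on_comp oU UU' phis _; apply: smooth_on_derive.
have fd' a : derivable (partial a f' \o phi) y (e_ i).
  exact: smooth_on_derivable (fd a) Uy.
rewrite derive_sum_seq; last by move=> a; exact: derivableM (Jd a) (fd' a).
rewrite [X in _ = X + _]mxE [X in _ = _ + X]exchange_big -big_split.
apply: eq_bigr => a _ /=.
have KE : K i y j a = 'D_(e_ i) (fun z => J z j a) y by rewrite mxE.
have gE : gradient f' (phi y) a 0 = partial a f' (phi y) by rewrite mxE.
apply: etrans (derive_mul (Jd a) (fd' a)) _; rewrite KE gE; congr (_ + _).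
rewrite derive_comp_row; last 2 first.
- exact: phid.
- exact: smooth_on_differentiable (smooth_on_derive _ fs') (UU' Uy).
rewrite [X in _ * X = _]mxE mulr_sumr; apply: eq_bigr => c _.
have -> : J y i c = ('D_(e_ i) phi y) 0 c.
  by rewrite mxE /partial derive_entry//; exact: phid.
by rewrite [gradient _ _ c 0]mxE mulrCA mulrA.
Qed.

(** In a Hessian the Christoffel symbols occur only contracted with the differential. Moving the
    inverse metric onto the differential leaves a Koszul combination of metric derivatives, so the
    transformation law of the symbols themselves can be bypassed. *)
Lemma christoffel_contract (H : 'rV[R]_n -> 'M[R]_n) h i j y :
  (invmx (H y))^T = invmx (H y) ->
  \sum_k christoffel H k i j y * partial k h y =
  2^-1 * \sum_l (mx_derive (e_ i) H y j l + mx_derive (e_ j) H y i l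
     - mx_derive (e_ l) H y i j) * (invmx (H y) *m gradient h y) l 0.
Proof.
move=> HT; have PE k a b : mx_derive (e_ k) H y a b = partial k (fun x => H x a b) y.
  by rewrite mxE.
under [in RHS]eq_bigr => l _ do rewrite !PE.
rewrite mulr_sumr.
under eq_bigr => k _ do rewrite /christoffel mulr_sumr mulr_suml.
rewrite exchange_big; apply: eq_bigr => l _ /=.
rewrite mxE !mulr_sumr; apply: eq_bigr => k _ /=.
rewrite -{1}HT ![(_ ^T) _ _]mxE [gradient _ _ _ _]mxE; ring.
Qed.

Lemma hessian_change y : U y ->
  hessian G f y = J y *m hessian G' f' (phi y) *m (J y)^T.
Proof.
move=> Uy; have Uy' := UU' Uy; have uJ := jacobian_unitmx Uy.
pose W := invmx (G y) *m gradient f y.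
pose W' := invmx (G' (phi y)) *m gradient f' (phi y).
have WW' : (J y)^T *m W = W'.
  by rewrite /W gradient_change// !mulmxA inverse_metric_change.
have Js := jacobian_smooth.
have comps : mx_smooth U (G' \o phi).
  by move=> a b; exact: smooth_on_comp oU UU' phis (Gs' a b).
have JTs := mx_smooth_tr Js.
have Ss : (G' (phi y))^T = G' (phi y) by have [] := Gpd' Uy'.
have dGE k : mx_derive (e_ k) G y = K k y *m G' (phi y) *m (J y)^T
    + (K k y *m G' (phi y) *m (J y)^T)^T
    + J y *m (\sum_c J y k c *: mx_derive (e_ c) G' (phi y)) *m (J y)^T.
  rewrite (mx_derive_near (N := fun z => J z *m (G' \o phi) z *m (J z)^T) _ oU Uy
    metric_change).
  rewrite (mx_deriveM _ Uy)//; last exact: mx_smoothM.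
  rewrite (mx_deriveM _ Uy)// mx_derive_tr -/(K k y).
  have -> : mx_derive (e_ k) (G' \o phi) y =
      \sum_c J y k c *: mx_derive (e_ c) G' (phi y).
    apply/matrixP => a b; rewrite mxE summxE.
    have -> : 'D_(e_ k) (fun z => (G' \o phi) z a b) y =
      'D_(e_ k) ((fun x => G' x a b) \o phi) y by [].
    rewrite derive_comp_row; last 2 first.
    - exact: phid.
    - exact: smooth_on_differentiable (Gs' a b) Uy'.
    rewrite mxE; apply: eq_bigr => c _; rewrite [RHS]mxE; congr (_ * _).
      by rewrite mxE /partial derive_entry//; exact: phid.
    by rewrite !mxE.
  by rewrite !trmx_mul trmxK Ss mulmxDl mulmxA addrAC.
have XS i j l : (K i y *m G' (phi y) *m (J y)^T) j l =
    (K j y *m G' (phi y) *m (J y)^T) i l.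
  by apply: eq_row_mulmx => a; exact: jacobian_derive_sym.
apply/matrixP => i j; rewrite [LHS]mxE.
rewrite christoffel_contract; last exact: (invmx_metric_tr Gpd).
rewrite (@koszul_change _ _ (J y) W _ _ XS _ i j dGE) -/W WW' ddf//.
(* The second derivatives of [phi] coming from the Koszul combination equal those in [ddf], and the
   two cancel. *)
have -> : (K i y *m G' (phi y) *m (J y)^T *m W) j 0 =
    (K i y *m gradient f' (phi y)) j 0.
  congr (fun_of_matrix _ j 0).
  by rewrite -mulmxA WW' /W' -mulmxA mulKVmx//; apply: posdef_unitmx (Gpd' Uy').
rewrite mulrDr mulKf ?pnatr_eq0// opprD addrACA subrr add0r.
rewrite mulr_sumr -sumrB.
have -> : (J y *m hessian G' f' (phi y) *m (J y)^T) i j =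
   \sum_c \sum_a J y i c * J y j a * hessian G' f' (phi y) c a.
  exact: conj_mulmx_entry.
apply: eq_bigr => c _; rewrite mulr_sumr -sumrB; apply: eq_bigr => a _.
rewrite mulrCA -mulrBr; congr (_ * _); rewrite [RHS]mxE christoffel_contract//.
exact: (invmx_metric_tr Gpd').
Qed.

Lemma coord_laplacian_change y : U y ->
  coord_laplacian G f y = coord_laplacian G' f' (phi y).
Proof.
move=> Uy; rewrite !coord_laplacian_hessian hessian_change//.
rewrite !trmx_mul trmxK -inverse_metric_change// !mulmxA.
by rewrite [LHS]mxtrace_mulC !mulmxA.
Qed.

End function.
End change_of_coordinates.

(** * Lengths, gradients and Lipschitz constants *)

Section unit_interval_integral.
Context {R : realType}.
Local Notation mu := (@lebesgue_measure R).

(* Unlike [ge0_le_integral], this does not require measurability. *)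
Lemma le_integral_nonmeasurable (D : set R) (f g : R -> \bar R) :
  (forall x, D x -> (0 <= f x)%E) -> (forall x, D x -> (f x <= g x)%E) ->
  (\int[mu]_(x in D) f x <= \int[mu]_(x in D) g x)%E.
Proof.
move=> f0 fg; rewrite !ge0_integralE//; last first.
  by move=> x Dx; apply: le_trans (fg x Dx); apply: f0.
apply: ge_ereal_sup => _ [h hf <-]; apply: ereal_sup_ubound; exists h => // x.
apply: le_trans (hf x) _; rewrite /patch; case: ifPn => //.
by rewrite inE => /fg.
Qed.

Lemma integral01_le_cst (s : R -> R) (B : R) :
  (forall t, 0 <= t <= 1 -> 0 <= s t <= B) ->
  (\int[mu]_(t in `[0%R, 1%R]) (s t)%:E <= B%:E)%E.
Proof.
move=> sB.
have -> : B%:E = (\int[mu]_(t in `[0%R, 1%R]) cst B%:E t)%E.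
  rewrite integral_cst//= lebesgue_measure_itv /= lte_fin ltr01.
  by rewrite sube0 mule1.
apply: le_integral_nonmeasurable => x /=; rewrite in_itv /= lee_fin => /sB /andP[//].
Qed.

(** In the application [s] is a speed, computed at each time in the chart selected there; it is
    therefore only compared pointwise, and the regularity is asked of [h']. *)
Lemma increment_le_integral (h h' s : R -> R) :
  (forall t : R, 0 <= t <= 1 -> is_derive t 1 h (h' t)) ->
  (forall t, 0 <= t <= 1 -> {for t, continuous h'}) ->
  (forall t, 0 <= t <= 1 -> `|h' t| <= s t) ->
  (`|h 1 - h 0|%:E <= \int[mu]_(t in `[0%R, 1%R]) (s t)%:E)%E.
Proof.
move=> hd h'c h's.
have h'C : {within `[0, 1], continuous h'}.
  by apply: continuous_in_subspaceT => t; rewrite inE /= in_itv /= => /h'c.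
have hc t : 0 <= t <= 1 -> {for t, continuous h}.
  move=> tI; apply: differentiable_continuous; apply/derivable1_diffP.
  by have [] := hd t tI.
have hI : derivable_oo_LRcontinuous h 0 1.
  split.
  - move=> t; rewrite in_itv /= => /andP[t0 t1].
    by have [] := hd t; rewrite ?(ltW t0) ?(ltW t1).
  - by apply: cvg_at_right_filter; apply: hc; rewrite lexx ler01.
  - by apply: cvg_at_left_filter; apply: hc; rewrite lexx ler01.
have := @continuous_FTC2 _ h' h 0 1 ltr01 h'C hI.
move=> /(_ _) FTC.
have {FTC} FTC : (\int[mu]_(x in `[0%R, 1%R]) (h' x)%:E = (h 1)%:E - (h 0)%:E)%E.
  apply: FTC => t; rewrite in_itv /= => /andP[t0 t1].
  by rewrite derive1E; have [] := hd t; rewrite ?(ltW t0) ?(ltW t1).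
have -> : `|h 1 - h 0|%:E = `|\int[mu]_(x in `[0%R, 1%R]) (h' x)%:E|%E.
  by rewrite FTC -EFinB.
apply: le_trans (le_abse_integral _ _ _) _ => //.
  apply/measurable_EFinP; apply: subspace_continuous_measurable_fun => //.
apply: le_integral_nonmeasurable => t //=; rewrite in_itv /= => tI.
by rewrite lee_fin; apply: h's.
Qed.

End unit_interval_integral.

Section charts.
Context {R : realType} {n : nat} {M : topologicalType}.
Implicit Types (c : chart R n M) (p : M) (x : 'rV[R]_n).

Lemma cimgP c p : cdom c p -> cimg c (c p).
Proof. by move=> cp; exists p. Qed.

Lemma cinvK c x : cimg c x -> c (cinv c x) = x.
Proof. by move=> [p cp <-]; rewrite cmapK. Qed.

Lemma cdom_cinv c x : cimg c x -> cdom c (cinv c x).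
Proof. by move=> [p cp <-]; rewrite cmapK. Qed.

Lemma near_cimg c x : cimg c x -> \forall y \near x, cimg c y.
Proof. by move=> cx; apply: open_nbhs_nbhs; split=> //; exact: open_cimg. Qed.

Lemma near_cdom c p : cdom c p -> \forall q \near p, cdom c q.
Proof. by move=> cp; apply: open_nbhs_nbhs; split=> //; exact: open_cdom. Qed.

Lemma overlap_open c c' : open (c @` (cdom c `&` cdom c')).
Proof.
rewrite openE => x [p [cp c'p] <-]; rewrite /interior.
have H : \forall y \near c p, cdom c' (cinv c y).
  have := @cinv_continuous _ _ _ c (c p) (cimgP cp).
  by rewrite /prop_for /continuous_at cmapK//; apply; exact: near_cdom.
apply: filterS2 (near_cimg (cimgP cp)) H => y cy c'y.
by exists (cinv c y); [split=> //; exact: cdom_cinv|exact: cinvK].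
Qed.

Lemma overlap_cinv c c' x : (c @` (cdom c `&` cdom c')) x ->
  [/\ cdom c (cinv c x), cdom c' (cinv c x), c (cinv c x) = x
    & transition c c' x = c' (cinv c x)].
Proof. by move=> [p [cp c'p] <-]; rewrite /transition /= cmapK. Qed.

End charts.

Section manifold.
Context {R : realType} {n : nat} {M : topologicalType}.
Variable A : orientedManifold R n M.
Variable g : tensor R n M.
Hypothesis g_riem : is_riemannian A g.
Implicit Types (c : chart R n M) (p : M) (x v : 'rV[R]_n) (f : M -> R).

Lemma metric_smooth c : atlas A c -> mx_smooth (cimg c) (g c).
Proof. by move=> Ac i j; have [H _ _ _] := g_riem; apply: H. Qed.

Lemma metric_posdef c x : atlas A c -> cimg c x -> posdef (g c x).
Proof.
move=> Ac cx; have [_ S P _] := g_riem; split; first exact: S.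
by move=> v; apply: P.
Qed.

Definition smooth_function f := forall c, atlas A c ->
  smooth_on (cimg c) (f \o cinv c).

Definition manifold_grad_sq f p := let c := chart_at A p in
  grad_sq (g c) (f \o cinv c) (c p).

Section change.
Variables (c c' : chart R n M).
Hypotheses (Ac : atlas A c) (Ac' : atlas A c').
Let U := c @` (cdom c `&` cdom c').

Let oU : open U. Proof. exact: overlap_open. Qed.
Let Uc y : U y -> cimg c y. Proof. by move=> [p [cp _] <-]; exact: cimgP. Qed.
Let UU' y : U y -> cimg c' (transition c c' y).
Proof. by move=> /overlap_cinv[_ c'y _ ->]; exact: cimgP. Qed.
Let Gpd y : U y -> posdef (g c y).
Proof. by move=> /Uc; exact: metric_posdef. Qed.

Let GG' y : U y -> g c y =
  'J (transition c c') y *m g c' (transition c c' y) *m ('J (transition c c') y)^T.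
Proof.
move=> /overlap_cinv[cy c'y yE ->]; have [_ _ _ T] := g_riem.
by have := T c c' _ Ac Ac' cy c'y; rewrite /= yE.
Qed.

Lemma metric_change_quadratic y v : U y ->
  let w := 'D_v (transition c c') y in
  w *m g c' (transition c c' y) *m w^T = v *m g c y *m v^T.
Proof.
move=> Uy w; have -> : w = v *m 'J (transition c c') y.
  apply: deriveEjacobian.
  exact: smooth_on_differentiable (atlas_smooth Ac Ac') Uy.
by rewrite GG'// trmx_mul !mulmxA.
Qed.

Let ff' f y : U y -> (f \o cinv c) y = (f \o cinv c') (transition c c' y).
Proof. by move=> /overlap_cinv[cy c'y yE tE]; rewrite /= tE cmapK. Qed.

Lemma grad_sq_transition f y : smooth_function f -> U y ->
  grad_sq (g c) (f \o cinv c) y = grad_sq (g c') (f \o cinv c') (transition c c' y).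
Proof.
move=> fs Uy.
exact: (grad_sq_change oU UU' (atlas_smooth Ac Ac') Gpd
  (fun y c'y => metric_posdef Ac' c'y) GG' (fs _ Ac') (@ff' f) Uy).
Qed.

Lemma coord_laplacian_transition f y : smooth_function f -> U y ->
  coord_laplacian (g c) (f \o cinv c) y =
  coord_laplacian (g c') (f \o cinv c') (transition c c' y).
Proof.
move=> fs Uy.
exact: (coord_laplacian_change oU UU' (atlas_smooth Ac Ac') Gpd
  (metric_smooth Ac') (fun y c'y => metric_posdef Ac' c'y) GG' (fs _ Ac')
  (@ff' f) Uy).
Qed.

End change.

(** Since the chart selected at [p] varies with [p], continuity and maxima of [manifold_grad_sq]
    become accessible only after passing to one fixed chart. *)
Lemma manifold_grad_sqE f c p : smooth_function f -> atlas A c -> cdom c p ->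
  manifold_grad_sq f p = grad_sq (g c) (f \o cinv c) (c p).
Proof.
move=> fs Ac cp; rewrite /manifold_grad_sq.
have Ac' := atlas_chart_at A p; have c'p := cdom_chart_at A p.
rewrite (@grad_sq_transition _ c)//; last by exists p.
by rewrite /transition /= cmapK.
Qed.

Lemma laplacianE f c p : smooth_function f -> atlas A c -> cdom c p ->
  laplacian A g f p = coord_laplacian (g c) (f \o cinv c) (c p).
Proof.
move=> fs Ac cp; rewrite /laplacian.
have Ac' := atlas_chart_at A p; have c'p := cdom_chart_at A p.
rewrite (@coord_laplacian_transition _ c)//; last by exists p.
by rewrite /transition /= cmapK.
Qed.

(** The segment from [x] to [x + v] in the chart is an admissible curve of speed at most [B]. Such
    segments provide the upper bounds on distances, both in the gradient estimate and for the
    continuity of [D]. *)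
Lemma riemannian_dist_segment c x v (B : R) : atlas A c ->
  (forall s : R, 0 <= s <= 1 -> cimg c (x + s *: v)) ->
  (forall s : R, 0 <= s <= 1 ->
     (v *m g c (x + s *: v) *m v^T) 0 0 <= B ^+ 2) ->
  0 <= B ->
  (riemannian_dist A g (cinv c x) (cinv c (x + v)) <= B%:E)%E.
Proof.
move=> Ac xI gB B0.
pose gamma (s : R^o) := cinv c (x + s *: v).
have chartD (t : R) : 0 <= t <= 1 -> (c @` (cdom c `&` cdom (chart_at A (gamma t)))) (x + t *: v).
  move=> tI; exists (gamma t); last by rewrite cinvK//; exact: xI.
  by split; [apply/cdom_cinv/xI|exact: cdom_chart_at].
have sm : smooth_curve A gamma.
  move=> t tI; set c' := chart_at A (gamma t).
  (* [smooth_curve] reads the curve in the chart selected at [gamma t]. As long as the segment stays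
     in the overlap with [c], this reading is the transition map composed with an affine line. *)
  pose U : set R^o := (fun s : R^o => x + s *: v) @^-1` (c @` (cdom c `&` cdom c')).
  exists U.
    split; last exact: chartD.
    apply: open_comp; last exact: overlap_open.
    move=> s _.
    exact/differentiable_continuous/differentiable_line.
  split=> [s /overlap_cinv[_ ? _ _]//|k].
  apply: (@differentiable_upto_affine _ _ _ _ _ _ (line_affine v x) k
    (c @` (cdom c `&` cdom c')) U (transition c c')).
  - by move=> s; apply: differentiable_line.
  - by [].
  - exact: atlas_smooth Ac (atlas_chart_at A _) k.
have sp t : 0 <= t <= 1 -> 0 <= speed A g gamma t <= B.
  move=> tI; rewrite /speed sqrtr_ge0 /=.
  set c' := chart_at A (gamma t).
  have tD := chartD t tI.
  have -> : 'D_1 (c' \o gamma) (t : R^o) = 'D_v (transition c c') (x + t *: v).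
    have := @derive_affine _ _ _ _ _ _ (line_affine v x) (transition c c') t (1 : R^o).
    by rewrite scale1r => <-.
  have -> : c' (gamma t) = transition c c' (x + t *: v) by [].
  rewrite (metric_change_quadratic Ac (atlas_chart_at A _) v tD).
  rewrite -[leRHS]ger0_norm// -sqrtr_sqr; apply: ler_wsqrtr.
  exact: gB.
apply: le_trans (_ : (curve_length A g gamma <= _)%E); last first.
  exact: integral01_le_cst.
apply: ereal_inf_lbound.
have -> : cinv c x = gamma 0 by rewrite /gamma scale0r addr0.
have -> : cinv c (x + v) = gamma 1 by rewrite /gamma scale1r.
rewrite /= -[X in path_length _ _ _ _ X]adde0.
by apply: path_length_cons => //; apply: path_length_nil.
Qed.

End manifold.

(** * Gradient bounds versus Lipschitz bounds *)

Section lipschitz_gradient.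
Context {R : realType} {n : nat} {M : topologicalType}.
Variable A : orientedManifold R n M.
Variable g : tensor R n M.
Hypothesis g_riem : is_riemannian A g.
Implicit Types (c : chart R n M) (p : M) (x v : 'rV[R]_n) (f : M -> R).

Lemma metric_quadratic_continuous c x v : atlas A c -> cimg c x ->
  {for x, continuous (fun y => (v *m g c y *m v^T) 0 0)}.
Proof.
move=> Ac cx; have oc : open (cimg c) by exact: open_cimg.
apply/differentiable_continuous.
have S : mx_smooth (cimg c) (fun y => v *m g c y *m v^T).
  apply: mx_smoothM => //; last exact: mx_smooth_cst.
  by apply: mx_smoothM => //; [exact: mx_smooth_cst|exact: (metric_smooth g_riem Ac)].
exact: smooth_on_differentiable (S 0 0) cx.
Qed.

(** Moving from [p] by [h] times the metric gradient [v] changes [f] by about [h * F], along a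
    segment of length about [h] times the square root of [F]; hence [F] is at most [L] times that
    root. *)
Lemma grad_sq_le_lipschitz f p (L : R) : smooth_function A f -> 0 <= L ->
  (forall q (B : R), 0 <= B -> (riemannian_dist A g p q <= B%:E)%E ->
     `|f p - f q| <= L * B) ->
  manifold_grad_sq A g f p <= L ^+ 2.
Proof.
move=> fs L0 fL; rewrite /manifold_grad_sq.
set c := chart_at A p; have Ac : atlas A c := atlas_chart_at A p.
have cp : cdom c p := cdom_chart_at A p.
have cx := cimgP cp; set x := c p in cx *; have xp : cinv c x = p by exact: cmapK.
have Gpd := metric_posdef g_riem Ac cx; have uG := posdef_unitmx Gpd.
pose d := gradient (f \o cinv c) x.
pose F := grad_sq (g c) (f \o cinv c) x; rewrite -/F.
pose v := d^T *m invmx (g c x).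
have vF : (v *m g c x *m v^T) 0 0 = F.
  rewrite /v mulmxKV// trmx_mul trmxK trmx_inv Gpd.1 mulmxA //.
have F0 : 0 <= F by rewrite -vF; exact: posdef_ge0.
have fd : differentiable (f \o cinv c) x.
  exact: smooth_on_differentiable (fs _ Ac) cx.
have DF : 'D_v (f \o cinv c) x = F by rewrite derive_row.
(* The slack [e] absorbs the variation of the metric coefficients along the short segment. *)
have key e : 0 < e -> F <= L * Num.sqrt (F + e).
  move=> e0; rewrite leNgt; apply/negP => FL.
  have : \forall y \near x, cimg c y /\ (v *m g c y *m v^T) 0 0 < F + e.
    apply: filterI; first exact: near_cimg.
    have := @metric_quadratic_continuous c x v Ac cx.
    rewrite /prop_for /continuous_at vF => /cvgr_lt; apply; lra.
  move=> /nbhs_ballP[r /= r0 rB].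
  have dv := diff_derivable (v := v) fd.
  have Q : \forall h \near (0 : R)^'+, L * Num.sqrt (F + e) <
      h^-1 *: (((f \o cinv c) \o shift x) (h *: v) - (f \o cinv c) x).
    have : (fun h : R => h^-1 *: (((f \o cinv c) \o shift x) (h *: v) - (f \o cinv c) x))
      @ 0^'+ --> F.
      by apply: cvg_dnbhs_at_right; rewrite -DF.
    by move=> /cvgr_gt; apply.
  have v10 : 0 < 1 + `|v| by have := normr_ge0 v; lra.
  have S : \forall h \near (0 : R)^'+, h < r / (1 + `|v|).
    by apply: nbhs_right_lt; rewrite divr_gt0.
  have [h [h0 [hr hQ]]] := filter_ex (filterI (nbhs_right_gt 0) (filterI S Q)).
  rewrite /= in h0.
  have near s : 0 <= s <= 1 -> ball x r (x + s *: (h *: v)).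
    move=> /andP[s0 s1]; rewrite -ball_normE /= opprD addNKr normrN.
    rewrite !normrZ (ger0_norm s0) (gtr0_norm h0).
    rewrite ltr_pdivlMr// in hr; apply: le_lt_trans hr.
    have H := normr_ge0 v; have := mulr_ge0 (ltW h0) H; move=> H2.
    have := ler_piMl H2 s1; lra.
  have Fe0 : 0 <= F + e by lra.
  have dist : (riemannian_dist A g p (cinv c (x + h *: v)) <=
      (h * Num.sqrt (F + e))%:E)%E.
    rewrite -[in leLHS]xp; apply: riemannian_dist_segment => //.
    - by move=> s sI; have [] := rB _ (near s sI).
    - move=> s sI; have [_ /ltW sF] := rB _ (near s sI).
      have -> : (h *: v *m g c (x + s *: (h *: v)) *m (h *: v)^T) 0 0 =
          h * h * (v *m g c (x + s *: (h *: v)) *m v^T) 0 0.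
        have -> : (h *: v)^T = h *: v^T by rewrite linearZ.
        by rewrite -scalemxAr -!scalemxAl scalerA mxE.
      by rewrite exprMn sqr_sqrtr// -expr2 ler_wpM2l// sqr_ge0.
    - by rewrite mulr_ge0 ?sqrtr_ge0 ?ltW.
  have := fL _ _ (mulr_ge0 (ltW h0) (sqrtr_ge0 _)) dist.
  rewrite /= xp [h *: v + x]addrC in hQ.
  have {}hQ : h * (L * Num.sqrt (F + e)) < f (cinv c (x + h *: v)) - f p.
    by rewrite -ltr_pdivlMl//; exact: hQ.
  rewrite distrC.
  have := ler_norm (f (cinv c (x + h *: v)) - f p).
  by move=> H1 H2; have := le_trans H1 H2; lra.
rewrite leNgt; apply/negP => LF.
(* With this value [L ^+ 2 * e < F * (F - L ^+ 2)], which contradicts the square of [key], namely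
   [F ^+ 2 <= L ^+ 2 * (F + e)]. *)
pose e := F * (F - L ^+ 2) / (L ^+ 2 + 1).
have L20 : 0 <= L ^+ 2 by exact: sqr_ge0.
have F0' : 0 < F by lra.
have e0 : 0 < e by rewrite divr_gt0 ?mulr_gt0 ?subr_gt0//; lra.
have eE : e * (L ^+ 2 + 1) = F * (F - L ^+ 2) by rewrite divfK// gt_eqF//; lra.
have Fe0 : 0 <= F + e by lra.
have := key e e0; rewrite -(@ler_pXn2r _ 2)// ?nnegrE ?mulr_ge0 ?sqrtr_ge0//.
rewrite exprMn sqr_sqrtr// => H.
have : F ^+ 2 = F * F by rewrite expr2.
nra.
Qed.

Lemma smooth_function_curve f (gamma : R^o -> M) (t : R) :
  smooth_function A f -> smooth_curve A gamma -> 0 <= t <= 1 ->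
  exists2 U : set R^o, open_nbhs (t : R^o) U & smooth_on U (f \o gamma).
Proof.
move=> fs gs tI; have [U tU [Uc Us]] := gs t tI; exists U => //.
set c := chart_at A (gamma t) in Uc Us.
have oU : open U by case: tU.
apply: (@smooth_on_congr _ _ _ _ ((f \o cinv c) \o (c \o gamma))) => //.
  by move=> s /Uc cs /=; rewrite cmapK.
apply: (smooth_on_comp oU _ Us (fs c (atlas_chart_at A _))).
by move=> s /Uc cs; exact: cimgP.
Qed.

(** The derivative pairs the velocity with the differential of [f], so the Cauchy-Schwarz inequality
    for the metric and its inverse applies. *)
Lemma derive_curve_le_speed f (gamma : R^o -> M) (t K : R) :
  smooth_function A f -> smooth_curve A gamma -> 0 <= t <= 1 -> 0 <= K ->
  (forall p, manifold_grad_sq A g f p <= K ^+ 2) ->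
  `|'D_1 (f \o gamma) (t : R^o)| <= K * speed A g gamma t.
Proof.
move=> fs gs tI K0 gK; have [U [oU tU] [Uc Us]] := gs t tI.
have := gK (gamma t); rewrite /manifold_grad_sq /speed.
set c := chart_at A (gamma t) in Uc Us *; have Ac : atlas A c := atlas_chart_at A _.
set x := c (gamma t); set v := 'D_1 (c \o gamma) (t : R^o) => FK.
have cx : cimg c x by apply/cimgP/Uc.
have Gpd := metric_posdef g_riem Ac cx.
have -> : 'D_1 (f \o gamma) (t : R^o) = (v *m gradient (f \o cinv c) x) 0 0.
  have -> : 'D_1 (f \o gamma) (t : R^o) =
      'D_1 ((f \o cinv c) \o (c \o gamma)) (t : R^o).
    apply: near_eq_derive; apply: open_eq_near oU _ tU => s /Uc cs /=.
    by rewrite cmapK.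
  apply: derive_comp_row; first exact: smooth_on_differentiable Us tU.
  exact: smooth_on_differentiable (fs _ Ac) cx.
set q := (v *m g c x *m v^T) 0 0.
have q0 : 0 <= q by exact: posdef_ge0.
have -> : K * Num.sqrt q = Num.sqrt (K ^+ 2 * q).
  by rewrite sqrtrM ?sqr_ge0// sqrtr_sqr ger0_norm.
rewrite -sqrtr_sqr.
apply: ler_wsqrtr; apply: le_trans (cauchy_schwarz_posdef _ _ Gpd) _.
exact: ler_wpM2r.
Qed.

(** Induction on the path: by integration each smooth piece is at least as long as the increment of
    [f] along it divided by [K], and increments add up by the triangle inequality. *)
Lemma riemannian_dist_ge f (K : R) : smooth_function A f -> 0 < K ->
  (forall p, manifold_grad_sq A g f p <= K ^+ 2) ->
  forall x y : M, ((`|f x - f y| / K)%:E <= riemannian_dist A g x y)%E.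
Proof.
move=> fs K0 gK x y; apply: le_ereal_inf_tmp => l; elim=> {x y l} [x|gamma y l gs _ IH].
  by rewrite subrr normr0 mul0r.
have H : ((`|f (gamma 1) - f (gamma 0)| / K)%:E <= curve_length A g gamma)%E.
  have -> : `|f (gamma 1) - f (gamma 0)| / K =
      `|K^-1 * (f \o gamma) 1 - K^-1 * (f \o gamma) 0|.
    by rewrite -mulrBr normrM normfV (gtr0_norm K0) mulrC.
  apply: (@increment_le_integral _ (fun t : R => K^-1 * (f \o gamma) t)
    (fun t : R => K^-1 * 'D_1 (f \o gamma) (t : R^o))).
  - move=> t tI; have [U [oU tU] Us] := smooth_function_curve fs gs tI.
    apply: is_deriveZ; apply: derivableP.
    exact: smooth_on_derivable Us tU.
  - move=> t tI; have [U [oU tU] Us] := smooth_function_curve fs gs tI.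
    apply: differentiable_continuous; apply: differentiableZ.
    exact: smooth_on_differentiable (smooth_on_derive _ Us) tU.
  - move=> t tI; rewrite normrM normfV (gtr0_norm K0) ler_pdivrMl//.
    by apply: derive_curve_le_speed => //; exact: ltW.
apply: le_trans (leeD H IH); rewrite -EFinD lee_fin -mulrDl ler_pM2r ?invr_gt0//.
by rewrite [`|f (gamma 1) - _|]distrC; exact: ler_distD.
Qed.

End lipschitz_gradient.

(** * Maximum principles *)

Section laplacian_at_max.
Context {R : realType} {n : nat}.
Implicit Types (U : set 'rV[R]_n) (f : 'rV[R]_n -> R).

Lemma second_derive_row U f x (v : 'rV[R]_n) : open U -> U x ->
  differentiable_upto 2 U f ->
  'D_v ('D_v f) x =
  (v *m (\matrix_(i, j) partial i (partial j f) x) *m v^T) 0 0.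
Proof.
move=> oU Ux /differentiable_uptoS[f0 f1].
have fj j : differentiable (partial j f) x.
  by have /differentiable_uptoS[H _] := f1 (delta_mx 0 j); apply: H.
transitivity ('D_v (fun y => \sum_j v 0 j * partial j f y) x).
  apply: near_eq_derive; apply: open_eq_near oU _ Ux => y Uy.
  rewrite derive_row; last exact: f0.
  by rewrite mxE; apply: eq_bigr => j _; rewrite [gradient _ _ _ _]mxE.
rewrite derive_sum_seq => [|j]; last first.
  have cd : derivable (fun=> v 0 j : R) x v by exact: derivable_cst.
  have pd : derivable (partial j f) x v by exact: diff_derivable.
  exact: derivableM cd pd.
rewrite mxE; apply: eq_bigr => j _.
rewrite derive_mul; [|exact: derivable_cst|exact: diff_derivable].
rewrite derive_cst mul0r add0r mulrC [X in _ = _ * X]mxE; congr (_ * _).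
rewrite derive_row// !mxE; apply: eq_bigr => i _.
by rewrite !mxE.
Qed.

(** First derivatives vanish at the maximum, leaving the trace of the inverse metric against the
    second derivatives, whose quadratic form at [v] is the second derivative along [v]. *)
Lemma coord_laplacian_max_le0 U (G : 'rV[R]_n -> 'M[R]_n) f x :
  open U -> U x -> posdef (G x) -> differentiable_upto 2 U f ->
  (forall y, U y -> f y <= f x) -> coord_laplacian G f x <= 0.
Proof.
move=> oU Ux Gpd f2 fmax.
rewrite coord_laplacian_critical; last first.
  by move=> k; have [] := derive_at_max (delta_mx 0 k) oU Ux f2 fmax.
pose B : 'M[R]_n := \matrix_(i, j) partial i (partial j f) x.
rewrite -oppr_ge0.
have -> : - (\sum_i \sum_j invmx (G x) i j * partial i (partial j f) x) =
    \tr (invmx (G x) *m (- B^T)).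
  rewrite mulmxN linearN /=; congr (- _); apply: eq_bigr => i _.
  by rewrite mxE; apply: eq_bigr => j _; rewrite !mxE.
apply: tr_posdef_mul_ge0; first exact: posdef_invmx.
move=> v; rewrite mulmxN mulNmx mxE oppr_ge0.
have -> : v *m B^T *m v^T = (v *m B *m v^T)^T by rewrite !trmx_mul trmxK mulmxA.
rewrite mxE -(second_derive_row v oU Ux f2).
by have [] := derive_at_max v oU Ux f2 fmax.
Qed.

End laplacian_at_max.

Section maximum_principle.
Context {R : realType} {X : topologicalType}.

(** If the bound failed at time [t], the function [phi] minus a small multiple of the elapsed time
    would attain its space-time maximum after [s]. Such a point is a spatial maximum at which the
    left difference quotients of [phi] stay above [e > 0]. *)
Lemma maximum_principle (phi : R -> X -> R) (s t K : R) :
  compact [set: X] -> s <= t ->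
  (forall tau p, s <= tau <= t ->
     {for (tau, p), continuous (fun z : R * X => phi z.1 z.2)}) ->
  (forall tau p, s < tau <= t -> derivable (phi^~ p) tau 1) ->
  (forall tau p, s < tau <= t -> (forall q, phi tau q <= phi tau p) ->
     derive1 (phi^~ p) tau <= 0) ->
  (forall p, phi s p <= K) -> forall p, phi t p <= K.
Proof.
move=> cX; rewrite le_eqVlt => /predU1P[<-//|st] phic phid phimax phis p0.
rewrite leNgt; apply/negP => Kp0.
(* Half of the excess at [p0] survives the penalty at time [t], so the maximum of [psi] exceeds [K]
   and cannot be attained at time [s]. *)
pose e := (phi t p0 - K) / (2 * (t - s)).
have e0 : 0 < e by rewrite divr_gt0//; lra.
have eE : e * (t - s) = (phi t p0 - K) / 2.
  by rewrite /e; field; rewrite subr_eq0 gt_eqF.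
pose psi (z : R * X) := phi z.1 z.2 - e * (z.1 - s).
pose I : set (R * X) := `[s, t]%classic `*` [set: X].
have cI : compact I by apply: compact_setX => //; exact: segment_compact.
have Ine : I !=set0 by exists (t, p0); split => //=; rewrite in_itv /= lexx ltW.
have psic : {within I, continuous psi}.
  apply: continuous_in_subspaceT => -[tau p]; rewrite inE => -[/= + _].
  rewrite in_itv /= => tauI.
  apply: cvgB; first exact: phic.
  apply: cvgM; first exact: cvg_cst.
  apply: cvgB; last exact: cvg_cst.
  exact: cvg_fst.
have [[tau p]] := compact_EVT_max Ine cI psic.
rewrite inE => -[/= + _]; rewrite in_itv /= => /andP[stau taut] pmax.
have pmax' tau' q : s <= tau' <= t ->
    phi tau' q - e * (tau' - s) <= phi tau p - e * (tau - s).
  by move=> tI; apply: (pmax (tau', q)); rewrite inE; split => //=; rewrite in_itv.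
have {}stau : s < tau.
  rewrite lt_neqAle stau andbT; apply/negP => /eqP stauE.
  have := pmax' t p0; rewrite (ltW st) lexx => /(_ isT).
  rewrite eE -stauE subrr mulr0 subr0 => H; have := phis p; lra.
have tauI : s < tau <= t by rewrite stau.
have D0 : derive1 (phi^~ p) tau <= 0.
  apply: phimax => // q; have := pmax' tau q; rewrite taut (ltW stau) => /(_ isT).
  lra.
(* The maximum may occur at the final time [t], so it can only be compared with earlier times. *)
have : (fun h => h^-1 *: (phi (h + tau) p - phi tau p)) @ 0^'- --> derive1 (phi^~ p) tau.
  apply: cvg_dnbhs_at_left.
  have := phid tau p tauI; rewrite derive1E /derivable /derive.
  suff -> : (fun h : R => h^-1 *: ((phi^~ p \o shift tau) (h *: 1) - phi tau p)) =
    (fun h => h^-1 *: (phi (h + tau) p - phi tau p)) by [].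
  by apply/funext => h /=; rewrite [h *: 1]mulr1.
move=> /cvgr_lt/(_ _ (le_lt_trans D0 e0)) Q.
have S : \forall h \near (0 : R)^'-, s - tau < h.
  by apply: nbhs_left_gt; lra.
have [h [h0 [hs hQ]]] := filter_ex (filterI (nbhs_left_lt 0) (filterI S Q)).
rewrite /= in h0.
have := pmax' (h + tau) p; have -> : s <= h + tau <= t by lra.
move=> /(_ isT) H.
move: hQ; rewrite /GRing.scale /= ltNge => /negP; apply.
by rewrite ler_ndivlMl//; lra.
Qed.

End maximum_principle.

(** * The gradient estimate along the Ricci flow *)

(** Near a point of an open subset of [B] the local smooth extension coincides with [f]. This frees
    the flow from its half-open time interval. *)
Lemma smooth_in_open (R : realType) (V W : normedModType R) (B U : set V)
    (f : V -> W) :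
  open U -> U `<=` B -> smooth_in B f -> smooth_on U f.
Proof.
move=> oU UB fs k vs vsk x Ux.
have [U' [oU' U'x] [h hs hf]] := fs x (UB x Ux).
have oI : open (U' `&` U) by exact: openI.
have fI : smooth_on (U' `&` U) f.
  apply: (smooth_on_congr oI) (_ : smooth_on _ h).
    by move=> y [U'y /UB By]; exact: hf.
  by move=> l; apply: differentiable_upto_sub (hs l) => y [].
exact: (fI k vs vsk x (conj U'x Ux)).
Qed.

Section space_time.
Context {R : realType} {V : normedModType R}.

(** Together with [time_affine], this identifies partial derivatives in space and in time with
    directional derivatives on space-time, where they can be commuted. *)
Lemma space_affine (t : R^o) (h : R) (v x : V) :
  (t, h *: v + x) = h *: ((0 : R^o), v) + (t, x).
Proof. by congr (_, _); rewrite /= scaler0 add0r. Qed.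

Lemma time_affine (x : V) (h : R) (s r : R^o) :
  (h *: s + r, x) = h *: (s, 0 : V) + (r, x).
Proof. by congr (_, _); rewrite /= scaler0 add0r. Qed.

Lemma differentiable_space (t : R^o) (x : V) :
  differentiable (fun y : V => (t, y)) x.
Proof. exact: differentiable_pair. Qed.

End space_time.

Section continuous_in_chart.
Context {R : realType} {n : nat} {M : topologicalType}.

Lemma cvg_chart (c : chart R n M) (t : R) (p : M) : cdom c p ->
  (fun z : R * M => ((z.1 : R^o), c z.2)) @ (t, p) --> ((t : R^o), c p).
Proof.
move=> cp.
have H1 : (fun z : R * M => (z.1 : R^o)) @ (t, p) --> (t : R^o).
  exact: (@cvg_fst _ _ (nbhs t) (nbhs p)).
have H2 : (fun z : R * M => c z.2) @ (t, p) --> c p.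
  apply: (cvg_comp snd c (@cvg_snd _ _ (nbhs t) (nbhs p) _)).
  exact: cmap_continuous.
exact: (cvg_pair H1 H2).
Qed.

Lemma continuous_in_chart (c : chart R n M) (a b t : R) (p : M)
    (H : R^o * 'rV[R]_n -> R) (h : R * M -> R) :
  cdom c p -> a < t < b -> differentiable H ((t : R^o), c p) ->
  (forall z, a < z.1 < b -> cdom c z.2 -> h z = H (z.1, c z.2)) ->
  {for (t, p), continuous h}.
Proof.
move=> cp tI /differentiable_continuous Hc hH.
rewrite /prop_for /continuous_at /= hH//.
apply: (@cvg_trans _ ((fun z : R * M => H (z.1, c z.2)) @ (t, p))).
  have N1 : \forall r \near t, r \in `]a, b[ by apply: near_in_itvoo; rewrite in_itv.
  have N2 := near_cdom cp.
  have {}N1 : \forall z \near (t, p), z.1 \in `]a, b[.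
    exact: (@cvg_fst _ _ (nbhs t) (nbhs p) _ _ N1).
  have {}N2 : \forall z \near (t, p), cdom c z.2.
    exact: (@cvg_snd _ _ (nbhs t) (nbhs p) _ _ N2).
  apply: near_eq_cvg; apply: filterS2 N1 N2 => z zI zc.
  by apply/esym/hH => //; move: zI; rewrite in_itv.
exact: (cvg_comp (fun z : R * M => ((z.1 : R^o), c z.2)) H (@cvg_chart c t p cp) Hc).
Qed.

End continuous_in_chart.

Section flow.
Context {R : realType} {n : nat} {M : topologicalType}.
Variable A : orientedManifold R n M.
Variables (T : \bar R) (g : R -> tensor R n M) (flow : is_ricci_flow A T g).
Variables (a b : R) (u : M -> R -> R).
Hypotheses (a_gt0 : 0 < a) (b_lt : (b%:E < T)%E).
Hypothesis heat : is_heat_solution A a b g u.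

Definition space_time_domain (c : chart R n M) : set (R^o * 'rV[R]_n) :=
  [set z | a < z.1 < b /\ cimg c z.2].

Notation Omega := space_time_domain.
Notation e_t := ((1 : R^o), (0 : 'rV[R]_n)).
Notation e_x k := ((0 : R^o), (delta_mx 0 k : 'rV[R]_n)).

Lemma open_space_time_domain c : open (Omega c).
Proof.
have -> : Omega c = (fst @^-1` [set` `]a, b[]) `&` (snd @^-1` cimg c).
  by apply/seteqP; split=> z /=; rewrite in_itv.
apply: openI; apply: open_comp.
- by move=> z _; exact: cvg_fst.
- exact: interval_open.
- by move=> z _; exact: cvg_snd.
- exact: open_cimg.
Qed.

Lemma lt_flow_time t : a < t < b -> 0 <= t /\ (t%:E < T)%E.
Proof.
move=> /andP[at_ tb]; split; first by rewrite ltW// (lt_trans a_gt0).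
by apply: lt_trans b_lt; rewrite lte_fin.
Qed.

Lemma flow_riemannian t : a < t < b -> is_riemannian A (g t).
Proof. by move=> /lt_flow_time[t0 tT]; have [H _ _] := flow; apply: H. Qed.

Let Gc c (z : R^o * 'rV[R]_n) := g z.1 c z.2.
Let uc c (z : R^o * 'rV[R]_n) := u (cinv c z.2) z.1.

Lemma flow_smooth c : atlas A c -> mx_smooth (Omega c) (Gc c).
Proof.
move=> Ac i j; have [_ H _] := flow.
apply: smooth_in_open (H c i j Ac); first exact: open_space_time_domain.
by move=> z [/lt_flow_time[z0 zT] cz].
Qed.

Lemma flow_posdef c z : atlas A c -> Omega c z -> posdef (Gc c z).
Proof.
move=> Ac [zI cz]; have rz := @flow_riemannian z.1 zI.
exact: (metric_posdef rz Ac cz).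
Qed.

Lemma heat_smooth c : atlas A c -> smooth_on (Omega c) (uc c).
Proof. by case: heat => + _; apply. Qed.

Lemma heat_smooth_function t : a < t < b -> smooth_function A (u^~ t).
Proof.
move=> tI c Ac k.
apply: (@differentiable_upto_affine _ _ _ _ (fun y => (t : R^o, y)) _
  (space_affine (t : R^o)) k (Omega c) (cimg c) (uc c)).
- by move=> x; exact: differentiable_space.
- by move=> x cx; split.
- exact: heat_smooth.
Qed.

(** At an interior time the restriction to times in [[0, T)] imposes nothing nearby, and convergence
    in the matrix norm gives convergence of each entry. *)
Lemma derive_time_metric c (t : R) x i j : atlas A c -> a < t < b -> cimg c x ->
  'D_e_t (fun z => Gc c z i j) ((t : R^o), x) = - 2 * ricci (g t c) x i j.
Proof.
move=> Ac tI cx; have [t0 tT] := lt_flow_time tI.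
have -> : 'D_e_t (fun z => Gc c z i j) ((t : R^o), x) =
    'D_1 ((fun z => Gc c z i j) \o (fun s : R^o => (s, x))) (t : R^o).
  by rewrite (derive_affine (time_affine x)).
rewrite /derive; apply: cvg_lim => //.
have [_ _ H] := flow; have {H} := H t c x t0 tT Ac cx.
move=> /cvgrPdist_lt H; apply/cvgrPdist_lt => e e0.
have : nbhs t (fun s : R => s != t -> 0 <= s /\ (s%:E < T)%E ->
    `|-2 *: ricci (g t c) x - (s - t)^-1 *: (g s c x - g t c x)| < e).
  exact: (H e e0).
move=> /nbhs_ballP[r /= r0 rH].
near=> h.
have hn0 : h != 0 by near: h; exact: nbhs_dnbhs_neq.
have hI : a < h + t < b.
  have -> : (a < h + t < b) = (h \in `]a - t, b - t[).
    by rewrite in_itv /= ltrBlDr ltrBrDr.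
  near: h; apply: nbhs_dnbhs; apply: near_in_itvoo.
  by rewrite in_itv /=; lra.
have hr : `|h| < r by near: h; exact: dnbhs0_lt.
have [ht0 htT] := lt_flow_time hI.
have := rH (h + t); rewrite -ball_normE /= opprD addrCA subrr addr0 normrN.
move=> /(_ hr); rewrite -subr_eq0 addrK => /(_ hn0 (conj ht0 htT)).
apply: le_lt_trans.
rewrite [leRHS]/Num.Def.normr/= mx_normrE.
apply: le_trans (le_bigmax _ _ (i, j)) => /=.
by rewrite !mxE [h *: 1]mulr1.
Unshelve. all: by end_near. Qed.

Let grad c (z : R^o * 'rV[R]_n) : 'cV[R]_n := \col_k 'D_(e_x k) (uc c) z.

Let F c (z : R^o * 'rV[R]_n) : R := ((grad c z)^T *m invmx (Gc c z) *m grad c z) 0 0.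

Let partial_space (h : R^o * 'rV[R]_n -> R) (t : R^o) x k :
  partial k (fun y => h (t, y)) x = 'D_(e_x k) h (t, x).
Proof. exact: (derive_affine (space_affine t)). Qed.

Let gradE c (t : R) x :
  grad c ((t : R^o), x) = gradient ((u^~ t) \o cinv c) x.
Proof.
apply/colP => k; rewrite !mxE.
exact: esym (partial_space (uc c) t x k).
Qed.

Let FE c (t : R) x :
  F c ((t : R^o), x) = grad_sq (g t c) ((u^~ t) \o cinv c) x.
Proof. by rewrite /F /grad_sq gradE. Qed.

Let unit_metric c z : atlas A c -> Omega c z -> Gc c z \in unitmx.
Proof. by move=> Ac cz; exact: posdef_unitmx (flow_posdef Ac cz). Qed.

Let grad_smooth c : atlas A c -> mx_smooth (Omega c) (grad c).
Proof.
move=> Ac i j; under eq_fun do rewrite mxE.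
exact: smooth_on_derive (heat_smooth Ac).
Qed.

Let inv_smooth c : atlas A c -> mx_smooth (Omega c) (fun z => invmx (Gc c z)).
Proof.
move=> Ac; apply: mx_smooth_inv; first exact: open_space_time_domain.
- by move=> z; exact: unit_metric.
- exact: flow_smooth.
Qed.

Let F_smooth c : atlas A c -> smooth_on (Omega c) (F c).
Proof.
move=> Ac; have oO := @open_space_time_domain c.
have gs := grad_smooth Ac; have Gs := inv_smooth Ac.
suff : mx_smooth (Omega c) (fun z => (grad c z)^T *m invmx (Gc c z) *m grad c z).
  exact.
by apply: mx_smoothM => //; apply: mx_smoothM => //; exact: mx_smooth_tr.
Qed.

(** Time and space derivatives commute on space-time, and the heat equation replaces the time
    derivative; chart independence of the Laplacian allows this at all nearby points in the one
    chart [c]. *)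
Let derive_time_grad c (t : R) x : atlas A c -> a < t < b -> cimg c x ->
  mx_derive e_t (grad c) ((t : R^o), x) =
  gradient (coord_laplacian (g t c) ((u^~ t) \o cinv c)) x.
Proof.
move=> Ac tI cx; have oO := @open_space_time_domain c.
have tx : Omega c ((t : R^o), x) by split.
apply/colP => k; rewrite !mxE.
have -> : 'D_e_t (fun z => grad c z k 0) ((t : R^o), x) =
    'D_e_t ('D_(e_x k) (uc c)) ((t : R^o), x).
  by congr (derive _ _ _); apply/funext => z; rewrite mxE.
rewrite (derive_comm e_t (e_x k) oO tx (heat_smooth Ac (k := 2%N))).
rewrite -(partial_space ('D_e_t (uc c)) t x k).
have oc : open (cimg c) by exact: open_cimg.
apply: near_eq_derive; apply: open_eq_near oc _ cx => y cy.
have <- := derive_affine (time_affine y) (uc c) (t : R^o) (1 : R^o).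
have [_ H] := heat.
have := H t (cinv c y) tI; rewrite derive1E => Hy.
rewrite -[y in RHS](cinvK cy).
rewrite -(laplacianE (flow_riemannian tI) (heat_smooth_function tI) Ac (cdom_cinv cy)).
exact: Hy.
Qed.

Let derive_time_inv c (t : R) x : atlas A c -> a < t < b -> cimg c x ->
  mx_derive e_t (fun z => invmx (Gc c z)) ((t : R^o), x) =
  2 *: (invmx (g t c x) *m ricci (g t c) x *m invmx (g t c x)).
Proof.
move=> Ac tI cx; have oO := @open_space_time_domain c.
have tx : Omega c ((t : R^o), x) by split.
rewrite (mx_derive_inv e_t oO tx); last 2 first.
- by move=> z; exact: unit_metric.
- exact: flow_smooth.
have -> : mx_derive e_t (Gc c) ((t : R^o), x) = - 2 *: ricci (g t c) x.
  by apply/matrixP => i j; rewrite !mxE derive_time_metric// !mxE.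
by rewrite -scalemxAr -scalemxAl scaleNr opprK.
Qed.

Let evolution_algebra (S C : 'M[R]_n) (v w : 'cV[R]_n) : S^T = S ->
  ((w^T *m S + v^T *m (2 *: (S *m C *m S))) *m v + v^T *m S *m w) 0 0 =
  2 * ((S *m v)^T *m w + (S *m v)^T *m C *m (S *m v)) 0 0.
Proof.
move=> ST.
have wv : (w^T *m S *m v) 0 0 = (v^T *m S *m w) 0 0.
  have -> : v^T *m S *m w = (w^T *m S *m v)^T.
    by rewrite !trmx_mul trmxK ST mulmxA.
  by rewrite [RHS]mxE.
have sc : (v^T *m (2 *: (S *m C *m S)) *m v) 0 0 =
    2 * (v^T *m (S *m C *m S) *m v) 0 0.
  by rewrite -scalemxAr -scalemxAl mxE.
rewrite mulmxDl !addmx_entry wv sc.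
by rewrite trmx_mul ST !mulmxA; ring.
Qed.

(** The time derivative equals twice the pairing of the gradient with the differential of the
    Laplacian, plus twice the Ricci term, which comes from differentiating the inverse metric. The
    Bochner formula at a maximum contains this same expression. *)
Lemma derive_time_grad_sq_le0 c (t : R) x : atlas A c -> a < t < b -> cimg c x ->
  (forall y, cimg c y -> F c ((t : R^o), y) <= F c ((t : R^o), x)) ->
  'D_e_t (F c) ((t : R^o), x) <= 0.
Proof.
move=> Ac tI cx Fmax; have oO := @open_space_time_domain c.
have tx : Omega c ((t : R^o), x) by split.
have rt := flow_riemannian tI.
have oc : open (cimg c) by exact: open_cimg.
have gs := metric_smooth rt Ac.
have gpd := fun y (cy : cimg c y) => metric_posdef rt Ac cy.
have us : smooth_on (cimg c) ((u^~ t) \o cinv c) by exact: heat_smooth_function.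
pose h := grad_sq (g t c) ((u^~ t) \o cinv c).
have hmax y : cimg c y -> h y <= h x by move=> /Fmax; rewrite !FE.
have hs : differentiable_upto 2 (cimg c) h.
  have grs := gradient_smooth us.
  have Gis := invmx_metric_smooth oc gs gpd.
  suff : mx_smooth (cimg c) (fun y => (gradient ((u^~ t) \o cinv c) y)^T *m
    invmx (g t c y) *m gradient ((u^~ t) \o cinv c) y) by move=> H; exact: (H 0 0 2%N).
  by apply: mx_smoothM => //; apply: mx_smoothM => //; exact: mx_smooth_tr.
have h0 k : partial k h x = 0.
  by have [] := derive_at_max (delta_mx 0 k) oc cx hs hmax.
have := coord_laplacian_max_le0 oc cx (gpd x cx) hs hmax.
rewrite (bochner_critical oc gs gpd us cx h0) pmulr_rle0 ?ltr0n// => B.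
have -> : 'D_e_t (F c) ((t : R^o), x) =
   (mx_derive e_t (fun z => (grad c z)^T *m invmx (Gc c z) *m grad c z) (t : R^o, x)) 0 0.
  by rewrite mxE.
have grs := grad_smooth Ac; have Gis := inv_smooth Ac.
have grTs := mx_smooth_tr grs.
rewrite (mx_deriveM _ tx)//; last exact: mx_smoothM.
rewrite (mx_deriveM _ tx)// mx_derive_tr derive_time_grad// derive_time_inv//.
rewrite gradE evolution_algebra; last exact: (invmx_metric_tr gpd).
(* [B] bounds this expression increased by the squared norm of the Hessian, so only the
   nonnegativity of the latter remains. *)
rewrite pmulr_rle0 ?ltr0n//; apply: le_trans B; rewrite lerDl.
have Gipd := posdef_invmx (gpd x cx).
apply: tr_posdef_mul_ge0 => // v.
set H := hessian _ _ _; have HT : H^T = H by exact: (hessian_tr oc gpd us cx).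
have -> : v *m (H *m invmx (g t c x) *m H) *m v^T =
    (v *m H) *m invmx (g t c x) *m (v *m H)^T.
  by rewrite trmx_mul HT !mulmxA.
exact: posdef_ge0.
Qed.

Let Fm (t : R) p := manifold_grad_sq A (g t) (u^~ t) p.

Let FmE c t p : atlas A c -> a < t < b -> cdom c p ->
  Fm t p = F c ((t : R^o), c p).
Proof.
move=> Ac tI cp; rewrite /Fm FE.
have fs := heat_smooth_function tI.
exact: (manifold_grad_sqE (flow_riemannian tI) fs Ac cp).
Qed.

Let Fm_continuous t p : a < t < b ->
  {for (t, p), continuous (fun z : R * M => Fm z.1 z.2)}.
Proof.
move=> tI; set c := chart_at A p; have Ac : atlas A c := atlas_chart_at A p.
have cp : cdom c p := cdom_chart_at A p.
have tx : Omega c ((t : R^o), c p) by split => //; exact: cimgP.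
apply: (continuous_in_chart (a := a) (b := b) cp tI
  (smooth_on_differentiable (F_smooth Ac) tx)) => z zI zc.
exact: FmE.
Qed.

Lemma heat_continuous t p : a < t < b ->
  {for (t, p), continuous (fun z : R * M => u z.2 z.1)}.
Proof.
move=> tI; set c := chart_at A p; have Ac : atlas A c := atlas_chart_at A p.
have cp : cdom c p := cdom_chart_at A p.
have tx : Omega c ((t : R^o), c p) by split => //; exact: cimgP.
apply: (continuous_in_chart (a := a) (b := b) cp tI
  (smooth_on_differentiable (heat_smooth Ac) tx)) => z zI zc.
by rewrite /uc /= cmapK.
Qed.

Lemma heat_derivable t p : a < t < b -> derivable (u p) t 1.
Proof.
move=> tI; set c := chart_at A p; have Ac : atlas A c := atlas_chart_at A p.
have cp : cdom c p := cdom_chart_at A p.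
have tx : Omega c ((t : R^o), c p) by split => //; exact: cimgP.
have -> : u p = uc c \o (fun s : R^o => (s, c p)).
  by apply/funext => s; rewrite /uc /= cmapK.
rewrite (derivable_affine (time_affine (c p)) (uc c) (t : R^o) (1 : R^o)).
exact: smooth_on_derivable (heat_smooth Ac) tx.
Qed.

Lemma grad_sq_nonincreasing (s t K : R) : compact [set: M] ->
  a < s -> s <= t -> t < b ->
  (forall p, manifold_grad_sq A (g s) (u^~ s) p <= K) ->
  forall p, manifold_grad_sq A (g t) (u^~ t) p <= K.
Proof.
move=> cM as_ st tb.
have tauI tau : s <= tau <= t -> a < tau < b.
  by move=> /andP[? ?]; apply/andP; split; lra.
have derivE tau p : s < tau <= t ->
    is_derive (tau : R) 1 (Fm^~ p) ('D_e_t (F (chart_at A p)) ((tau : R^o), chart_at A p p)).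
  move=> /andP[stau taut]; set c := chart_at A p.
  have tI : a < tau < b by apply: tauI; rewrite (ltW stau).
  have Ac : atlas A c := atlas_chart_at A p.
  have cx : cimg c (c p) := cimgP (cdom_chart_at A p).
  (* The chart selected at [p] does not depend on time, so at a fixed point the evolution is that of
     [F] in a single chart. *)
  have -> : Fm^~ p = F c \o (fun s : R^o => (s, c p)).
    by apply/funext => r /=; rewrite FE.
  have aff := time_affine (c p).
  split.
    rewrite (derivable_affine aff (F c) (tau : R^o) (1 : R^o)).
    have tx : Omega c ((tau : R^o), c p) by split.
    exact: smooth_on_derivable (F_smooth Ac) tx.
  exact: (derive_affine aff (F c) (tau : R^o) (1 : R^o)).
apply: (@maximum_principle R M Fm s t K cM st).
- by move=> tau p /tauI; exact: Fm_continuous.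
- by move=> tau p tI; have [] := derivE tau p tI.
- move=> tau p tI pmax; rewrite derive1E; have [_ ->] := derivE tau p tI.
  have tI' : a < tau < b by case/andP: tI => ? ?; apply: tauI; lra.
  apply: derive_time_grad_sq_le0 => //.
  + exact: atlas_chart_at.
  + exact/cimgP/cdom_chart_at.
  + move=> y cy; have Ac := atlas_chart_at A p.
    have := pmax (cinv (chart_at A p) y).
    rewrite (FmE Ac tI' (cdom_cinv cy)) (FmE Ac tI' (cdom_chart_at A p)).
    by rewrite (cinvK cy).
Qed.

End flow.

(** * The Laplacian of a product *)

Section laplacian_linear.
Context {R : realType} {n : nat}.
Implicit Types (U : set 'rV[R]_n) (G : 'rV[R]_n -> 'M[R]_n).

Lemma coord_laplacianD U G (f h : 'rV[R]_n -> R) x : open U -> U x ->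
  differentiable_upto 2 U f -> differentiable_upto 2 U h ->
  coord_laplacian G (fun y => f y + h y) x =
  coord_laplacian G f x + coord_laplacian G h x.
Proof.
move=> oU Ux /differentiable_uptoS[f0 f1] /differentiable_uptoS[h0 h1].
have D k y : U y -> partial k (fun y => f y + h y) y = partial k f y + partial k h y.
  by move=> Uy; apply: deriveD; apply: diff_derivable; [exact: f0|exact: h0].
have DD i j : partial i (partial j (fun y => f y + h y)) x =
    partial i (partial j f) x + partial i (partial j h) x.
  transitivity (partial i (fun y => partial j f y + partial j h y) x).
    by apply: near_eq_derive; apply: open_eq_near oU _ Ux => y; exact: D.
  have [fj _] := (differentiable_uptoS _ _ _).1 (f1 (delta_mx 0 j)).
  have [hj _] := (differentiable_uptoS _ _ _).1 (h1 (delta_mx 0 j)).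
  by apply: deriveD; apply: diff_derivable; [exact: fj|exact: hj].
rewrite /coord_laplacian -big_split; apply: eq_bigr => i _ /=.
rewrite -big_split; apply: eq_bigr => j _ /=.
rewrite -mulrDr; congr (_ * _); rewrite DD.
under eq_bigr => k _ do rewrite D// mulrDr.
by rewrite big_split /= opprD addrACA.
Qed.

Lemma coord_laplacianZ U G (f : 'rV[R]_n -> R) (r : R) x : open U -> U x ->
  differentiable_upto 2 U f ->
  coord_laplacian G (fun y => r * f y) x = r * coord_laplacian G f x.
Proof.
move=> oU Ux /differentiable_uptoS[f0 f1].
have D k y : U y -> partial k (fun y => r * f y) y = r * partial k f y.
  by move=> Uy; apply: deriveZ; apply: diff_derivable; exact: f0.
have DD i j : partial i (partial j (fun y => r * f y)) x =
    r * partial i (partial j f) x.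
  transitivity (partial i (fun y => r * partial j f y) x).
    by apply: near_eq_derive; apply: open_eq_near oU _ Ux => y; exact: D.
  have [fj _] := (differentiable_uptoS _ _ _).1 (f1 (delta_mx 0 j)).
  by apply: deriveZ; apply: diff_derivable; exact: fj.
rewrite /coord_laplacian mulr_sumr; apply: eq_bigr => i _ /=.
rewrite mulr_sumr; apply: eq_bigr => j _ /=.
rewrite mulrCA; congr (_ * _); rewrite DD mulrBr mulr_sumr; congr (_ - _).
by apply: eq_bigr => k _; rewrite D// mulrCA.
Qed.

End laplacian_linear.

Section product_laplacian.
Context {R : realType} {n1 n2 : nat}.
Variables (G1 : 'rV[R]_n1 -> 'M[R]_n1) (G2 : 'rV[R]_n2 -> 'M[R]_n2).

Let G (z : 'rV[R]_(n1 + n2)) : 'M[R]_(n1 + n2) :=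
  block_mx (G1 (lsubmx z)) 0 0 (G2 (rsubmx z)).

Lemma lsubmx_affine (h : R) (v x : 'rV[R]_(n1 + n2)) :
  lsubmx (h *: v + x) = h *: lsubmx v + lsubmx x.
Proof. by rewrite linearP. Qed.

Lemma rsubmx_affine (h : R) (v x : 'rV[R]_(n1 + n2)) :
  rsubmx (h *: v + x) = h *: rsubmx v + rsubmx x.
Proof. by rewrite linearP. Qed.

Lemma lsubmx_delta_lshift (i : 'I_n1) :
  lsubmx (delta_mx 0 (lshift n2 i) : 'rV[R]_(n1 + n2)) = delta_mx 0 i.
Proof. by apply/rowP => j; rewrite !mxE (inj_eq (@lshift_inj _ _)). Qed.

Lemma lsubmx_delta_rshift (i : 'I_n2) :
  lsubmx (delta_mx 0 (rshift n1 i) : 'rV[R]_(n1 + n2)) = 0.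
Proof. by apply/rowP => j; rewrite !mxE eq_lrshift andbF. Qed.

Lemma rsubmx_delta_rshift (i : 'I_n2) :
  rsubmx (delta_mx 0 (rshift n1 i) : 'rV[R]_(n1 + n2)) = delta_mx 0 i.
Proof. by apply/rowP => j; rewrite !mxE (inj_eq (@rshift_inj _ _)). Qed.

Lemma rsubmx_delta_lshift (i : 'I_n1) :
  rsubmx (delta_mx 0 (lshift n2 i) : 'rV[R]_(n1 + n2)) = 0.
Proof. by apply/rowP => j; rewrite !mxE eq_rlshift andbF. Qed.

Lemma partial_lshift_lsubmx (i : 'I_n1) (f : 'rV[R]_n1 -> R) z :
  partial (lshift n2 i) (f \o lsubmx) z = partial i f (lsubmx z).
Proof. by rewrite /partial (derive_affine lsubmx_affine) lsubmx_delta_lshift. Qed.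

Lemma partial_rshift_lsubmx (i : 'I_n2) (f : 'rV[R]_n1 -> R) z :
  partial (rshift n1 i) (f \o lsubmx) z = 0.
Proof. by rewrite /partial (derive_affine lsubmx_affine) lsubmx_delta_rshift derive0. Qed.

Lemma partial_rshift_rsubmx (i : 'I_n2) (f : 'rV[R]_n2 -> R) z :
  partial (rshift n1 i) (f \o rsubmx) z = partial i f (rsubmx z).
Proof. by rewrite /partial (derive_affine rsubmx_affine) rsubmx_delta_rshift. Qed.

Lemma partial_lshift_rsubmx (i : 'I_n1) (f : 'rV[R]_n2 -> R) z :
  partial (lshift n2 i) (f \o rsubmx) z = 0.
Proof. by rewrite /partial (derive_affine rsubmx_affine) rsubmx_delta_lshift derive0. Qed.

Let G_ll (i j : 'I_n1) : (fun z => G z (lshift n2 i) (lshift n2 j)) = (fun x => G1 x i j) \o lsubmx.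
Proof. by apply/funext => z; rewrite /G block_mxEul. Qed.

Let G_lr (i : 'I_n1) (j : 'I_n2) : (fun z => G z (lshift n2 i) (rshift n1 j)) = fun=> 0.
Proof. by apply/funext => z; rewrite /G block_mxEur mxE. Qed.

Let G_rl (i : 'I_n2) (j : 'I_n1) : (fun z => G z (rshift n1 i) (lshift n2 j)) = fun=> 0.
Proof. by apply/funext => z; rewrite /G block_mxEdl mxE. Qed.

Let G_rr (i j : 'I_n2) : (fun z => G z (rshift n1 i) (rshift n1 j)) = (fun x => G2 x i j) \o rsubmx.
Proof. by apply/funext => z; rewrite /G block_mxEdr. Qed.

Let partial0 k (z : 'rV[R]_(n1 + n2)) : partial k (fun=> 0 : R) z = 0.
Proof. exact: derive_cst. Qed.

Variable z : 'rV[R]_(n1 + n2).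
Hypotheses (u1 : G1 (lsubmx z) \in unitmx) (u2 : G2 (rsubmx z) \in unitmx).

Let Gi : invmx (G z) = block_mx (invmx (G1 (lsubmx z))) 0 0 (invmx (G2 (rsubmx z))).
Proof.
by rewrite /G invmx_block_diag// block_diag_mx_unit u1.
Qed.

Let christoffel_lll k i j :
  christoffel G (lshift n2 k) (lshift n2 i) (lshift n2 j) z =
  christoffel G1 k i j (lsubmx z).
Proof.
rewrite /christoffel big_split_ord /= [X in _ + X]big1 => [|m _]; last first.
  by rewrite Gi block_mxEur mxE mul0r.
rewrite addr0; congr (_ * _); apply: eq_bigr => m _.
by rewrite Gi block_mxEul !G_ll !partial_lshift_lsubmx.
Qed.

Let christoffel_lrr k i j :
  christoffel G (lshift n2 k) (rshift n1 i) (rshift n1 j) z = 0.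
Proof.
rewrite /christoffel big_split_ord /= [X in _ + X]big1 => [|m _]; last first.
  by rewrite Gi block_mxEur mxE mul0r.
rewrite big1 ?addr0 ?mulr0// => m _.
by rewrite !G_rl G_rr !partial0 partial_lshift_rsubmx addr0 subr0 mulr0.
Qed.

Let christoffel_rll k i j :
  christoffel G (rshift n1 k) (lshift n2 i) (lshift n2 j) z = 0.
Proof.
rewrite /christoffel big_split_ord /= [X in X + _]big1 => [|m _]; last first.
  by rewrite Gi block_mxEdl mxE mul0r.
rewrite big1 ?addr0 ?mulr0// => m _.
by rewrite !G_lr G_ll !partial0 partial_rshift_lsubmx addr0 subr0 mulr0.
Qed.

Let christoffel_rrr k i j :
  christoffel G (rshift n1 k) (rshift n1 i) (rshift n1 j) z =
  christoffel G2 k i j (rsubmx z).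
Proof.
rewrite /christoffel big_split_ord /= [X in X + _]big1 => [|m _]; last first.
  by rewrite Gi block_mxEdl mxE mul0r.
rewrite add0r; congr (_ * _); apply: eq_bigr => m _.
by rewrite Gi block_mxEdr !G_rr !partial_rshift_rsubmx.
Qed.

(** Index pairs mixing the two factors are weighted by the zero blocks of the inverse metric. For
    pure pairs, the Christoffel symbols whose upper index lies in the other factor vanish. *)
Let coord_laplacian_split f : coord_laplacian G f z =
  \sum_i \sum_j invmx (G1 (lsubmx z)) i j *
    (partial (lshift n2 i) (partial (lshift n2 j) f) z
     - \sum_k christoffel G1 k i j (lsubmx z) * partial (lshift n2 k) f z) +
  \sum_i \sum_j invmx (G2 (rsubmx z)) i j *
    (partial (rshift n1 i) (partial (rshift n1 j) f) z
     - \sum_k christoffel G2 k i j (rsubmx z) * partial (rshift n1 k) f z).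
Proof.
rewrite /coord_laplacian big_split_ord /=; congr (_ + _); apply: eq_bigr => i _.
  rewrite big_split_ord /= [X in _ + X]big1 ?addr0 => [|j _]; last first.
    by rewrite Gi block_mxEur mxE mul0r.
  apply: eq_bigr => j _; rewrite Gi block_mxEul; congr (_ * (_ - _)).
  rewrite big_split_ord /= [X in _ + X]big1 ?addr0 => [|k _]; last first.
    by rewrite christoffel_rll mul0r.
  by apply: eq_bigr => k _; rewrite christoffel_lll.
rewrite big_split_ord /= [X in X + _]big1 ?add0r => [|j _]; last first.
  by rewrite Gi block_mxEdl mxE mul0r.
apply: eq_bigr => j _; rewrite Gi block_mxEdr; congr (_ * (_ - _)).
rewrite big_split_ord /= [X in X + _]big1 ?add0r => [|k _]; last first.
  by rewrite christoffel_lrr mul0r.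
by apply: eq_bigr => k _; rewrite christoffel_rrr.
Qed.

Lemma coord_laplacian_lsubmx f :
  coord_laplacian G (f \o lsubmx) z = coord_laplacian G1 f (lsubmx z).
Proof.
have E (j : 'I_n1) : partial (lshift n2 j) (f \o lsubmx) = partial j f \o lsubmx.
  by apply/funext => y; exact: partial_lshift_lsubmx.
have E' (j : 'I_n2) : partial (rshift n1 j) (f \o lsubmx) = (fun=> 0 : R).
  by apply/funext => y; exact: (partial_rshift_lsubmx j f y).
rewrite coord_laplacian_split /coord_laplacian [X in _ + X]big1 ?addr0 => [|i _].
  apply: eq_bigr => i _; apply: eq_bigr => j _.
  rewrite E partial_lshift_lsubmx; congr (_ * (_ - _)).
  by apply: eq_bigr => k _; rewrite E.
rewrite big1// => j _; rewrite E' partial0 big1 ?subr0 ?mulr0// => k _.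
by rewrite E' mulr0.
Qed.

Lemma coord_laplacian_rsubmx f :
  coord_laplacian G (f \o rsubmx) z = coord_laplacian G2 f (rsubmx z).
Proof.
have E (j : 'I_n2) : partial (rshift n1 j) (f \o rsubmx) = partial j f \o rsubmx.
  by apply/funext => y; exact: partial_rshift_rsubmx.
have E' (j : 'I_n1) : partial (lshift n2 j) (f \o rsubmx) = (fun=> 0 : R).
  by apply/funext => y; exact: (partial_lshift_rsubmx j f y).
rewrite coord_laplacian_split /coord_laplacian [X in X + _]big1 ?add0r => [|i _].
  apply: eq_bigr => i _; apply: eq_bigr => j _.
  rewrite E partial_rshift_rsubmx; congr (_ * (_ - _)).
  by apply: eq_bigr => k _; rewrite E.
rewrite big1// => j _; rewrite E' partial0 big1 ?subr0 ?mulr0// => k _.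
by rewrite E' mulr0.
Qed.

Lemma posdef_block_diag : posdef (G1 (lsubmx z)) -> posdef (G2 (rsubmx z)) ->
  posdef (G z).
Proof.
move=> p1 p2; split; first by rewrite /G tr_block_mx !trmx0 p1.1 p2.1.
move=> v v0; rewrite /G -[v]hsubmxK mul_row_block !mulmx0 addr0 add0r.
rewrite tr_row_mx mul_row_col addmx_entry.
have [l0|/p1.2 l0] := eqVneq (lsubmx v) 0; last first.
  by have := posdef_ge0 (rsubmx v) p2; lra.
have /p2.2 r0 : rsubmx v != 0.
  by apply: contra v0 => /eqP r0; rewrite -[v]hsubmxK l0 r0 row_mx0.
by have := posdef_ge0 (lsubmx v) p1; lra.
Qed.

End product_laplacian.

(** * Distances along the flow *)

Lemma le_mx_norm (R : realType) p q (N : 'M[R]_(p, q)) i j : `|N i j| <= `|N|.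
Proof.
rewrite [leRHS]/Num.Def.normr/= mx_normrE.
exact: (le_bigmax _ (fun ij : 'I_p * 'I_q => `|N ij.1 ij.2|) (i, j)).
Qed.

(** The norm of a row vector is its largest entry in absolute value, so each of the [n ^ 2] terms is
    at most [K] times its square. *)
Lemma quadratic_form_le (R : realType) n (N : 'M[R]_n) (v : 'rV[R]_n) (K : R) :
  (forall i j, `|N i j| <= K) ->
  (v *m N *m v^T) 0 0 <= n%:R ^+ 2 * K * `|v| ^+ 2.
Proof.
move=> NK; rewrite mxE; apply: le_trans (ler_norm _) _.
apply: le_trans (ler_norm_sum _ _ _) _.
apply: (@le_trans _ _ (\sum_(j < n) \sum_(i < n) (K * `|v| ^+ 2))).
  apply: ler_sum => j _; rewrite normrM [_^T _ _]mxE mxE.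
  apply: le_trans (ler_wpM2r _ (ler_norm_sum _ _ _)) _ => //.
  rewrite mulr_suml; apply: ler_sum => i _; rewrite normrM.
  rewrite -mulrA mulrCA expr2; apply: ler_pM => //.
  by apply: ler_pM => //; exact: le_mx_norm.
by rewrite !sumr_const card_ord -mulrnA -[leLHS]mulr_natl natrM -expr2 !mulrA.
Qed.

Section flow_distance.
Context {R : realType} {n : nat} {M : topologicalType}.
Variable A : orientedManifold R n M.
Variables (T : \bar R) (g : R -> tensor R n M) (flow : is_ricci_flow A T g).
Variables (a b : R).
Hypotheses (a_gt0 : 0 < a) (b_lt : (b%:E < T)%E).

(** Metric coefficients are bounded near the chart point of [(t, p)], uniformly in time, so the
    chart segment from [p] to a nearby point is short for every metric of nearby time. This
    uniformity is what joint continuity of [D] requires. *)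
Lemma near_riemannian_dist (t e : R) (p : M) : a < t < b -> 0 < e ->
  \forall z \near (t, p), (riemannian_dist A (g z.1) p z.2 <= e%:E)%E.
Proof.
move=> tI e0; set c := chart_at A p; have Ac : atlas A c := atlas_chart_at A p.
have cp : cdom c p := cdom_chart_at A p.
have tx : space_time_domain a b c ((t : R^o), c p) by split => //; exact: cimgP.
pose G (z : R^o * 'rV[R]_n) := g z.1 c z.2.
have Gs : mx_smooth (space_time_domain a b c) G by exact: (flow_smooth flow a_gt0 b_lt Ac).
pose K := 1 + `|G ((t : R^o), c p)|.
have GK1 (ij : 'I_n * 'I_n) :
    \forall w \near ((t : R^o), c p), `|G w ij.1 ij.2| < K.
  have Gc := differentiable_continuous (smooth_on_differentiable (Gs ij.1 ij.2) tx).
  apply: (cvgr_lt _ (cvg_norm Gc)).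
  by rewrite /K; have := le_mx_norm (G ((t : R^o), c p)) ij.1 ij.2; lra.
have GK : \forall w \near ((t : R^o), c p), forall i j, `|G w i j| < K.
  have GK2 := filter_forall (nbhs_filter ((t : R^o), c p)) GK1.
  apply: (@filterS _ _ (nbhs_filter ((t : R^o), c p)) _ _ _ GK2).
  by move=> w H i j; exact: (H (i, j)).
have dom : \forall w \near ((t : R^o), c p), space_time_domain a b c w.
  by apply: open_nbhs_nbhs; split => //; exact: open_space_time_domain.
have [r /= r0 rB] := (nbhs_ballP _ _).1 (filterI dom GK).
(* Adding 1 makes [C <= C ^+ 2], so that [C] times the norm of [v] bounds the speed without taking a
   square root. *)
pose C := 1 + n%:R ^+ 2 * K.
have K1 : 1 <= K by rewrite /K lerDl.
have nK0 : 0 <= n%:R ^+ 2 * K by apply: mulr_ge0; [exact: sqr_ge0|lra].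
have C1 : 1 <= C by rewrite /C lerDl.
have C0 : 0 < C by lra.
have near1 : \forall z \near (t, p),
    ball ((t : R^o), c p) (Num.min r (e / C)) ((z.1 : R^o), c z.2).
  have N : nbhs ((t : R^o), c p) (ball ((t : R^o), c p) (Num.min r (e / C))).
    by apply: nbhsx_ballx; rewrite lt_min r0 divr_gt0.
  exact: (@cvg_chart _ _ _ c t p cp _ N).
have near2 : \forall z \near (t, p), cdom c z.2.
  exact: (@cvg_snd _ _ (nbhs t) (nbhs p) _ _ (near_cdom cp)).
apply: filterS2 near1 near2 => -[tau q] /= [/= btau bq] cq.
pose v := c q - c p.
have vr : `|v| < Num.min r (e / C).
  by move: bq; rewrite -ball_normE /= distrC.
have {vr} [vr ve] : `|v| < r /\ `|v| < e / C by move: vr; rewrite lt_min => /andP[].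
have seg s : 0 <= s <= 1 -> ball ((t : R^o), c p) r ((tau : R^o), c p + s *: v).
  move=> /andP[s0 s1]; split => /=.
    by move: btau; apply: le_ball; rewrite ge_min lexx.
  rewrite -ball_normE /= opprD addNKr normrN normrZ ger0_norm//.
  by apply: le_lt_trans vr; exact: ler_piMl.
have [tauI _] := (rB _ (seg 0 (introT andP (conj (lexx 0) ler01)))).1.
have rt := flow_riemannian flow a_gt0 b_lt tauI.
have pE : cinv c (c p) = p by exact: cmapK.
have qE : cinv c (c p + v) = q by rewrite /v addrC subrK cmapK.
rewrite -[p in X in (X <= _)%E]pE -[q]qE.
apply: (@le_trans _ _ (C * `|v|)%:E); last first.
  by rewrite lee_fin mulrC -ler_pdivlMr// ltW.
apply: (riemannian_dist_segment rt Ac) => [s sI|s sI|].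
- by have [[_ ?] _] := rB _ (seg s sI).
- have [_ H] := rB _ (seg s sI).
  apply: le_trans (quadratic_form_le v (fun i j => ltW (H i j))) _.
  rewrite exprMn; apply: ler_wpM2r; first exact: sqr_ge0.
  have : C <= C ^+ 2 by rewrite expr2; apply: ler_peMl => //; exact: ltW.
  by rewrite /C; lra.
- by rewrite mulr_ge0// ltW.
Qed.

Variable u : M -> R -> R.
Hypothesis heat : is_heat_solution A a b g u.
Variable d : R -> M -> M -> R.
Hypothesis dE : forall t x y, a < t < b ->
  (d t x y)%:E = riemannian_dist A (g t) x y.
Hypothesis d_ge0 : forall t x y, a < t < b -> 0 <= d t x y.

(** The bound is converted to a gradient bound at time [s], propagated, and converted back at time
    [t]. Since [L] may be 0, the last conversion is made with [L + e]. *)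
Lemma heat_lipschitz (s t L : R) : compact [set: M] ->
  a < s -> s <= t -> t < b -> 0 <= L ->
  (forall x y, `|u x s - u y s| <= L * d s x y) ->
  forall x y, `|u x t - u y t| <= L * d t x y.
Proof.
move=> cM as_ st tb L0 lip x y.
have sI : a < s < b by apply/andP; split; lra.
have tI : a < t < b by apply/andP; split; lra.
have Fs p : manifold_grad_sq A (g s) (u^~ s) p <= L ^+ 2.
  apply: grad_sq_le_lipschitz => //.
  - exact: (flow_riemannian flow a_gt0 b_lt sI).
  - exact: (heat_smooth_function heat sI).
  - move=> q B B0; rewrite -dE// lee_fin => dB.
    by apply: le_trans (lip p q) _; exact: ler_wpM2l.
have Ft := grad_sq_nonincreasing flow a_gt0 b_lt heat cM as_ st tb Fs.
have key e : 0 < e -> `|u x t - u y t| <= (L + e) * d t x y.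
  move=> e0; have Le0 : 0 < L + e by lra.
  have FK p : manifold_grad_sq A (g t) (u^~ t) p <= (L + e) ^+ 2.
    by apply: le_trans (Ft p) _; rewrite ler_pXn2r ?nnegrE//; lra.
  have := riemannian_dist_ge (flow_riemannian flow a_gt0 b_lt tI)
    (heat_smooth_function heat tI) Le0 FK x y.
  by rewrite -dE// lee_fin ler_pdivrMr// mulrC.
rewrite leNgt; apply/negP => H.
have d0 := d_ge0 x y tI.
(* Then [e * d t x y] is at most half of the supposed excess; the added 1 covers a zero distance. *)
pose e := (`|u x t - u y t| - L * d t x y) / (2 * (d t x y + 1)).
have d1 : 0 < d t x y + 1 by lra.
have e0 : 0 < e by rewrite divr_gt0//; lra.
have eE : e * (d t x y + 1) = (`|u x t - u y t| - L * d t x y) / 2.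
  by rewrite /e; field; rewrite gt_eqF.
have := key e e0; nra.
Qed.

End flow_distance.

(** * The disjoint union *)

Lemma distance_ge0 (R : realType) (X : choiceType) (d : distance R X) x y : 0 <= d x y.
Proof.
by have := dist_triangle d y x x; rewrite dist_xx (dist_sym d y x); lra.
Qed.

Section disjoint_union.
Context {R : realType} {n : nat} {M1 M2 : topologicalType}.
Variables (A1 : orientedManifold R n M1) (A2 : orientedManifold R n M2).
Hypotheses (cM1 : compact [set: M1]) (cM2 : compact [set: M2]).
Variables (T1 T2 : \bar R) (g1 : R -> tensor R n M1) (g2 : R -> tensor R n M2).
Hypotheses (flow1 : is_ricci_flow A1 T1 g1) (flow2 : is_ricci_flow A2 T2 g2).
Variable D : R -> M1 + M2 -> M1 + M2 -> R.
Variables (a b : R).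
Hypotheses (a_gt0 : 0 < a) (b_lt1 : (b%:E < T1)%E) (b_lt2 : (b%:E < T2)%E).
Hypothesis D_metric : forall t : R, a < t < b -> exists m : distance R (M1 + M2)%type, D t = m.
Hypothesis D_M1 : forall (t : R) (x y : M1), a < t < b ->
  (D t (inl x) (inl y))%:E = riemannian_dist A1 (g1 t) x y.
Hypothesis D_M2 : forall (t : R) (x y : M2), a < t < b ->
  (D t (inr x) (inr y))%:E = riemannian_dist A2 (g2 t) x y.
Hypothesis D_time : forall (t : R) (x : M1) (y : M2), a < t < b ->
  derivable (fun s : R => D s (inl x) (inr y)) t 1.
Hypothesis D_space : forall t : R, a < t < b ->
  twice_differentiable_prod A1 A2 (fun x y => D t (inl x) (inr y)).
Hypothesis D_ineq : forall (t : R) (x : M1) (y : M2), a < t < b ->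
  prod_laplacian A1 A2 (g1 t) (g2 t) (fun x y => D t (inl x) (inr y)) x y
     <= derive1 (fun s : R => D s (inl x) (inr y)) t.

Lemma cross_distance_le t x x' y y' : a < t < b ->
  `|D t (inl x) (inr y) - D t (inl x') (inr y')| <=
  D t (inl x) (inl x') + D t (inr y) (inr y').
Proof.
move=> /D_metric[m ->].
have h1 := dist_triangle m (inl x') (inl x) (inr y).
have h2 := dist_triangle m (inr y') (inl x') (inr y).
have h3 := dist_triangle m (inl x) (inl x') (inr y').
have h4 := dist_triangle m (inr y) (inl x) (inr y').
rewrite (dist_sym m (inl x') (inl x)) in h3.
rewrite (dist_sym m (inr y') (inr y)) in h2.
by rewrite ler_norml; apply/andP; split; lra.
Qed.

(** The variation is split in two: first the time changes with the points fixed, where derivability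
    in time applies; then the points move at the new time [s], at a cost measured by the metrics at
    time [s]. *)
Lemma cross_distance_continuous t x y : a < t < b ->
  {for (t, (x, y)), continuous
     (fun z : R * (M1 * M2) => D z.1 (inl z.2.1) (inr z.2.2))}.
Proof.
move=> tI; rewrite /prop_for /continuous_at /=.
apply/cvgrPdist_lt => e e0.
have e40 : 0 < e / 4 by lra.
pose F := nbhs (t, (x, y)).
have C0 : fst @ F --> t by exact: (@cvg_fst _ _ (nbhs t) (nbhs (x, y))).
have C : snd @ F --> (x, y) by exact: (@cvg_snd _ _ (nbhs t) (nbhs (x, y))).
have C1 : (fun z : R * (M1 * M2) => (z.1, z.2.1)) @ F --> (t, x).
  apply: cvg_pair C0 _.
  exact: (cvg_comp snd fst C (@cvg_fst _ _ (nbhs x) (nbhs y) _)).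
have C2 : (fun z : R * (M1 * M2) => (z.1, z.2.2)) @ F --> (t, y).
  apply: cvg_pair C0 _.
  exact: (cvg_comp snd snd C (@cvg_snd _ _ (nbhs x) (nbhs y) _)).
have N0 : \forall s \near t, `|D t (inl x) (inr y) - D s (inl x) (inr y)| < e / 4.
  have /derivable1_diffP/differentiable_continuous := @D_time t x y tI.
  by move=> /cvgrPdist_lt/(_ _ e40).
have NI : \forall s \near t, s \in `]a, b[ by apply: near_in_itvoo; rewrite in_itv.
have N1 := near_riemannian_dist flow1 a_gt0 b_lt1 x tI e40.
have N2 := near_riemannian_dist flow2 a_gt0 b_lt2 y tI e40.
have {}N0 : F (fun z => `|D t (inl x) (inr y) - D z.1 (inl x) (inr y)| < e / 4).
  exact: (C0 _ N0).
have {}NI : F (fun z => z.1 \in `]a, b[) by exact: (C0 _ NI).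
have {}N1 : F (fun z => (riemannian_dist A1 (g1 z.1) x z.2.1 <= (e / 4)%:E)%E).
  exact: (C1 _ N1).
have {}N2 : F (fun z => (riemannian_dist A2 (g2 z.1) y z.2.2 <= (e / 4)%:E)%E).
  exact: (C2 _ N2).
apply: filterS2 (filterI N0 NI) (filterI N1 N2) => -[s [x' y']] /= [H0 HI] [H1 H2].
move: HI; rewrite in_itv /= => sI.
have {}H1 : D s (inl x) (inl x') <= e / 4 by rewrite -lee_fin (D_M1 x x' sI).
have {}H2 : D s (inr y) (inr y') <= e / 4 by rewrite -lee_fin (D_M2 y y' sI).
have H3 := cross_distance_le x x' y y' sI.
rewrite -(subrKA (D s (inl x) (inr y))).
apply: le_lt_trans (ler_normD _ _) _; lra.
Qed.

Variable u : M1 + M2 -> R -> R.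
Hypothesis heat1 : is_heat_solution A1 a b g1 (fun p => u (inl p)).
Hypothesis heat2 : is_heat_solution A2 a b g2 (fun p => u (inr p)).
Variables (L sigma : R).
Hypothesis L0 : 0 <= L.

Let w t (z : M1 * M2) : R :=
  sigma * u (inl z.1) t + (- sigma * u (inr z.2) t + - L * D t (inl z.1) (inr z.2)).

Let w_continuous t z : a < t < b ->
  {for (t, z), continuous (fun y : R * (M1 * M2) => w y.1 y.2)}.
Proof.
case: z => x y tI.
pose F := nbhs (t, (x, y)).
have C0 : fst @ F --> t by exact: (@cvg_fst _ _ (nbhs t) (nbhs (x, y))).
have C : snd @ F --> (x, y) by exact: (@cvg_snd _ _ (nbhs t) (nbhs (x, y))).
have C1 : (fun z : R * (M1 * M2) => (z.1, z.2.1)) @ F --> (t, x).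
  apply: cvg_pair C0 _.
  exact: (cvg_comp snd fst C (@cvg_fst _ _ (nbhs x) (nbhs y) _)).
have C2 : (fun z : R * (M1 * M2) => (z.1, z.2.2)) @ F --> (t, y).
  apply: cvg_pair C0 _.
  exact: (cvg_comp snd snd C (@cvg_snd _ _ (nbhs x) (nbhs y) _)).
have u1c : (fun z : R * (M1 * M2) => u (inl z.2.1) z.1) @ F --> u (inl x) t.
  exact: (cvg_comp _ _ C1 (heat_continuous (p := x) heat1 tI)).
have u2c : (fun z : R * (M1 * M2) => u (inr z.2.2) z.1) @ F --> u (inr y) t.
  exact: (cvg_comp _ _ C2 (heat_continuous (p := y) heat2 tI)).
have Dc := @cross_distance_continuous t x y tI.
rewrite /prop_for /continuous_at /w /=.
apply: cvgD; first exact: cvgM (cvg_cst _) u1c.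
by apply: cvgD; [exact: cvgM (cvg_cst _) u2c|exact: cvgM (cvg_cst _) Dc].
Qed.

Let w_derive t z : a < t < b -> is_derive (t : R) 1 (w^~ z)
  (sigma * laplacian A1 (g1 t) (fun p => u (inl p) t) z.1 +
   (- sigma * laplacian A2 (g2 t) (fun p => u (inr p) t) z.2 +
   - L * derive1 (fun s : R => D s (inl z.1) (inr z.2)) t)).
Proof.
move=> tI.
have d1 : is_derive t 1 (u (inl z.1)) (laplacian A1 (g1 t) (fun p => u (inl p) t) z.1).
  have H := heat1.2 t z.1 tI; rewrite -H derive1E; apply: derivableP.
  exact: (heat_derivable heat1 tI).
have d2 : is_derive t 1 (u (inr z.2)) (laplacian A2 (g2 t) (fun p => u (inr p) t) z.2).
  have H := heat2.2 t z.2 tI; rewrite -H derive1E; apply: derivableP.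
  exact: (heat_derivable heat2 tI).
have d3 : is_derive t 1 (fun s : R => D s (inl z.1) (inr z.2))
    (derive1 (fun s : R => D s (inl z.1) (inr z.2)) t).
  by rewrite derive1E; apply: derivableP; exact: D_time.
have s1 := is_deriveZ sigma d1; have s2 := is_deriveZ (- sigma) d2.
have s3 := is_deriveZ (- L) d3.
exact: is_deriveD s1 (is_deriveD s2 s3).
Qed.

(** In the product of the charts selected at [p] and [q], the product Laplacian of [w] at the
    maximum is nonpositive, and it dominates the time derivative. *)
Let w_max t z : a < t < b -> (forall z', w t z' <= w t z) -> derive1 (w^~ z) t <= 0.
Proof.
move=> tI wmax; rewrite derive1E; have [_ ->] := w_derive z tI.
case: z wmax => p q wmax /=.
set c1 := chart_at A1 p; set c2 := chart_at A2 q.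
have Ac1 : atlas A1 c1 := atlas_chart_at A1 p.
have Ac2 : atlas A2 c2 := atlas_chart_at A2 q.
have cp : cimg c1 (c1 p) := cimgP (cdom_chart_at A1 p).
have cq : cimg c2 (c2 q) := cimgP (cdom_chart_at A2 q).
have oU : open (prod_cimg c1 c2).
  apply: openI; apply: open_comp; try exact: open_cimg.
  - by move=> z _; apply/differentiable_continuous/differentiable_lsubmx.
  - by move=> z _; apply/differentiable_continuous/differentiable_rsubmx.
pose z0 := row_mx (c1 p) (c2 q).
have lz : lsubmx z0 = c1 p by rewrite row_mxKl.
have rz : rsubmx z0 = c2 q by rewrite row_mxKr.
have Uz : prod_cimg c1 c2 z0 by split; rewrite ?lz ?rz.
pose f1 := (fun p => u (inl p) t) \o cinv c1.
pose f2 := (fun p => u (inr p) t) \o cinv c2.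
pose f3 := prod_coord c1 c2 (fun x y => D t (inl x) (inr y)).
have s1 : differentiable_upto 2 (prod_cimg c1 c2) (f1 \o lsubmx).
  apply: (differentiable_upto_affine (@lsubmx_affine R n n) (U := cimg c1)).
  - by move=> z; exact: differentiable_lsubmx.
  - by move=> z [].
  - exact: (heat_smooth_function heat1 tI Ac1).
have s2 : differentiable_upto 2 (prod_cimg c1 c2) (f2 \o rsubmx).
  apply: (differentiable_upto_affine (@rsubmx_affine R n n) (U := cimg c2)).
  - by move=> z; exact: differentiable_rsubmx.
  - by move=> z [].
  - exact: (heat_smooth_function heat2 tI Ac2).
have s3 : differentiable_upto 2 (prod_cimg c1 c2) f3 by exact: D_space.
have scale (r : R) (f : 'rV[R]_(n + n) -> R) : differentiable_upto 2 (prod_cimg c1 c2) f ->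
    differentiable_upto 2 (prod_cimg c1 c2) (fun y => r * f y).
  by move=> fs; apply: (differentiable_uptoM oU) fs; exact: differentiable_upto_cst.
have s23 : differentiable_upto 2 (prod_cimg c1 c2)
    (fun y => - sigma * (f2 \o rsubmx) y + - L * f3 y).
  by apply: (differentiable_uptoD oU); exact: scale.
pose f y := sigma * (f1 \o lsubmx) y + (- sigma * (f2 \o rsubmx) y + - L * f3 y).
have fs : differentiable_upto 2 (prod_cimg c1 c2) f.
  by apply: (differentiable_uptoD oU) s23; exact: scale.
have p1 : posdef (g1 t c1 (lsubmx z0)).
  by rewrite lz; exact: (metric_posdef (flow_riemannian flow1 a_gt0 b_lt1 tI) Ac1 cp).
have p2 : posdef (g2 t c2 (rsubmx z0)).
  by rewrite rz; exact: (metric_posdef (flow_riemannian flow2 a_gt0 b_lt2 tI) Ac2 cq).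
have := coord_laplacian_max_le0 (G := prod_metric (g1 t) (g2 t) c1 c2) oU Uz
  (posdef_block_diag p1 p2) fs.
have fE y : prod_cimg c1 c2 y -> f y = w t (cinv c1 (lsubmx y), cinv c2 (rsubmx y)).
  by [].
have fmax y : prod_cimg c1 c2 y -> f y <= f z0.
  move=> Uy; rewrite (fE y Uy) (fE z0 Uz) lz rz.
  by rewrite (cmapK (cdom_chart_at A1 p)) (cmapK (cdom_chart_at A2 q)).
move=> /(_ fmax).
rewrite (coord_laplacianD _ oU Uz (scale _ _ s1) s23).
rewrite (coord_laplacianD _ oU Uz (scale _ _ s2) (scale _ _ s3)).
rewrite !(coord_laplacianZ _ _ oU Uz)//.
rewrite (coord_laplacian_lsubmx (posdef_unitmx p1) (posdef_unitmx p2)).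
rewrite (coord_laplacian_rsubmx (posdef_unitmx p1) (posdef_unitmx p2)) lz rz.
(* The heat equation makes the two [u] terms identical on both sides; the remaining ones compare by
   the hypothesis on [D], reversed by the factor [- L]. *)
apply: le_trans; rewrite lerD2l lerD2l !mulNr lerN2 ler_wpM2l//.
exact: D_ineq.
Qed.

Lemma cross_maximum_principle s t : a < s -> s <= t -> t < b ->
  (forall x y, sigma * (u (inl x) s - u (inr y) s) <= L * D s (inl x) (inr y)) ->
  forall x y, sigma * (u (inl x) t - u (inr y) t) <= L * D t (inl x) (inr y).
Proof.
move=> as_ st tb ws x y.
have tauI tau : s <= tau <= t -> a < tau < b.
  by move=> /andP[? ?]; apply/andP; split; lra.
have cM : compact [set: M1 * M2].
  by rewrite -setXTT; exact: compact_setX.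
have := @maximum_principle R (M1 * M2)%type w s t 0 cM st.
have H z r : w r z <= 0 = (sigma * (u (inl z.1) r - u (inr z.2) r) <=
    L * D r (inl z.1) (inr z.2)).
  by rewrite /w -[RHS]subr_le0; congr (_ <= 0); ring.
move=> mp; rewrite -(H (x, y) t); apply: mp => [tau p|tau p|tau p|p].
- by move=> /tauI; exact: w_continuous.
- move=> /andP[? ?]; have tI : a < tau < b by apply: tauI; lra.
  by have [] := w_derive p tI.
- by move=> /andP[? ?]; apply: w_max; apply: tauI; lra.
- by rewrite H; exact: ws.
Qed.

End disjoint_union.

Theorem theorem1p2 (R : realType) (n : nat) (M1 M2 : topologicalType)
  (A1 : orientedManifold R n M1) (A2 : orientedManifold R n M2)
  (compactM1 : compact [set: M1]) (compactM2 : compact [set: M2])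
  (T1 T2 T : \bar R) (T1_gt0 : (0 < T1)%E) (T2_gt0 : (0 < T2)%E)
  (TE : T = Order.min T1 T2)
  (g1 : R -> tensor R n M1) (g2 : R -> tensor R n M2)
  (flow1 : is_ricci_flow A1 T1 g1) (flow2 : is_ricci_flow A2 T2 g2)
  (D : R -> M1 + M2 -> M1 + M2 -> R)
  (D_metric : forall t : R, 0 <= t -> (t%:E < T)%E ->
     is_complete_compact_metric (D t))
  (D_M1 : forall (t : R) (x y : M1), 0 <= t -> (t%:E < T)%E ->
     (D t (inl x) (inl y))%:E = riemannian_dist A1 (g1 t) x y)
  (D_M2 : forall (t : R) (x y : M2), 0 <= t -> (t%:E < T)%E ->
     (D t (inr x) (inr y))%:E = riemannian_dist A2 (g2 t) x y)
  (D_time : forall (t : R) (x : M1) (y : M2), 0 < t -> (t%:E < T)%E ->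
     derivable (fun s : R => D s (inl x) (inr y)) t 1)
  (D_space : forall t : R, 0 < t -> (t%:E < T)%E ->
     twice_differentiable_prod A1 A2 (fun x y => D t (inl x) (inr y)))
  (D_ineq : forall (t : R) (x : M1) (y : M2), 0 < t -> (t%:E < T)%E ->
     prod_laplacian A1 A2 (g1 t) (g2 t) (fun x y => D t (inl x) (inr y)) x y
     <= derive1 (fun s : R => D s (inl x) (inr y)) t) :
  is_super_ricci_flow A1 A2 g1 g2 T D.
Proof.
move=> a b u a0 ab bT [heat1 heat2] s t as_ st tb.
have [b1 b2] : (b%:E < T1)%E /\ (b%:E < T2)%E.
  by move: bT; rewrite TE lt_min => /andP.
have I tau : a < tau < b -> [/\ 0 <= tau, 0 < tau & (tau%:E < T)%E].
  move=> /andP[at_ taub]; split; [lra|lra|].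
  by apply: lt_trans bT; rewrite lte_fin.
have sI : a < s < b by apply/andP; split; lra.
have tI : a < t < b by apply/andP; split; lra.
have Dm tau : a < tau < b -> exists m : distance R (M1 + M2)%type, D tau = m.
  by move=> /I[t0 _ tT]; have [m [-> _ _]] := D_metric tau t0 tT; exists m.
have D_gt0 tau x y : a < tau < b -> x <> y -> 0 < D tau x y.
  move=> /Dm[m ->] xy; rewrite lt_neqAle distance_ge0 andbT eq_sym.
  by apply/negP => /eqP/dist_eq0.
apply: ge_ereal_sup => _ [x [y [xy ->]]].
(* An infinite constant at time [s] bounds everything, and the value [-oo] is excluded because the
   pair [x], [y] contributes a real quotient. *)
case LE : (Lip (D s) (u^~ s)) => [L| |]; last 2 first.
- by rewrite leey.
- have : ((`|u x s - u y s| / D s x y)%:E <= Lip (D s) (u^~ s))%E.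
    by apply: ereal_sup_ubound; exists x, y.
  by rewrite LE leeNy_eq.
have lip x' y' : `|u x' s - u y' s| <= L * D s x' y'.
  have [->|x'y'] := pselect (x' = y').
    have [m ->] := Dm s sI.
    by rewrite subrr normr0 dist_xx mulr0.
  have : ((`|u x' s - u y' s| / D s x' y')%:E <= Lip (D s) (u^~ s))%E.
    by apply: ereal_sup_ubound; exists x', y'.
  by rewrite LE lee_fin ler_pdivrMr ?D_gt0.
(* The distinct points [x] and [y] are at positive distance, so a negative [L] would contradict
   [lip]. *)
have L0 : 0 <= L.
  rewrite -(pmulr_lge0 _ (D_gt0 s x y sI xy)).
  exact: le_trans (normr_ge0 _) (lip x y).
rewrite lee_fin ler_pdivrMr ?D_gt0// {xy}.
have D_ge0 tau x' y' : a < tau < b -> 0 <= D tau x' y'.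
  by move=> /Dm[m ->]; exact: distance_ge0.
have dM1 tau x' y' : a < tau < b ->
  (D tau (inl x') (inl y'))%:E = riemannian_dist A1 (g1 tau) x' y'.
  by move=> /I[t0 _ tT]; exact: D_M1.
have dM2 tau x' y' : a < tau < b ->
  (D tau (inr x') (inr y'))%:E = riemannian_dist A2 (g2 tau) x' y'.
  by move=> /I[t0 _ tT]; exact: D_M2.
have cross x' y' : `|u (inl x') t - u (inr y') t| <= L * D t (inl x') (inr y').
  have mp sigma := @cross_maximum_principle R n M1 M2 A1 A2 compactM1 compactM2
    T1 T2 g1 g2 flow1 flow2 D a b a0 b1 b2 Dm dM1 dM2
    (fun tau x y tauI => let: And3 _ t0 tT := I tau tauI in D_time tau x y t0 tT)
    (fun tau tauI => let: And3 _ t0 tT := I tau tauI in D_space tau t0 tT)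
    (fun tau x y tauI => let: And3 _ t0 tT := I tau tauI in D_ineq tau x y t0 tT)
    u heat1 heat2 L sigma L0 s t as_ st tb.
  have m1 := mp 1 _ x' y'; have m2 := mp (-1) _ x' y'.
  rewrite ler_norml; apply/andP; split.
    have := m2; rewrite !mulN1r !opprB => H.
    suff : u (inr y') t - u (inl x') t <= L * D t (inl x') (inr y') by lra.
    apply: H => p q; rewrite mulN1r opprB; apply: le_trans (ler_norm _) _.
    by rewrite distrC; exact: lip.
  have := m1; rewrite !mul1r; apply => p q; rewrite mul1r.
  by apply: le_trans (ler_norm _) _; exact: lip.
case: x y => [x|x] [y|y].
- apply: (@heat_lipschitz _ _ _ A1 T1 g1 flow1 a b a0 b1 (fun p => u (inl p)) heat1
    (fun t x y => D t (inl x) (inl y)) dM1 _ s t L compactM1 as_ st tb L0) => // *.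
  exact: D_ge0.
- exact: cross.
- have [m E] := Dm t tI; rewrite distrC E dist_sym -E; exact: cross.
- apply: (@heat_lipschitz _ _ _ A2 T2 g2 flow2 a b a0 b2 (fun p => u (inr p)) heat2
    (fun t x y => D t (inr x) (inr y)) dM2 _ s t L compactM2 as_ st tb L0) => // *.
  exact: D_ge0.
Qed.
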